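(* Let $X_1,\dots,X_n$ be i.i.d. with distribution function $F$ and $Y_1,\dots,Y_m$ i.i.d. with distribution function $G$, the two samples being independent. Assume that $n,m\to\infty$ with $\frac{n}{m}\to\nu\in(0,\infty)$, that $F$ and $G$ have continuous densities $f$ and $g$, and that the slope $\frac{g(F^{-1}(t))}{f(F^{-1}(t))}$ of the ROC curve $t\mapsto G(F^{-1}(t))$ is bounded on every subinterval $(a,b)$ of $(0,1)$, $a<b\in(0,1)$. Let $\hat F_n^*$ and $\hat G_m^*$ be the empirical distribution functions of the bootstrap samples. Then the empirical bootstrap process of $\theta$ and $I_2$, $$\sqrt{n}\left(\begin{pmatrix}\hat\theta^*_{mn}\\ \hat I^*_{2,mn}\end{pmatrix}-\begin{pmatrix}\hat\theta_{mn}\\ \hat I_{2,mn}\end{pmatrix}\right),$$ where $$\hat\theta^*_{mn}=\int_0^1\hat G^*_m(\hat F_n^{*-1}(\alpha))\,d\alpha,\qquad \hat I^*_{2,mn}=\int_0^1\hat G^*_m(\hat F_n^{*-1}(1-\alpha/2))\,d\alpha-\int_0^1\hat G^*_m(\hat F_n^{*-1}(\alpha/2))\,d\alpha,$$ is asymptotically normally distributed, with limit distribution identical to that of $$\sqrt{n}\left(\begin{pmatrix}\hat\theta_{mn}\\ \hat I_{2,mn}\end{pmatrix}-\begin{pmatrix}\theta\\ I_2\end{pmatrix}\right).$$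
   Context: For a distribution function $F$ (including an empirical one), $F^{-1}(t)=\inf\{y:F(y)\ge t\}$. The relative effect is $\theta=\int G\,dF=\int_0^1 G(F^{-1}(\alpha))\,d\alpha$ and the overlap index of $G$ with respect to $F$ is $I_2=\int_0^1 G(F^{-1}(1-\alpha/2))\,d\alpha-\int_0^1 G(F^{-1}(\alpha/2))\,d\alpha$. Let $\hat F_n$ and $\hat G_m$ be the empirical distribution functions of $X_1,\dots,X_n$ and $Y_1,\dots,Y_m$. The plug-in estimators $\hat\theta_{mn}$ and $\hat I_{2,mn}$ are obtained by replacing $F,G$ by $\hat F_n,\hat G_m$ in these integral formulas: $$\hat\theta_{mn}=\int_0^1\hat G_m(\hat F_n^{-1}(\alpha))\,d\alpha,\qquad \hat I_{2,mn}=\int_0^1\hat G_m(\hat F_n^{-1}(1-\alpha/2))\,d\alpha-\int_0^1\hat G_m(\hat F_n^{-1}(\alpha/2))\,d\alpha .$$ Bootstrap samples: given the data, $X_1^*,\dots,X_n^*$ is an i.i.d. sample from $\hat F_n$ and $Y_1^*,\dots,Y_m^*$ is an i.i.d. sample from $\hat G_m$ (drawn independently of each other); $\hat F_n^*$ and $\hat G_m^*$ are the corresponding empirical distribution functions $\hat F_n^*(x)=\frac1n\sum_{i=1}^n \mathbf 1\{X_i^*\le x\}$ and $\hat G_m^*(y)=\frac1m\sum_{j=1}^m\mathbf 1\{Y_j^*\le y\}$. ''Asymptotically normally distributed with limit distribution $L$'' means convergence in distribution to the normal law $L$ as $n,m\to\infty$. *)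

(* Defs.v *)
From HB Require Import structures.
From mathcomp Require Export all_boot all_order all_algebra.
From mathcomp Require Export all_classical all_reals all_analysis.

Set Implicit Arguments.
Unset Strict Implicit.
Unset Printing Implicit Defensive.

Export Order.TTheory GRing.Theory Num.Theory.
Export numFieldNormedType.Exports.

#[global] Open Scope classical_set_scope.
#[global] Open Scope ring_scope.

Section functionals.
Context {R : realType}.
Local Notation lambda := (@lebesgue_measure R).

(* [inf] returns 0 on sets that are empty or not bounded below.  This affects
   only levels outside ]0, 1[ (a null set in the integrals below) and the
   empirical distribution function of an empty sample. *)
Definition quantile (F : R -> R) (t : R) : R := inf [set y | t <= F y].

Definition rel_effect (F G : R -> R) : R :=
  \int[lambda]_(a in `[0, 1]) G (quantile F a).

Definition overlap_index (F G : R -> R) : R :=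
  \int[lambda]_(a in `[0, 1]) G (quantile F (1 - a / 2)) -
  \int[lambda]_(a in `[0, 1]) G (quantile F (a / 2)).

Definition roc_slope (F f g : R -> R) (t : R) : R :=
  g (quantile F t) / f (quantile F t).

Definition continuous_density (F f : R -> R) : Prop :=
  [/\ continuous f, forall x, 0 <= f x &
      forall x, (F x)%:E = (\int[lambda]_(t in `]-oo, x]) (f t)%:E)%E].

Definition ecdf (n : nat) (x : nat -> R) (y : R) : R :=
  n%:R^-1 * \sum_(i < n) (x i <= y)%R%:R.

(* The probability of A under the empirical law, whose distribution function
   is [ecdf n x]. *)
Definition empirical_prob (n : nat) (x : nat -> R) (A : set R) : R :=
  n%:R^-1 * \sum_(i < n) \1_A (x i).

Definition rescaled_error (n : nat) (F' G' F G : R -> R) : R * R :=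
  (Num.sqrt n%:R * (rel_effect F' G' - rel_effect F G),
   Num.sqrt n%:R * (overlap_index F' G' - overlap_index F G)).

(* The library's [normal_prob m 0] is the uniform law on [0, 1], so the
   degenerate normal law has to be given separately, as a Dirac mass. *)
Definition normal_law (mu : set R -> \bar R) : Prop :=
  exists m s : R, 0 <= s /\
    forall A, measurable A ->
      mu A = if s == 0 then \d_m A else normal_prob m s A.

(* Possibly degenerate: every linear combination of the two coordinates is
   univariate normal. *)
Definition bivariate_normal (L : probability (R * R)%type R) : Prop :=
  forall a b : R, normal_law (pushforward L (fun z => a * z.1 + b * z.2)).

End functionals.

Section sampling.
Context {d : measure_display} {Omega : measurableType d} {R : realType}.
Implicit Type P : probability Omega R.

Definition mutually_independent P (I : eqType) (Z : I -> Omega -> R) : Prop :=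
  forall (s : seq I) (A : I -> set R), uniq s -> (forall i, measurable (A i)) ->
    P (\bigcap_(i in [set` s]) Z i @^-1` A i) =
    (\prod_(i <- s) fine (P (Z i @^-1` A i)))%:E.

(* The X's and the Y's as one family: its mutual independence says that each
   sample is independent and that the samples are independent of each other. *)
Definition two_samples (X Y : nat -> Omega -> R) (i : nat + nat) :
    Omega -> R :=
  match i with inl k => X k | inr k => Y k end.

(* sigma(X_0, ..., X_(n-1), Y_0, ..., Y_(m-1)) *)
Definition data_sigma (n m : nat) (X Y : nat -> Omega -> R) :
    set (set Omega) :=
  <<s [set E | (exists2 i, (i < n)%N &
                  preimage_set_system setT (X i) measurable E) \/
               (exists2 j, (j < m)%N &
                  preimage_set_system setT (Y j) measurable E)] >>.

(* Given the data, the first n of the Xs are i.i.d. from the empirical law of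
   the X's, the first m of the Ys are i.i.d. from that of the Y's, and the two
   are independent: the displayed product is the conditional probability of
   the rectangle given [data_sigma n m X Y]. *)
Definition bootstrap_samples P (n m : nat) (X Y Xs Ys : nat -> Omega -> R) :
    Prop :=
  forall (A B : nat -> set R) (D : set Omega),
    (forall i, measurable (A i)) -> (forall j, measurable (B j)) ->
    data_sigma n m X Y D ->
    P (D `&` \bigcap_(i in `I_n) Xs i @^-1` A i
         `&` \bigcap_(j in `I_m) Ys j @^-1` B j) =
    (\int[P]_(w in D)
       (\prod_(i < n) empirical_prob n (X ^~ w) (A i) *
        \prod_(j < m) empirical_prob m (Y ^~ w) (B j))%:E)%E.

(* W is a version of E[Z | S]. *)
Definition cond_expectation P (S : set (set Omega)) (Z W : Omega -> R) :
    Prop :=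
  [/\ P.-integrable setT (EFin \o W),
      forall B : set R, measurable B -> S (W @^-1` B) &
      forall D, S D ->
        (\int[P]_(w in D) (W w)%:E = \int[P]_(w in D) (Z w)%:E)%E].

Definition cvg_in_probability P (W : nat -> Omega -> R) (c : R) : Prop :=
  forall e : R, 0 < e -> P [set w | e <= `|W k w - c|] @[k --> \oo] --> 0%E.

Definition bounded_continuous (h : R * R -> R) : Prop :=
  continuous h /\ exists M : R, forall z, `|h z| <= M.

Definition cvg_in_distribution P (T : nat -> Omega -> R * R)
    (L : probability (R * R)%type R) : Prop :=
  forall h, bounded_continuous h ->
    (\int[P]_w h (T k w)) @[k --> \oo] --> (\int[L]_z h z).

(* Weak convergence, in probability, of the conditional law of T k given the
   sigma-algebra S k. *)
Definition cond_cvg_in_distribution P (S : nat -> set (set Omega))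
    (T : nat -> Omega -> R * R) (L : probability (R * R)%type R) : Prop :=
  forall h, bounded_continuous h ->
  forall W : nat -> Omega -> R,
    (forall k, cond_expectation P (S k) (h \o T k) (W k)) ->
    cvg_in_probability P W (\int[L]_z h z).

End sampling.

(* Main.v *)
(** The estimator of [theta] is a two-sample U-statistic with kernel
    1{y <= x}.  For U uniform, the laws of F^-1(1 - U/2) and F^-1(U/2) average
    to the law of X, so I_2 = 2 \int |G - G(x0)| dF with x0 the median of F,
    and the plug-in estimator of I_2 differs from the U-statistic with kernel
    2 |1{y <= x} - 1{y <= x0}| by at most 2 |2 Fhat(x0) - 1| times the
    oscillation of Ghat near x0, which is o(n^(-1/2)) in L1.  This replaces the
    differentiation of the ROC process.

    For bounded kernels, the Hoeffding projection and Lindeberg's replacement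
    argument give an explicit bound on
    E cos(a U_1 + b U_2 + c) - exp(-Q(a, b) / 2) cos c that is uniform over all
    pairs of laws.  It therefore also applies, conditionally on the data, to
    the resampled variables, whose laws are the empirical ones; the variances
    of the latter converge to Q in L1.  Trigonometric polynomials are dense
    enough to turn these bounds into weak convergence.  The conditional law
    given the data is the average over all resampling maps. *)
From HB Require Import structures.
Require Import Defs.
From mathcomp Require Import measurable_realfun normal_distribution uniform_distribution.
From mathcomp Require Import ring lra.

Set Implicit Arguments.
Unset Strict Implicit.
Unset Printing Implicit Defensive.

(** * Means of bounded measurable functions *)

(** The laws from which the bootstrap draws change with the data, so a limit theorem for one fixed
    pair of laws cannot be applied to them. Each distributional estimate is therefore explicit in n
    and m, with constants chosen before the probability space, and limits are taken at the very end.

    The U-statistic that stands in for I_2 uses the same nonrandom centre [x0] for the samples and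
    for the bootstrap samples. Since [x0] need not be a median of the empirical law, two remainders
    occur in the bootstrap, one from the resample and one from the data. Both are bounded in mean
    from two facts that samples and bootstrap samples share: a mean square error of order 1/n of the
    first empirical distribution function at a point, and unbiasedness of the second.

    The infimum in [quantile] hides how I_2 depends on the data. I_2 is the minimum over c of 2
    E|G(X) - c|, attained at the median; for empirical laws it becomes a minimum over sample points,
    which gives both measurability and the sign of the remainders. *)

Section bounded_measurable.
Context {d : measure_display} {T : measurableType d} {R : realType}.
Implicit Types f g : T -> R.

(** The statistics involved are bounded for fixed sample sizes. Within this class, which is closed
    under algebraic operations, [mean] is linear under any probability without integrability side
    conditions. *)
Definition bmfun f := measurable_fun setT f /\ exists M, forall x, `|f x| <= M.

Lemma bmfun_bound f : bmfun f -> exists2 M, 0 < M & forall x, `|f x| <= M.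
Proof.
case=> _ [M fM]; exists (`|M| + 1); first by rewrite ltr_wpDl.
by move=> x; rewrite (le_trans (fM x))// (le_trans (ler_norm M))// lerDl.
Qed.

Lemma eq_bmfun f g : f =1 g -> bmfun g -> bmfun f.
Proof. by move=> /funext ->. Qed.

Lemma bmfun_cst c : bmfun (fun=> c : R).
Proof. by split; [exact: measurable_cst | exists `|c|]. Qed.

Lemma bmfunD f g : bmfun f -> bmfun g -> bmfun (fun x => f x + g x).
Proof.
move=> [mf [M fM]] [mg [N gN]]; split; first exact: measurable_funD.
by exists (M + N) => x; rewrite (le_trans (ler_normD _ _))// lerD.
Qed.

Lemma bmfunN f : bmfun f -> bmfun (fun x => - f x).
Proof.
move=> [mf [M fM]]; split; first exact: measurableT_comp.
by exists M => x; rewrite normrN.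
Qed.

Lemma bmfunB f g : bmfun f -> bmfun g -> bmfun (fun x => f x - g x).
Proof. by move=> bf /bmfunN; exact: bmfunD. Qed.

Lemma bmfunM f g : bmfun f -> bmfun g -> bmfun (fun x => f x * g x).
Proof.
move=> [mf [M fM]] [mg [N gN]]; split; first exact: measurable_funM.
by exists (M * N) => x; rewrite normrM ler_pM.
Qed.

Lemma bmfunZ c f : bmfun f -> bmfun (fun x => c * f x).
Proof. by move=> bf; apply: bmfunM => //; exact: bmfun_cst. Qed.

Lemma bmfunX n f : bmfun f -> bmfun (fun x => f x ^+ n).
Proof.
move=> bf; elim: n => [|n IH]; first exact: bmfun_cst.
by under eq_fun do rewrite exprS; exact: bmfunM.
Qed.

Lemma bmfun_norm f : bmfun f -> bmfun (fun x => `|f x|).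
Proof.
move=> [mf [M fM]]; split; first exact: measurableT_comp.
by exists M => x; rewrite normr_id.
Qed.

Lemma bmfun_sum (I : Type) (s : seq I) (Q : pred I) (F : I -> T -> R) :
  (forall i, Q i -> bmfun (F i)) -> bmfun (fun x => \sum_(i <- s | Q i) F i x).
Proof.
move=> bF; elim: s => [|i s IH].
  by apply: (eq_bmfun _ (bmfun_cst 0)) => x; rewrite big_nil.
apply: (@eq_bmfun _
  (fun x => if Q i then F i x + \sum_(j <- s | Q j) F j x
            else \sum_(j <- s | Q j) F j x)) => [x|]; first by rewrite big_cons.
by case: (boolP (Q i)) => // Qi; apply: bmfunD => //; exact: bF.
Qed.

Lemma bmfun_prod (I : Type) (s : seq I) (Q : pred I) (F : I -> T -> R) :
  (forall i, Q i -> bmfun (F i)) -> bmfun (fun x => \prod_(i <- s | Q i) F i x).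
Proof.
move=> bF; elim: s => [|i s IH].
  by apply: (eq_bmfun _ (bmfun_cst 1)) => x; rewrite big_nil.
apply: (@eq_bmfun _
  (fun x => if Q i then F i x * \prod_(j <- s | Q j) F j x
            else \prod_(j <- s | Q j) F j x)) => [x|]; first by rewrite big_cons.
by case: (boolP (Q i)) => // Qi; apply: bmfunM => //; exact: bF.
Qed.

Lemma bmfun_indic A : measurable A -> bmfun (\1_A : T -> R).
Proof.
move=> mA; split; first exact: measurable_indic.
by exists 1 => x; rewrite indicE; case: (_ \in _); rewrite ?normr0 ?normr1.
Qed.

Lemma bmfun_comp d' (T' : measurableType d') (u : T -> T') (f : T' -> R) :
  measurable_fun setT u -> measurable_fun setT f ->
  (exists M, forall x, `|f x| <= M) -> bmfun (fun x => f (u x)).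
Proof.
move=> mu mf [M fM]; split; first exact: (measurableT_comp mf mu).
by exists M => x; exact: fM.
Qed.

Lemma bmfun_cos f : measurable_fun setT f -> bmfun (fun x => cos (f x)).
Proof.
move=> mf; apply: bmfun_comp => //; last by exists 1 => x; exact: cos_max.
by apply: continuous_measurable_fun; exact: continuous_cos.
Qed.

Lemma bmfun_sin f : measurable_fun setT f -> bmfun (fun x => sin (f x)).
Proof.
move=> mf; apply: bmfun_comp => //; last by exists 1 => x; exact: sin_max.
by apply: continuous_measurable_fun; exact: continuous_sin.
Qed.

Lemma bmfun_meas f : bmfun f -> measurable_fun setT f. Proof. by case. Qed.

End bounded_measurable.

Lemma bmfun_compr {d d'} {T : measurableType d} {T' : measurableType d'}
    {R : realType} (u : T -> T') (f : T' -> R) :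
  measurable_fun setT u -> bmfun f -> bmfun (fun x => f (u x)).
Proof. by move=> mu [mf bf]; exact: bmfun_comp. Qed.

Section mean.
Context {d : measure_display} {T : measurableType d} {R : realType}.
Variable P : probability T R.
Implicit Types f g : T -> R.

Definition mean f : R := \int[P]_w f w.

Lemma bmfun_integrable f : bmfun f -> P.-integrable setT (EFin \o f).
Proof.
move=> [mf [M fM]]; apply: measurable_bounded_integrable => //.
  by rewrite (le_lt_trans (probability_le1 _ _))// ltry.
by exists M; split=> [|t Mt x _]; [exact: num_real|rewrite /= (le_trans (fM x))// ltW].
Qed.

Lemma EFin_mean f : bmfun f -> (mean f)%:E = (\int[P]_w (f w)%:E)%E.
Proof.
by move=> bf; rewrite /mean /Rintegral fineK//;
  apply: integrable_fin_num => //; exact: bmfun_integrable.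
Qed.

Lemma eq_mean f g : f =1 g -> mean f = mean g.
Proof. by move=> fg; congr mean; exact/funext. Qed.

Lemma mean_cst c : mean (fun=> c) = c.
Proof. by rewrite /mean Rintegral_cst//= probability_setT mulr1. Qed.

Lemma meanD f g : bmfun f -> bmfun g ->
  mean (fun x => f x + g x) = mean f + mean g.
Proof. by move=> bf bg; rewrite /mean RintegralD//; exact: bmfun_integrable. Qed.

Lemma meanB f g : bmfun f -> bmfun g ->
  mean (fun x => f x - g x) = mean f - mean g.
Proof. by move=> bf bg; rewrite /mean RintegralB//; exact: bmfun_integrable. Qed.

Lemma meanZ c f : bmfun f -> mean (fun x => c * f x) = c * mean f.
Proof. by move=> bf; rewrite /mean RintegralZl//; exact: bmfun_integrable. Qed.

Lemma le_mean f g : bmfun f -> bmfun g -> (forall x, f x <= g x) ->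
  mean f <= mean g.
Proof.
by move=> bf bg fg; apply: le_Rintegral => //; exact: bmfun_integrable.
Qed.

Lemma mean_ge0 f : (forall x, 0 <= f x) -> 0 <= mean f.
Proof. by move=> f0; apply: Rintegral_ge0 => x _; exact: f0. Qed.

Lemma le_mean_cst f c : bmfun f -> (forall x, f x <= c) -> mean f <= c.
Proof.
move=> bf fc; rewrite -[leRHS](mean_cst c); apply: le_mean => //.
exact: bmfun_cst.
Qed.

Lemma norm_mean f : bmfun f -> `|mean f| <= mean (fun x => `|f x|).
Proof. by move=> bf; apply: le_normr_Rintegral => //; exact: bmfun_integrable. Qed.

Lemma norm_mean_le f c : bmfun f -> (forall x, `|f x| <= c) -> `|mean f| <= c.
Proof.
move=> bf fc; rewrite (le_trans (norm_mean _))//.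
by apply: le_mean_cst => //; exact: bmfun_norm.
Qed.

Lemma mean_sum (I : Type) (s : seq I) (Q : pred I) (F : I -> T -> R) :
  (forall i, Q i -> bmfun (F i)) ->
  mean (fun x => \sum_(i <- s | Q i) F i x) = \sum_(i <- s | Q i) mean (F i).
Proof.
move=> bF; elim: s => [|i s IH].
  by rewrite big_nil; under eq_mean do rewrite big_nil; rewrite mean_cst.
rewrite big_cons; under eq_mean do rewrite big_cons.
case: ifP => // Qi; rewrite meanD ?IH//; first exact: bF.
exact: bmfun_sum.
Qed.

Lemma mean_indic A : measurable A -> mean \1_A = fine (P A).
Proof. by move=> mA; rewrite /mean /Rintegral integral_indic// setIT. Qed.

Lemma mean_sqr f : bmfun f -> mean f ^+ 2 <= mean (fun x => f x ^+ 2).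
Proof.
move=> bf; have := mean_ge0 (fun x => sqr_ge0 (f x - mean f)).
have -> : mean (fun x => (f x - mean f) ^+ 2) =
          mean (fun x => f x ^+ 2 - (2 * mean f) * f x + mean f ^+ 2).
  by apply: eq_mean => x; ring.
rewrite meanD; [|by apply: bmfunB; [exact: bmfunX|exact: bmfunZ]|exact: bmfun_cst].
rewrite meanB; [|exact: bmfunX|exact: bmfunZ].
rewrite meanZ// mean_cst; lra.
Qed.

(** Jensen's inequality for the square. This is how the L2 bounds coming from orthogonality become
    the L1 bounds that the remainders need. *)
Lemma mean_norm_sqrt f c : bmfun f -> 0 <= c -> mean (fun x => f x ^+ 2) <= c ^+ 2 ->
  mean (fun x => `|f x|) <= c.
Proof.
move=> bf c0 fc; rewrite -(@ler_pXn2r _ 2)// ?nnegrE ?mean_ge0//.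
rewrite (le_trans (mean_sqr _))//; first exact: bmfun_norm.
by under eq_mean do rewrite real_normK ?num_real//.
Qed.

End mean.

(** Bundles a function with its measurability proof, so that [distribution] can push a law forward
    along it. *)
Definition mfun_of {d d'} {T : measurableType d} {T' : measurableType d'}
    (f : T -> T') (mf : measurable_fun setT f) : {mfun T >-> T'} :=
  HB.pack f (isMeasurableFun.Build _ _ _ _ f mf).

Section pushforward_and_product.
Context {d d' : measure_display} {T : measurableType d} {T' : measurableType d'}.
Context {R : realType}.

Lemma mean_distribution (P : probability T R) (X : {mfun T >-> T'}) (f : T' -> R) :
  bmfun f -> mean (distribution P X) f = mean P (f \o X).
Proof.
move=> bf; rewrite /mean /Rintegral integral_distribution//.
  by apply/measurable_EFinP; exact: bmfun_meas.
apply: (@bmfun_integrable _ _ _ _ (f \o X)).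
exact: (@bmfun_compr _ _ _ _ _ X).
Qed.

Lemma eq_mean_measure (P Q : probability T R) (f : T -> R) :
  (forall A, measurable A -> P A = Q A) -> mean P f = mean Q f.
Proof.
by move=> PQ; congr fine; apply: eq_measure_integral => A mA _; exact: PQ.
Qed.

Context (P : probability T R) (Q : probability T' R).

Lemma bmfun_mean1 (f : T * T' -> R) : bmfun f ->
  bmfun (fun x => mean Q (fun y => f (x, y))).
Proof.
move=> bf; have [M M0 fM] := bmfun_bound bf.
have bfx x : bmfun (fun y => f (x, y)).
  exact: (@bmfun_compr _ _ _ _ _ (pair x)).
split; last by exists M => x; apply: norm_mean_le => // y.
apply/measurable_EFinP.
rewrite (_ : _ \o _ = fun x => \int[Q]_y (f (x, y))%:E)%E; last first.
  by apply/funext => x /=; rewrite EFin_mean.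
apply: (@measurable_fubini_F _ _ _ _ _ P Q (EFin \o f)).
exact: bmfun_integrable.
Qed.

Lemma mean_prod (f : T * T' -> R) : bmfun f ->
  mean (P \x Q)%E f = mean P (fun x => mean Q (fun y => f (x, y))).
Proof.
move=> bf.
have bfx x : bmfun (fun y => f (x, y)).
  exact: (@bmfun_compr _ _ _ _ _ (pair x)).
apply: EFin_inj; rewrite !EFin_mean//; last exact: bmfun_mean1.
under [RHS]eq_integral do rewrite EFin_mean//.
rewrite -(@integral12_prod_meas1 _ _ _ _ _ P Q (EFin \o f))//.
exact: (@bmfun_integrable _ _ _ (P \x Q)%E).
Qed.

Lemma mean_prod_swap (f : T * T' -> R) : bmfun f ->
  mean (P \x Q)%E f = mean Q (fun y => mean P (fun x => f (x, y))).
Proof.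
move=> bf.
have bfy y : bmfun (fun x => f (x, y)).
  exact: (@bmfun_compr _ _ _ _ _ (pair^~ y)).
apply: EFin_inj; rewrite !EFin_mean//; last first.
  have [M M0 fM] := bmfun_bound bf.
  split; last by exists M => y; apply: norm_mean_le.
  apply/measurable_EFinP.
  rewrite (_ : _ \o _ = fun y => \int[P]_x (f (x, y))%:E)%E; last first.
    by apply/funext => y /=; rewrite EFin_mean.
  apply: (@measurable_fubini_G _ _ _ _ _ P Q (EFin \o f)).
  exact: (@bmfun_integrable _ _ _ (P \x Q)%E).
under [RHS]eq_integral do rewrite EFin_mean//.
rewrite -(@integral21_prod_meas1 _ _ _ _ _ P Q (EFin \o f))//.
exact: (@bmfun_integrable _ _ _ (P \x Q)%E).
Qed.

End pushforward_and_product.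

(** * Approximation by trigonometric polynomials *)

Section bernstein.
Context {R : realType}.

(* [bern N phi p] is the mean of [phi] under the binomial law (N, p). *)
Fixpoint bern (N : nat) (phi : nat -> R) (p : R) : R :=
  if N is N'.+1 then (1 - p) * bern N' phi p + p * bern N' (phi \o S) p
  else phi 0%N.

Lemma bern_cst N c p : bern N (fun=> c) p = c.
Proof. by elim: N => //= N; rewrite /comp /= => ->; ring. Qed.

Lemma bernD N phi psi p :
  bern N (fun k => phi k + psi k) p = bern N phi p + bern N psi p.
Proof. by elim: N phi psi => //= N IH phi psi; rewrite /comp !IH; ring. Qed.

Lemma bernZ N c phi p : bern N (fun k => c * phi k) p = c * bern N phi p.
Proof. by elim: N phi => //= N IH phi; rewrite /comp !IH; ring. Qed.

Lemma le_bern N phi psi p : 0 <= p <= 1 ->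
  (forall k, (k <= N)%N -> phi k <= psi k) -> bern N phi p <= bern N psi p.
Proof.
move=> /andP[p0 p1]; elim: N phi psi => [|N IH] phi psi le /=; first exact: le.
apply: lerD; (apply: ler_wpM2l; first by rewrite ?subr_ge0); apply: IH => k kN.
  by apply: le; rewrite (leq_trans kN).
exact: le.
Qed.

(** Variance plus squared bias. The centre [c] is arbitrary because a success in the first trial
    replaces it by [c - 1]. *)
Lemma bern_sqr N c p :
  bern N (fun k => (k%:R - c) ^+ 2) p = N%:R * p * (1 - p) + (N%:R * p - c) ^+ 2.
Proof.
elim: N c => [|N IH] c /=; first by ring.
rewrite IH (_ : _ \o _ = fun k => (k%:R - (c - 1)) ^+ 2); last first.
  by apply/funext => k /=; rewrite -natr1; congr (_ ^+ 2); ring.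
by rewrite IH -natr1; ring.
Qed.

Lemma norm_bern N phi c p : 0 <= p <= 1 ->
  `|bern N phi p - c| <= bern N (fun k => `|phi k - c|) p.
Proof.
move=> /andP[p0 p1]; elim: N phi => //= N IH phi.
have -> : (1 - p) * bern N phi p + p * bern N (phi \o S) p - c =
  (1 - p) * (bern N phi p - c) + p * (bern N (phi \o S) p - c) by ring.
rewrite (le_trans (ler_normD _ _))// !normrM (ger0_norm p0).
rewrite (ger0_norm (_ : 0 <= 1 - p)) ?subr_ge0//.
by apply: lerD; apply: ler_wpM2l; rewrite ?subr_ge0.
Qed.

(** Bernstein's proof of the Weierstrass theorem: the quadratic penalty has binomial mean K p (1 -
    p) / N, and p (1 - p) <= 1. *)
Lemma bern_approx N phi c p e K : (0 < N)%N -> 0 <= p <= 1 -> 0 <= K ->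
  (forall k, (k <= N)%N -> `|phi k - c| <= e + K * (k%:R / N%:R - p) ^+ 2) ->
  `|bern N phi p - c| <= e + K / N%:R.
Proof.
move=> N0 p01 K0 le; rewrite (le_trans (norm_bern _ _ _ p01))//.
rewrite (le_trans (le_bern p01 le))//.
have NN : N%:R != 0 :> R by rewrite pnatr_eq0 -lt0n.
rewrite bernD bern_cst bernZ lerD2l ler_wpM2l//.
rewrite [X in bern _ X _](_ : _ =
    fun k => N%:R ^- 2 * (k%:R - N%:R * p) ^+ 2); last first.
  by apply/funext => k; field.
rewrite bernZ bern_sqr subrr expr0n addr0.
have -> : N%:R ^- 2 * (N%:R * p * (1 - p)) = (p * (1 - p)) * N%:R^-1 :> R.
  by field.
rewrite ler_piMl ?invr_ge0 ?ler0n//; nra.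
Qed.

End bernstein.

Section trigonometric_polynomials.
Context {R : realType}.
Implicit Types (f g : R * R -> R) (t : R * R * R * R).

(** [t] lists the coefficient, the two frequencies and the phase. With a free phase, sines and
    products of cosines are again sums of cosines, so cosines alone carry the information of a
    characteristic function. *)
Definition trigmono t (z : R * R) :=
  t.1.1.1 * cos (t.1.1.2 * z.1 + t.1.2 * z.2 + t.2).

Definition trigpoly f := exists l, forall z, f z = \sum_(t <- l) trigmono t z.

Lemma trigpoly_cst c : trigpoly (fun=> c).
Proof.
exists [:: (c, 0, 0, 0)] => z; rewrite big_seq1 /trigmono /=.
by rewrite !mul0r !addr0 cos0 mulr1.
Qed.

Lemma trigpolyD f g : trigpoly f -> trigpoly g -> trigpoly (fun z => f z + g z).
Proof. by move=> [l fl] [l' gl]; exists (l ++ l') => z; rewrite big_cat/= fl gl. Qed.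

(** 2 cos A cos B = cos (A + B) + cos (A - B); [mul 1] and [mul (-1)] produce the two families of
    frequencies. *)
Lemma trigpolyM f g : trigpoly f -> trigpoly g -> trigpoly (fun z => f z * g z).
Proof.
move=> [l fl] [l' gl].
pose mul (s : R) t t' : R * R * R * R :=
  (t.1.1.1 * t'.1.1.1 / 2, t.1.1.2 + s * t'.1.1.2, t.1.2 + s * t'.1.2,
   t.2 + s * t'.2).
exists ([seq mul 1 t t' | t <- l, t' <- l'] ++
        [seq mul (-1) t t' | t <- l, t' <- l']) => z.
rewrite fl gl big_distrlr/= big_cat/= !big_allpairs_dep/= -big_split/=.
apply: eq_bigr => t _; rewrite -big_split/=; apply: eq_bigr => t' _.
rewrite /trigmono /=.
set A := t.1.1.2 * z.1 + t.1.2 * z.2 + t.2.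
set B := t'.1.1.2 * z.1 + t'.1.2 * z.2 + t'.2.
rewrite (_ : _ + _ + (t.2 + 1 * _) = A + B); last by rewrite /A /B; ring.
rewrite (_ : _ + _ + (t.2 + -1 * _) = A - B); last by rewrite /A /B; ring.
by rewrite (cosD A) (cosB A); field.
Qed.

Lemma trigpoly_sin (a b : R) : trigpoly (fun z => sin (a * z.1 + b * z.2)).
Proof.
exists [:: (1, a, b, - (pi / 2))] => z.
by rewrite big_seq1 /trigmono /= cosBpihalf mul1r.
Qed.

Lemma trigpoly_bern N (phi : nat -> R * R -> R) f :
  (forall k, trigpoly (phi k)) -> trigpoly f ->
  trigpoly (fun z => bern N (phi^~ z) (f z)).
Proof.
move=> + tf; elim: N phi => [|N IH] phi tphi /=; first exact: tphi.
apply: trigpolyD; apply: trigpolyM => //.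
- apply: trigpolyD; first exact: trigpoly_cst.
  have [l fl] := trigpolyM (trigpoly_cst (-1)) tf.
  by exists l => z; rewrite -fl; ring.
- exact: IH.
- by apply: (IH (phi \o S)) => k; exact: tphi.
Qed.

End trigonometric_polynomials.

Section approximation.
Context {R : realType}.

(** Mean value theorem, the cosine being at least [cos 1] on [-1, 1]. *)
Lemma sin_bilipschitz (u v : R) : -1 <= u <= 1 -> -1 <= v <= 1 ->
  cos 1 * `|u - v| <= `|sin u - sin v|.
Proof.
wlog uv : u v / u <= v => [H u1 v1|].
  have [uv|/ltW vu] := leP u v; first exact: H.
  by rewrite distrC [leRHS]distrC; exact: H.
move=> /andP[u1 u1'] /andP[v1 v1'].
have [c cuv E] : exists2 c, c \in `[u, v]%R & sin v - sin u = cos c * (v - u).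
  apply: (@MVT_segment _ sin cos) => //.
  by apply/continuous_subspaceT => x; exact: continuous_sin.
move: cuv; rewrite in_itv/= => /andP[uc cv].
rewrite distrC [leRHS]distrC E normrM ler_wpM2r//.
rewrite (le_trans _ (ler_norm _))// -[leRHS]cos_norm.
have c1 : `|c| <= 1 by rewrite ler_norml; lra.
have pi1 : 1 <= pi :> R by rewrite (le_trans _ (pi_ge2 _))//; lra.
have [->//|c1'] := eqVneq (`|c|) 1.
apply: ltW; rewrite ltr_cos ?lt_neqAle ?c1' ?c1// in_itv/= ?normr_ge0 ?ler01//=.
exact: le_trans pi1.
Qed.

(** [v] is the preimage of [s] under u -> (1 + sin u) / 2 if there is one in [-1, 1], and the nearer
    endpoint otherwise. Projecting [2 * s - 1] onto the range of the sine only brings it closer to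
    [sin u], after which [sin_bilipschitz] applies. *)
Lemma sin_near_inverse (s : R) : 0 <= s <= 1 -> exists2 v : R, -1 <= v <= 1 &
  forall u, -1 <= u <= 1 -> cos 1 * `|u - v| <= 2 * `|s - (1 + sin u) / 2|.
Proof.
move=> /andP[s0 s1].
have le1 : -1 <= 1 :> R by lra.
have key v u : -1 <= v <= 1 -> -1 <= u <= 1 ->
    `|sin u - sin v| <= `|sin u - (2 * s - 1)| ->
    cos 1 * `|u - v| <= 2 * `|s - (1 + sin u) / 2|.
  move=> v1 u1 le; rewrite (le_trans (sin_bilipschitz u1 v1))//.
  rewrite (le_trans le)// (_ : sin u - _ = - (2 * (s - (1 + sin u) / 2))).
    by rewrite normrN normrM ger0_norm.
  by field.
have mono x y : -1 <= x <= 1 -> -1 <= y <= 1 -> x <= y -> sin x <= sin y :> R.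
  move=> x1 y1; rewrite le_eqVlt => /orP[/eqP->//|xy].
  have := pi_ge2 R => pi2.
  by apply: ltW; rewrite ltr_sin// in_itv/=; lra.
have [sl|sl] := leP (2 * s - 1) (sin (-1)).
  exists (-1); first lra.
  move=> u u1; apply: key => //; first lra.
  have := mono (-1) u; rewrite u1 => /(_ _ _ _); move=> H.
  have {}H : sin (-1) <= sin u by apply: H => //; lra.
  by rewrite !ger0_norm; lra.
have [sr|sr] := leP (sin 1) (2 * s - 1).
  exists 1; first lra.
  move=> u u1; apply: key => //; first lra.
  have H : sin u <= sin 1 by apply: mono => //; lra.
  by rewrite !ler0_norm; lra.
have [v] : exists2 c, c \in `[-1, 1]%R & sin c = 2 * s - 1.
  apply: IVT => //; first by apply/continuous_subspaceT => x; exact: continuous_sin.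
  by rewrite ge_min le_max (ltW sl) (ltW sr) orbT.
rewrite in_itv/= => v1 sv; exists v => // u u1; apply: key => //.
by rewrite sv.
Qed.

Lemma uniform_continuity_box (h : R * R -> R) (tau e : R) : continuous h -> 0 < e ->
  exists2 dl : R, 0 < dl & forall x y x' y' : R, `|x| <= tau -> `|y| <= tau ->
    `|x' - x| < dl -> `|y' - y| < dl -> `|h (x', y') - h (x, y)| < e.
Proof.
move=> ch e0.
have cK : compact ([set` `[- tau, tau]] `*` [set` `[- tau, tau]] : set (R * R)).
  by apply: compact_setX; exact: segment_compact.
have /(_ R 0^'+ (fun dl z => forall z' : R * R, `|z'.1 - z.1| < dl ->
    `|z'.2 - z.2| < dl -> `|h z' - h z| < e)) := (compact_near_coveringP _).1 cK.
case.
- move=> z _.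
  have /cvgrPdist_lt/(_ (e / 2)) := ch z; rewrite divr_gt0// => /(_ isT).
  move=> /nbhs_ballP[r /= r0 hr].
  have r20 : 0 < r / 2 by rewrite divr_gt0.
  exists (ball z (r / 2), [set dl | dl < r / 2]).
    split; first exact: nbhsx_ballx.
    exact: nbhs_right_lt.
  move=> [z' dl] /= [[zz1 zz2] dlr] w w1 w2.
  rewrite /ball/= in zz1 zz2.
  have -> : h w - h z' = (h z - h z') - (h z - h w) by ring.
  rewrite (le_lt_trans (ler_normB _ _))// [e]splitr ltrD//; apply: hr.
    by split; rewrite /ball/= (lt_trans zz1,lt_trans zz2)// ltr_pdivrMr// ltr_pMr// ltr1n.
  split; rewrite /ball/=.
    rewrite (_ : z.1 - w.1 = (z.1 - z'.1) - (w.1 - z'.1)); last by ring.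
    by rewrite (le_lt_trans (ler_normB _ _))// [r]splitr ltrD// (lt_trans w1).
  rewrite (_ : z.2 - w.2 = (z.2 - z'.2) - (w.2 - z'.2)); last by ring.
  by rewrite (le_lt_trans (ler_normB _ _))// [r]splitr ltrD// (lt_trans w2).
- move=> dl0 /= dl00 H; exists (dl0 / 2); first by rewrite divr_gt0.
  move=> x y x' y' xt yt xx yy; apply: (H (dl0 / 2)) => //=.
  + by rewrite sub0r normrN gtr0_norm ?divr_gt0// ltr_pdivrMr// ltr_pMr// ltr1n.
  + by rewrite divr_gt0.
  + by rewrite /= !in_itv/= -!ler_norml.
Qed.

Lemma norm_bern_le N (phi : nat -> R) M p : 0 <= p <= 1 ->
  (forall k, `|phi k| <= M) -> `|bern N phi p| <= M.
Proof.
move=> p01 le; rewrite -[bern _ _ _]subr0 (le_trans (norm_bern _ _ _ p01))//.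
rewrite -[leRHS](bern_cst N M p) le_bern// => k _; by rewrite subr0.
Qed.

(** A Bernstein polynomial in each coordinate, composed with u -> (1 + sin (u / tau)) / 2. Being an
    average of values of [h], it obeys the bound [M] on the whole plane and not just in the box;
    this is what makes mass outside the box harmless later. *)
Lemma trig_approximation (h : R * R -> R) (M tau e : R) :
  continuous h -> (forall z, `|h z| <= M) -> 0 < tau -> 0 < e ->
  exists p, [/\ trigpoly p, forall z, `|p z| <= M &
    forall z, `|z.1| <= tau -> `|z.2| <= tau -> `|p z - h z| <= e].
Proof.
move=> ch hM tau0 e0.
have M0 : 0 <= M by rewrite (le_trans _ (hM 0)).
have e20 : 0 < e / 2 by rewrite divr_gt0.
have [dl dl0 hdl] := uniform_continuity_box tau ch e20.
have k0 : 0 < cos 1 :> R := cos1_gt0 R.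
(* [c] converts an error in sine level into a distance: a node at distance at least [dl] has level
   error at least [dl / c], and then [K] times its square is at least [2 * M], the largest
   difference between two values of [h]. *)
pose c : R := 2 * tau / cos 1; have c0 : 0 < c by rewrite !divr_gt0 ?mulr_gt0.
pose K : R := 2 * M * (c / dl) ^+ 2.
have K0 : 0 <= K by rewrite mulr_ge0 ?sqr_ge0 ?mulr_ge0.
(* Each coordinate costs [K / N <= e / 4]; uniform continuity takes the remaining [e / 2]. *)
pose N := (Num.truncn (4 * K / e)).+1.
have N0 : (0 < N)%N by [].
have KN : K / N%:R <= e / 4.
  rewrite ler_pdivrMr ?ltr0n//; have := truncnS_gt (4 * K / e).
  by rewrite ltr_pdivrMr// -/N; lra.
have node k : {v : R | -1 <= v <= 1 & (k <= N)%N -> forall u, -1 <= u <= 1 ->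
    cos 1 * `|u - v| <= 2 * `|k%:R / N%:R - (1 + sin u) / 2| }.
  apply: cid2; have [kN|kN] := leqP k N; last by exists 0 => //; lra.
  have [|v v1 hv] := @sin_near_inverse (k%:R / N%:R).
    by rewrite divr_ge0 ?ler0n// ler_pdivrMr ?ltr0n// mul1r ler_nat.
  by exists v.
pose x k : R := tau * s2val (node k).
have close k u dx : (k <= N)%N -> `|u| <= tau -> 
    dx = k%:R / N%:R - (1 + sin (tau^-1 * u)) / 2 ->
    `|x k - u| < dl \/ 2 * M <= K * dx ^+ 2.
  move=> kN ut dxE; rewrite /x; case: (node k) => /= v v1 /(_ kN) hv.
  have [?|far] := ltP `|tau * v - u| dl; [by left|right].
  have tu1 : -1 <= tau^-1 * u <= 1.
    by rewrite -ler_norml normrM gtr0_norm ?invr_gt0// mulrC ler_pdivrMr// mul1r.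
  have := hv _ tu1; rewrite -dxE => {}hv.
  have E : `|tau^-1 * u - v| = tau^-1 * `|tau * v - u|.
    rewrite (_ : _ - v = tau^-1 * (u - tau * v)); last by field; rewrite gt_eqF.
    by rewrite normrM gtr0_norm ?invr_gt0// distrC.
  have dlc : dl <= c * `|dx|.
    rewrite (le_trans far)// /c mulrAC ler_pdivlMr// mulrC.
    rewrite -(@ler_pM2l _ tau^-1) ?invr_gt0// mulrCA -E.
    rewrite (le_trans hv)// le_eqVlt; apply/orP; left; apply/eqP; field.
    by rewrite gt_eqF.
  rewrite /K -mulrA -exprMn ler_peMr ?mulr_ge0// -[(c / dl * dx) ^+ 2]real_normK ?num_real//.
  rewrite exprn_ege1// normrM (gtr0_norm (divr_gt0 c0 dl0)).
  by rewrite mulrAC ler_pdivlMr// mul1r.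
pose q (u : R) := (1 + sin (tau^-1 * u)) / 2.
have q01 u : 0 <= q u <= 1.
  have := sin_geN1 (tau^-1 * u); have := sin_le1 (tau^-1 * u).
  by rewrite /q; lra.
exists (fun z => bern N (fun k => bern N (fun l => h (x k, x l)) (q z.2)) (q z.1)).
split.
- have tq a b : trigpoly (fun z : R * R => (1 + sin (a * z.1 + b * z.2)) / 2).
    apply: trigpolyM; last exact: trigpoly_cst.
    by apply: trigpolyD; [exact: trigpoly_cst|exact: trigpoly_sin].
  have t1 : trigpoly (fun z : R * R => q z.1).
    have [l hl] := tq tau^-1 0; exists l => z.
    by rewrite -hl mul0r addr0.
  have t2 : trigpoly (fun z : R * R => q z.2).
    have [l hl] := tq 0 tau^-1; exists l => z.
    by rewrite -hl mul0r add0r.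
  apply: (trigpoly_bern N _ t1) => k.
  apply: (trigpoly_bern N _ t2) => l.
  exact: trigpoly_cst.
- by move=> z; apply: norm_bern_le => // k; apply: norm_bern_le.
- move=> z z1 z2.
  apply: (@le_trans _ _ ((e / 2 + K / N%:R) + K / N%:R)); last by lra.
  apply: bern_approx => // k kN.
  rewrite [leRHS]addrAC.
  apply: bern_approx => // l lN.
  have Kz a : 0 <= K * a ^+ 2 by rewrite mulr_ge0 ?sqr_ge0.
  have far : `|h (x k, x l) - h z| <= 2 * M.
    by rewrite (le_trans (ler_normB _ _))// mulr_natl mulr2n lerD.
  have [xk|xk] := close k z.1 _ kN z1 erefl; last first.
    rewrite (le_trans far)// (le_trans xk)// -/(q z.1).
    by have := Kz (l%:R / N%:R - q z.2); lra.
  have [xl|xl] := close l z.2 _ lN z2 erefl; last first.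
    rewrite (le_trans far)// (le_trans xl)// -/(q z.2).
    by have := Kz (k%:R / N%:R - q z.1); lra.
  have := hdl _ _ _ _ z1 z2 xk xl; rewrite -surjective_pairing.
  by have := Kz (k%:R / N%:R - q z.1); have := Kz (l%:R / N%:R - q z.2); lra.
Qed.

End approximation.

(** * Gaussian laws and characteristic functions *)

Section normal_characteristic_function.
Context {R : realType}.
Local Notation mu := (@lebesgue_measure R).
Variable s : R.
Hypothesis s0 : 0 < s.
Local Notation p := (normal_pdf 0 s).

Let s_neq0 : s != 0. Proof. by rewrite gt_eqF. Qed.

(** The density enters through the Radon-Nikodym derivative of [normal_prob], which equals
    [normal_pdf] almost everywhere because both integrate to the same measure. *)
Lemma mean_normal (f : R -> R) : bmfun f ->
  mean (normal_prob 0 s) f = \int[mu]_x (f x * p x).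
Proof.
move=> bf; have fi := bmfun_integrable (normal_prob 0 s) bf.
have numu := normal_prob_dominates 0 s.
congr fine; rewrite -(Radon_Nikodym_change_of_variables numu)//=.
have mf : measurable_fun setT (EFin \o f).
  by apply/measurable_EFinP; exact: bmfun_meas.
have mp : measurable_fun setT (EFin \o p).
  by apply/measurable_EFinP; exact: measurable_normal_pdf.
under [RHS]eq_integral do rewrite EFinM.
apply: ae_eq_integral => //.
- by apply: emeasurable_funM => //; apply: (measurable_int mu);
    exact: Radon_Nikodym_integrable.
- exact: emeasurable_funM.
- apply: ae_eqe_mul2l => /=.
  rewrite Radon_NikodymE//=.
  case: cid => /= h [h1 h2 h3].
  by apply: integral_ae_eq => //= E _ mE; rewrite -h3.
Qed.

(** With y = x / (2 s) the exponent splits as - y^2 - y^2. One factor exp(- y^2) absorbs |y|, since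
    |y| <= 1 + y^2 <= exp(y^2); the other is a Gaussian profile of standard deviation sqrt 2 times
    s, so the first moment is dominated by an integrable density. *)
Lemma normal_fun_moment_bound x :
  `|x| * normal_fun 0 s x <= 2 * s * normal_fun 0 (Num.sqrt 2 * s) x.
Proof.
rewrite /normal_fun subr0; set y := x / (2 * s).
have -> : - x ^+ 2 / (s ^+ 2 *+ 2) = - y ^+ 2 - y ^+ 2 by rewrite /y; field.
have -> : - x ^+ 2 / ((Num.sqrt 2 * s) ^+ 2 *+ 2) = - y ^+ 2.
  by rewrite exprMn sqr_sqrtr ?ler0n// /y; field.
rewrite expRD mulrA ler_pM2r ?expR_gt0// expRN ler_pdivrMr ?expR_gt0//.
have -> : x = 2 * s * y by rewrite /y; field.
rewrite normrM gtr0_norm ?mulr_gt0// ler_pM2l ?mulr_gt0//.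
rewrite (le_trans _ (expR_ge1Dx _))//.
have [y1|y1] := leP `|y| 1; first by rewrite (le_trans y1)// lerDl sqr_ge0.
rewrite -[y ^+ 2]real_normK ?num_real//.
by rewrite ler_wpDl// expr2 ler_peMl// ltW.
Qed.

Lemma normal_moment_bound x : `|x| * p x <= 2 * s * normal_peak s.
Proof.
rewrite normal_pdfE// mulrCA mulrC ler_wpM2r ?normal_peak_ge0//.
rewrite (le_trans (normal_fun_moment_bound x))// ler_piMr ?mulr_ge0 ?(ltW s0)//.
rewrite /normal_fun -[leRHS]expR0 ler_expR mulNr oppr_le0 mulr_ge0 ?sqr_ge0//.
by rewrite invr_ge0 mulrn_wge0// sqr_ge0.
Qed.

Lemma measurable_p : measurable_fun setT p.
Proof. exact: measurable_normal_pdf. Qed.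

Lemma normal_moment_le x : `|x| * p x <=
  2 * s * normal_peak s / normal_peak (Num.sqrt 2 * s) *
  normal_pdf 0 (Num.sqrt 2 * s) x.
Proof.
have s'0 : Num.sqrt 2 * s != 0 by rewrite mulf_neq0// gt_eqF// sqrtr_gt0.
have peak0 := normal_peak_gt0 s'0.
rewrite !normal_pdfE// mulrCA.
apply: (@le_trans _ _
  (normal_peak s * (2 * s * normal_fun 0 (Num.sqrt 2 * s) x))).
  by rewrite ler_wpM2l ?normal_peak_ge0// normal_fun_moment_bound.
by rewrite le_eqVlt; apply/orP; left; apply/eqP; field; rewrite gt_eqF.
Qed.

Lemma integrable_normal_moment : mu.-integrable setT (fun x => (`|x| * p x)%:E).
Proof.
apply: (@le_integrable _ _ _ mu _ measurableT _
  (fun x => (2 * s * normal_peak s / normal_peak (Num.sqrt 2 * s))%:E *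
            (normal_pdf 0 (Num.sqrt 2 * s) x)%:E)%E).
- apply/measurable_EFinP; apply: measurable_funM; last exact: measurable_p.
  exact: normr_measurable.
- move=> x _; rewrite -EFinM !abse_EFin lee_fin ger0_norm.
    by apply: le_trans (ler_norm _); exact: normal_moment_le.
  by apply: mulr_ge0; [exact: normr_ge0|exact: normal_pdf_ge0].
- by apply: integrableZl => //; exact: integrable_normal_pdf.
Qed.

Lemma is_derive_normal_pdf (x : R) : is_derive x (1 : R) p (- (x / s ^+ 2) * p x).
Proof.
have -> : p = (fun x => normal_peak s * expR (- (s ^+ 2 *+ 2)^-1 * (x * x))).
  rewrite normal_pdfE//; apply/funext => y; rewrite /normal_fun subr0.
  by congr (_ * expR _); rewrite -expr2 mulrC mulrN mulNr mulrC.
have dsq : is_derive x (1 : R) (fun x : R => - (s ^+ 2 *+ 2)^-1 * (x * x))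
    (- (x / s ^+ 2)).
  apply: is_derive_eq.
  by rewrite /GRing.scale/=; field.
apply: is_derive_eq.
by rewrite /GRing.scale/=; ring.
Qed.

Lemma integrable_bounded_normal (f : R -> R) : bmfun f ->
  mu.-integrable setT (fun x => (f x * p x)%:E).
Proof.
move=> bf; have [M M0 fM] := bmfun_bound bf.
have le (x : R) : `|f x * p x| <= `|M * p x|.
  by rewrite !normrM ler_wpM2r// (gtr0_norm M0); exact: fM.
apply: (@le_integrable _ _ _ mu _ measurableT _ (fun x => M%:E * (p x)%:E)%E).
- apply/measurable_EFinP; apply: measurable_funM; last exact: measurable_p.
  by case: bf.
- by move=> x _; rewrite -EFinM !abse_EFin lee_fin; exact: le.
- by apply: integrableZl => //; exact: integrable_normal_pdf.
Qed.

Lemma integrable_bounded_normal_moment (f : R -> R) : bmfun f ->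
  mu.-integrable setT (fun x => (f x * (x * p x))%:E).
Proof.
move=> bf; have [M M0 fM] := bmfun_bound bf.
have le (x : R) : `|f x * (x * p x)| <= `|M * (`|x| * p x)|.
  by rewrite !normrM normr_id ler_wpM2r// ?mulr_ge0// (gtr0_norm M0); exact: fM.
apply: (@le_integrable _ _ _ mu _ measurableT _
  (fun x => M%:E * (`|x| * p x)%:E)%E).
- apply/measurable_EFinP; apply: measurable_funM; first by case: bf.
  by apply: measurable_funM => //; exact: measurable_p.
- by move=> x _; rewrite -EFinM !abse_EFin lee_fin; exact: le.
- by apply: integrableZl => //; exact: integrable_normal_moment.
Qed.

Lemma bmfun_cos_affine (t c : R) : bmfun (fun x : R => cos (t * x + c)).
Proof.
by apply: bmfun_cos; apply: measurable_funD => //; exact: measurable_funM.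
Qed.

Lemma bmfun_sin_affine (t c : R) : bmfun (fun x : R => sin (t * x + c)).
Proof.
by apply: bmfun_sin; apply: measurable_funD => //; exact: measurable_funM.
Qed.

Let phi c t := \int[mu]_x (cos (t * x + c) * p x).
Let phi' c t := - \int[mu]_x (sin (t * x + c) * (x * p x)).

(** Differentiation under the integral sign; [|x| * p x] dominates the derivative in the parameter
    uniformly. *)
Lemma is_derive_normal_char c t : is_derive t (1 : R) (phi c) (phi' c t).
Proof.
pose f (u x : R) := cos (u * x + c) * p x.
have df u x : is_derive u (1 : R) (f^~ x) (- (sin (u * x + c) * (x * p x))).
  have d1 : is_derive u (1 : R) (fun u : R => u * x + c) x.
    by apply: is_derive_eq; rewrite /GRing.scale/=; ring.
  by apply: is_derive_eq; rewrite /GRing.scale/=; ring.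
have Ia : [set` `](t - 1), (t + 1)[] t by rewrite /= in_itv/= ltrBlDr ltrDl ltr01.
have intf u : mu.-integrable setT (EFin \o f u).
  by apply: integrable_bounded_normal; exact: bmfun_cos_affine.
have G0 x : 0 <= `|x| * p x by rewrite mulr_ge0// normal_pdf_ge0.
have Gub u x : `|partial1of2 f u x| <= `|x| * p x.
  rewrite partial1of2E derive_val normrN !normrM (ger0_norm (normal_pdf_ge0 _ _ _)).
  by rewrite ler_piMl ?G0// sin_max.
have ddf u x : derivable (f^~ x) u 1 by exact: ex_derive.
apply: DeriveDef.
  exact: (@derivable_under_integral _ _ _ mu f setT measurableT t _ _ Ia
    (fun u _ => intf u) (fun u x _ _ => ddf u x) _ G0 integrable_normal_moment
    (fun u x _ _ => Gub u x)).
rewrite -derive1E (@differentiation_under_integral _ _ _ mu f setT measurableT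
  t _ _ Ia (fun u _ => intf u) (fun u x _ _ => ddf u x) _ G0
  integrable_normal_moment (fun u x _ _ => Gub u x)).
rewrite /phi' -mulN1r -RintegralZl//.
  by apply: eq_Rintegral => x _; rewrite partial1of2E derive_val mulN1r.
by apply: integrable_bounded_normal_moment; exact: bmfun_sin_affine.
Qed.

(** Integration by parts. [D] is the derivative of [F]; its integral over a growing interval is a
    boundary term of order 1/n, so by dominated convergence its integral over the line is 0, and the
    equation is a rearrangement of this. *)
Lemma normal_char_ode c t : phi' c t = - (s ^+ 2 * t * phi c t).
Proof.
pose F x := sin (t * x + c) * p x.
pose D x := t * (cos (t * x + c) * p x) - s ^- 2 * (sin (t * x + c) * (x * p x)).
have dF (x : R) : is_derive x (1 : R) F (D x).
  have d1 : is_derive x (1 : R) (fun u : R => t * u + c) t.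
    by apply: is_derive_eq; rewrite /GRing.scale/=; ring.
  have := is_derive_normal_pdf x => d2.
  by apply: is_derive_eq; rewrite /GRing.scale/= /D; ring.
have i1 := integrable_bounded_normal (bmfun_cos_affine t c).
have i2 := integrable_bounded_normal_moment (bmfun_sin_affine t c).
have i1' : mu.-integrable setT (fun x => (t * (cos (t * x + c) * p x))%:E).
  by under eq_fun do rewrite EFinM; exact: integrableZl.
have i2' : mu.-integrable setT (fun x => (s ^- 2 * (sin (t * x + c) * (x * p x)))%:E).
  by under eq_fun do rewrite EFinM; exact: integrableZl.
suff D0 : \int[mu]_x D x = 0.
  move: D0; rewrite /D RintegralB// RintegralZl// RintegralZl// => /eqP.
  rewrite subr_eq0 => /eqP E.
  rewrite /phi' /phi; congr (- _).
  by apply: (mulfI (invr_neq0 (expf_neq0 2 s_neq0))); rewrite -E; field.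
have iD : mu.-integrable setT (EFin \o D).
  by rewrite /D; under [EFin \o _]eq_fun do rewrite EFinB; exact: integrableB.
have cD : continuous D.
  have cp : continuous p by exact: continuous_normal_pdf.
  have caff : continuous (fun x : R => t * x + c).
    by move=> x; apply: cvgD; [apply: cvgM; [exact: cvg_cst|exact: cvg_id]|exact: cvg_cst].
  move=> x; apply: cvgB; (apply: cvgM; first exact: cvg_cst); apply: cvgM.
  - by apply: (cvg_comp _ cos); [exact: caff|exact: continuous_cos].
  - exact: cp.
  - by apply: (cvg_comp _ sin); [exact: caff|exact: continuous_sin].
  - by apply: cvgM; [exact: cvg_id|exact: cp].
have cF : continuous F.
  move=> x; apply/differentiable_continuous/derivable1_diffP.
  by case: (dF x).
(* [n.+1] keeps the interval nondegenerate, as the fundamental theorem of calculus requires, and its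
   endpoints nonzero. *)
pose I (n : nat) : set R := [set` `[- n.+1%:R, n.+1%:R]].
have FTC n : (\int[mu]_(x in I n) (D x)%:E = (F n.+1%:R - F (- n.+1%:R))%:E)%E.
  rewrite EFinB; apply: continuous_FTC2.
  - by rewrite ltrNl (lt_le_trans (_ : _ < 0))// oppr_lt0.
  - exact: continuous_subspaceT.
  - split; first by move=> x _; case: (dF x).
      by apply: cvg_at_right_filter; exact: cF.
    by apply: cvg_at_left_filter; exact: cF.
  - by move=> x _; rewrite derive1E derive_val.
have E n : (\int[mu]_x (D x * \1_(I n) x)%:E = (F n.+1%:R - F (- n.+1%:R))%:E)%E.
  rewrite -FTC [RHS]integral_mkcond; apply: eq_integral => x _.
  by rewrite patchE indicE; case: ifP => _; rewrite ?mulr1 ?mulr0.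
have [|||||_ _] := @dominated_convergence _ _ _ mu setT measurableT
  (fun n x => (D x * \1_(I n) x)%:E) (EFin \o D) (abse \o (EFin \o D)) .
- move=> n; apply/measurable_EFinP; apply: measurable_funM.
    by apply/measurable_EFinP; case/integrableP: iD.
  by apply: measurable_indic; exact: measurable_itv.
- by case/integrableP: iD.
- apply: aeW => x _; apply: cvg_near_cst.
  near=> n; rewrite indicE mem_set ?mulr1// /I/= in_itv/=.
  rewrite -ler_norml (@le_trans _ _ n%:R) ?ler_nat//.
  near: n; exact: nbhs_infty_ger.
- exact: integrable_abse.
- apply: aeW => x n _ /=; rewrite lee_fin normrM ler_piMr// indicE.
  by case: (_ \in _); rewrite ?normr0 ?normr1.
rewrite (_ : [sequence _]_n = (fun n => (F n.+1%:R - F (- n.+1%:R))%:E)); last first.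
  by apply/funext => n; exact: E.
move=> lim1.
have lim2 : (F n.+1%:R - F (- n.+1%:R))%:E @[n --> \oo] --> (0 : R)%:E.
  apply: cvg_EFin; first by apply: nearW.
  apply: norm_cvg0.
  pose C := 4 * s * normal_peak s.
  have Fub (x : R) : x != 0 -> `|F x| <= 2 * s * normal_peak s / `|x|.
    move=> x0; rewrite ler_pdivlMr ?normr_gt0// /F normrM.
    apply: le_trans (normal_moment_bound x).
    rewrite mulrC (ger0_norm (normal_pdf_ge0 _ _ _)) ler_wpM2l//.
    by rewrite ler_piMl ?normal_pdf_ge0// sin_max.
  apply: (@squeeze_cvgr _ _ _ _ (cst 0) (fun n => C * n.+1%:R^-1)).
  - apply: nearW => n /=; rewrite normr_ge0/=.
    have n0 : n.+1%:R != 0 :> R by [].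
    have n0' : - n.+1%:R != 0 :> R by rewrite oppr_eq0.
    rewrite (le_trans (ler_normB _ _))// (le_trans (lerD (Fub _ n0) (Fub _ n0')))//.
    rewrite normrN (ger0_norm (ler0n _ _)) /C.
    by rewrite le_eqVlt; apply/orP; left; apply/eqP; ring.
  - exact: cvg_cst.
  - rewrite -(mulr0 C); apply: cvgM; first exact: cvg_cst.
    exact: cvg_harmonic.
rewrite /Rintegral.
by rewrite (cvg_unique (@ereal_hausdorff R) lim1 lim2).
Unshelve. all: by end_near.
Qed.

(** By the differential equation, [psi] has derivative 0, and its value at 0 is [cos c]. *)
Lemma mean_cos_normal t c :
  mean (normal_prob 0 s) (fun x => cos (t * x + c)) =
  expR (- (s ^+ 2 * t ^+ 2 / 2)) * cos c.
Proof.
rewrite mean_normal; last exact: bmfun_cos_affine.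
rewrite -/(phi c t).
pose psi u := phi c u * expR (s ^+ 2 / 2 * (u * u)).
have dpsi u : is_derive u (1 : R) psi 0.
  have dphi := is_derive_normal_char c u.
  have dE : is_derive u (1 : R) (fun u => s ^+ 2 / 2 * (u * u)) (s ^+ 2 * u).
    by apply: is_derive_eq; rewrite /GRing.scale/=; field.
  apply: is_derive_eq; rewrite /GRing.scale/= normal_char_ode; ring.
have : psi t = psi 0 by exact: is_derive_0_is_cst.
rewrite /psi !mulr0 expR0 mulr1 {2}/phi.
have -> : \int[mu]_x (cos (0 * x + c) * p x) = cos c.
  under eq_Rintegral do rewrite mul0r add0r.
  rewrite RintegralZl//; last exact: integrable_normal_pdf.
  by rewrite /Rintegral integral_normal_pdf mulr1.
move=> <-; rewrite mulrCA -expRD.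
by rewrite (_ : _ + _ = 0) ?expR0 ?mulr1//; field.
Qed.

End normal_characteristic_function.

(** * Laws determined by rays, and right-continuity of distribution functions *)

Section measure_determination.
Context {R : realType}.

(** The complementary open rays are stable under intersection, generate the Borel sets and exhaust
    the line. *)
Lemma eq_measure_ray (P Q : probability R R) :
  (forall x, P `]-oo, x]%classic = Q `]-oo, x]%classic) -> forall A, measurable A -> P A = Q A.
Proof.
move=> PQ A mA.
pose G := [set B : set R | exists x, B = `]x, +oo[%classic].
have PQ' x : P `]x, +oo[%classic = Q `]x, +oo[%classic.
  by rewrite -setCitvl !probability_setC// PQ.
apply: (measure_unique G (fun n => `](- n%:R), +oo[%classic)) => //.
- exact: RGenOInfty.measurableE.
- move=> _ _ [x ->] [y ->]; exists (Num.max x y).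
  apply/seteqP; split => z /=; rewrite !in_itv/= !andbT gt_max.
    by move=> [-> ->].
  by move=> /andP[].
- by move=> n; exists (- n%:R).
- apply/seteqP; split => // x _; exists (Num.truncn `|x|).+1 => //=.
  rewrite in_itv/= andbT ltrNl (le_lt_trans (ler_norm _))// normrN.
  exact: truncnS_gt.
- by move=> _ [x ->]; exact: PQ'.
- by move=> n; rewrite (le_lt_trans (probability_le1 _ _))// ltry.
Qed.

(** Right-continuity of the distribution function, obtained as continuity from above along the rays
    that end at a + 1/(n+1). *)
Lemma fine_ray_lim (P : probability R R) (a e : R) : 0 < e ->
  exists2 b, a < b & fine (P `]-oo, b]%classic) <= fine (P `]-oo, a]%classic) + e.
Proof.
move=> e0.
pose F n : set R := `]-oo, a + n.+1%:R^-1]%classic.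
have mF n : measurable (F n) by exact: measurable_itv.
have cF : \bigcap_n F n = `]-oo, a]%classic.
  apply/seteqP; split => x /=; last first.
    rewrite in_itv/= => xa n _ /=; rewrite /F/= in_itv/= (le_trans xa)// lerDl invr_ge0.
    exact: ler0n.
  move=> xF; rewrite in_itv/=; apply/ler_addgt0Pr => r r0.
  have [n nr] := ltr_add_invr (y := 0) r0.
  have := xF n I; rewrite /F/= in_itv/= => /le_trans; apply.
  by rewrite lerD2l ltW// -[_^-1]add0r.
have : P \o F @ \oo --> P (\bigcap_n F n).
  apply: nonincreasing_cvg_mu => //.
  - by rewrite (le_lt_trans (probability_le1 P (mF 0%N)))// ltry.
  - by rewrite cF; exact: measurable_itv.
  - move=> n m nm; apply/subsetPset => x /=; rewrite /F/= !in_itv/=.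
    move=> /le_trans; apply; rewrite lerD2l lef_pV2 ?posrE ?ltr0n//.
    by rewrite ler_nat ltnS.
rewrite cF -[X in _ --> X]fineK ?fin_num_measure// => /fine_cvgP[_ /cvgrPdist_le/(_ _ e0)].
move=> [N _ /(_ N)]; rewrite /= leqnn => /(_ isT).
rewrite ler_distlC => /andP[_ H].
by exists (a + N.+1%:R^-1); rewrite ?ltrDl ?invr_gt0 ?ltr0n.
Qed.

End measure_determination.

(** * Tightness and test functions on the plane *)

Section tightness.
Context {R : realType}.

Definition outside (tau : R) (z : R * R) : R :=
  (~~ ((`|z.1| <= tau) && (`|z.2| <= tau)))%:R.

Lemma bmfun_outside d (T : measurableType d) (tau : R) (Z : T -> R * R) :
  measurable_fun setT Z -> bmfun (fun w => outside tau (Z w)).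
Proof.
move=> mZ; apply: (bmfun_compr mZ).
have -> : outside tau = \1_(~` (`[- tau, tau]%classic `*` `[- tau, tau]%classic)).
  apply/funext => z; rewrite indicE /outside in_setC; congr (~~ _)%:R.
  by rewrite in_setX !mem_setE !in_itv/= !ler_norml.
apply: bmfun_indic; apply: measurableC; apply: measurableX; exact: measurable_itv.
Qed.

Lemma tight (P : probability (R * R)%type R) (e : R) : 0 < e ->
  exists2 tau, 0 < tau & mean P (outside tau) <= e.
Proof.
move=> e0.
pose F n : set (R * R) := ~` (`[- n.+1%:R, n.+1%:R]%classic `*` `[- n.+1%:R, n.+1%:R]%classic).
have mF n : measurable (F n).
  by apply: measurableC; apply: measurableX; exact: measurable_itv.
have FE n : outside n.+1%:R = \1_(F n).
  apply/funext => z; rewrite indicE /outside in_setC; congr (~~ _)%:R.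
  by rewrite in_setX !mem_setE !in_itv/= !ler_norml.
have cF : \bigcap_n F n = set0.
  apply/seteqP; split => // z zF.
  have [n Hn] : exists n : nat, Num.max `|z.1| `|z.2| < n%:R.
    by exists (Num.truncn (Num.max `|z.1| `|z.2|)).+1; exact: truncnS_gt.
  move: Hn; rewrite gt_max => /andP[z1 z2].
  apply: (zF n I); split; rewrite /= in_itv/= -ler_norml ltW//.
    by rewrite (lt_le_trans z1)// ler_nat.
  by rewrite (lt_le_trans z2)// ler_nat.
have : P \o F @ \oo --> P (\bigcap_n F n).
  apply: nonincreasing_cvg_mu => //.
  - by rewrite (le_lt_trans (probability_le1 P (mF 0%N)))// ltry.
  - by rewrite cF.
  - move=> n m nm; apply/subsetPset; apply: subsetC.
    have le : n.+1%:R <= m.+1%:R :> R by rewrite ler_nat ltnS.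
    by move=> z [z1 z2]; split; [move: z1|move: z2]; apply: subset_itv;
      rewrite bnd_simp ?lerN2.
rewrite cF measure0 => /fine_cvgP[_ /cvgrPdist_le/(_ _ e0)].
move=> [N _ /(_ N)]; rewrite /= leqnn => /(_ isT).
rewrite sub0r normrN => H; exists N.+1%:R => //.
by rewrite FE mean_indic// (le_trans (ler_norm _)).
Qed.

Lemma measurable_trigpoly (p : R * R -> R) : trigpoly p -> measurable_fun setT p.
Proof.
move=> [l pl]; rewrite (_ : p = fun z => \sum_(t <- l) trigmono t z); last exact/funext.
suff : bmfun (fun z => \sum_(t <- l) trigmono t z) by case.
apply: bmfun_sum => t _; apply: bmfunZ; apply: bmfun_cos.
apply: measurable_funD => //; apply: measurable_funD; exact: measurable_funM.
Qed.

(** Measurability for the product sigma-algebra: [h] is a pointwise limit of trigonometric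
    polynomials, the n-th one being within 1/(n+1) of [h] on the box of half-width n+1. *)
Lemma bmfun_continuous (h : R * R -> R) : bounded_continuous h -> bmfun h.
Proof.
move=> [ch [M hM]]; split; last by exists M.
have /choice[p Hp] : forall n : nat, exists p, [/\ trigpoly p, forall z, `|p z| <= M &
    forall z, `|z.1| <= n.+1%:R -> `|z.2| <= n.+1%:R -> `|p z - h z| <= n.+1%:R^-1].
  by move=> n; apply: trig_approximation.
apply: (measurable_fun_cvg (h := p)) => // [n|z _].
  by have [tp _ _] := Hp n; exact: measurable_trigpoly.
apply/cvgrPdist_le => e e0; near=> n.
have [_ _ H] := Hp n.
rewrite distrC (le_trans (H z _ _))//.
- rewrite (@le_trans _ _ n%:R) ?ler_nat//; near: n; exact: nbhs_infty_ger.
- rewrite (@le_trans _ _ n%:R) ?ler_nat//; near: n; exact: nbhs_infty_ger.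
- rewrite invf_ple ?posrE ?ltr0n// (@le_trans _ _ n%:R) ?ler_nat//.
  near: n; exact: nbhs_infty_ger.
Unshelve. all: by end_near.
Qed.

(* Any test function can be traded for a trigonometric polynomial, at a price
   that only depends on the mass outside of a box. *)
Lemma trig_substitute (h : R * R -> R) (M tau e : R) :
  continuous h -> (forall z, `|h z| <= M) -> 0 < tau -> 0 < e ->
  exists2 p, trigpoly p & forall d (T : measurableType d) (P : probability T R)
    (Z : T -> R * R), measurable_fun setT Z ->
    `|mean P (h \o Z) - mean P (p \o Z)| <= e + 2 * M * mean P (outside tau \o Z).
Proof.
move=> ch hM tau0 e0.
have [p [tp pM pE]] := trig_approximation ch hM tau0 e0.
exists p => // d T P Z mZ.
have bh : bmfun (h \o Z).
  by apply: (bmfun_compr mZ); apply: bmfun_continuous; split => //; exists M.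
have bp : bmfun (p \o Z).
  by apply: (bmfun_compr mZ); split; [exact: measurable_trigpoly|exists M].
have bo : bmfun (outside tau \o Z) by exact: bmfun_outside.
rewrite -meanB// (le_trans (norm_mean P (bmfunB bh bp)))//.
rewrite -[X in _ <= X + _](mean_cst P e) -meanZ// -meanD//; last 2 first.
  exact: bmfun_cst.
  exact: bmfunZ.
apply: le_mean.
- exact: bmfun_norm (bmfunB bh bp).
- by apply: bmfunD; [exact: bmfun_cst|exact: bmfunZ].
move=> w /=; have M0 : 0 <= M by rewrite (le_trans _ (hM 0)).
rewrite /outside; have [/andP[z1 z2]|_] := boolP (_ && _); last first.
  rewrite mulr1 (le_trans (ler_normB _ _))//.
  by have := hM (Z w); have := pM (Z w); lra.
by rewrite mulr0 addr0 distrC; exact: pE.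
Qed.

End tightness.

Section characteristic_functions.
Context {R : realType}.
Implicit Types P Q : probability R R.

(** For a < b, the piecewise linear function equal to 1 up to [a] and to 0 from [b] on: a continuous
    test function squeezed between the indicators of two rays. *)
Definition ramp (a b x : R) : R := Num.max 0 (Num.min 1 ((b - x) / (b - a))).

Lemma continuous_ramp a b : continuous (ramp a b).
Proof.
move=> x.
apply: (@continuous_max _ _ (cst 0) (fun x => Num.min 1 ((b - x) / (b - a)))).
  exact: cvg_cst.
apply: (@continuous_min _ _ (cst 1) (fun x => (b - x) / (b - a))).
  exact: cvg_cst.
apply: cvgM; last exact: cvg_cst.
by apply: cvgB; [exact: cvg_cst|exact: cvg_id].
Qed.

Lemma ramp_bounds a b x : a < b ->
  \1_(`]-oo, a]%classic) x <= ramp a b x <= \1_(`]-oo, b]%classic) x.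
Proof.
move=> ab; rewrite /ramp !indicE !mem_setE !in_itv/=.
have ba : 0 < b - a by rewrite subr_gt0.
apply/andP; split.
  have [xa|xa] := leP x a; last by rewrite le_max lexx.
  rewrite le_max le_min lexx/= ler_pdivlMr// mul1r lerD2l lerN2 xa.
  by rewrite orbT.
have [xb|xb] := leP x b; first by rewrite ge_max ler01 ge_min lexx.
rewrite ge_max lexx ge_min ler_pdivrMr// mul0r subr_le0.
by rewrite (ltW xb) orbT.
Qed.

(** Equal cosine means give equal means of trigonometric polynomials, hence of bounded continuous
    functions by tightness, hence of ramps, hence equal distribution functions by
    right-continuity. *)
Lemma char_fun_unique P Q :
  (forall t c, mean P (fun x => cos (t * x + c)) = mean Q (fun x => cos (t * x + c))) ->
  forall A, measurable A -> P A = Q A.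
Proof.
move=> PQ.
(* The line is embedded in the plane so that the approximation of planar test functions can be
   used. *)
have mZ : measurable_fun setT (fun x : R => (x, 0 : R)).
  by apply: measurable_fun_pair => //; exact: measurable_cst.
have PQh (h : R * R -> R) : bounded_continuous h ->
    mean P (fun x => h (x, 0)) = mean Q (fun x => h (x, 0)).
  move=> bh; have [ch [M hM]] := bh.
  have M0 : 0 <= M by rewrite (le_trans _ (hM 0)).
  apply/eqP; rewrite -subr_eq0 -normr_le0; apply/ler_addgt0Pr => e e0.
  rewrite add0r.
  (* Chosen so that [e] is twice [e' + 2 * M * e']: [P] and [Q] each cost one approximation error
     and one tail. *)
  pose e' := e / (2 + 4 * M).
  have e'0 : 0 < e' by rewrite divr_gt0//; lra.
  have [t1 t10 H1] := tight (distribution P (mfun_of mZ)) e'0.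
  have [t2 t20 H2] := tight (distribution Q (mfun_of mZ)) e'0.
  rewrite mean_distribution /= in H1; last exact: bmfun_outside.
  rewrite mean_distribution /= in H2; last exact: bmfun_outside.
  pose tau := Num.max t1 t2.
  have tau0 : 0 < tau by rewrite lt_max t10.
  have out t z : t <= tau -> outside tau z <= outside t z :> R.
    move=> tt; rewrite /outside ler_nat.
    have [/andP[z1 z2]|_] := boolP ((`|z.1| <= t) && (`|z.2| <= t)).
      by rewrite (le_trans z1)// (le_trans z2).
    by case: (_ && _).
  have [p [l pl] sub] := trig_substitute ch hM tau0 e'0.
  have := sub _ _ P _ mZ; have := sub _ _ Q _ mZ.
  have -> : mean P (p \o (fun x => (x, 0))) = mean Q (p \o (fun x => (x, 0))).
    have pE (N : probability R R) : mean N (p \o (fun x => (x, 0))) =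
        \sum_(t <- l) t.1.1.1 * mean N (fun x => cos (t.1.1.2 * x + t.2)).
      rewrite (@eq_mean _ _ _ _ _
        (fun x => \sum_(t <- l) t.1.1.1 * cos (t.1.1.2 * x + t.2))); last first.
        move=> x /=; rewrite pl; apply: eq_bigr => t _.
        by rewrite /trigmono /= mulr0 addr0.
      rewrite mean_sum; last by move=> t _; apply: bmfunZ; exact: bmfun_cos_affine.
      by apply: eq_bigr => t _; rewrite meanZ//; exact: bmfun_cos_affine.
    by rewrite !pE; apply: eq_bigr => t _; rewrite PQ.
  have le N t : t <= tau -> mean N (outside t \o (fun x => (x, 0))) <= e' ->
      mean N (outside tau \o (fun x => (x, 0))) <= e'.
    move=> tt; apply: le_trans; apply: le_mean; [exact: bmfun_outside|
      exact: bmfun_outside|by move=> x; exact: out].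
  have {}H1 := le P t1 _ H1; have {}H2 := le Q t2 _ H2.
  have {}H1 := H1 ltac:(by rewrite le_max lexx).
  have {}H2 := H2 ltac:(by rewrite le_max lexx orbT).
  have eE : e = e' + 2 * M * e' + (e' + 2 * M * e').
    by rewrite /e'; field; rewrite gt_eqF//; lra.
  have M20 : 0 <= 2 * M by lra.
  have {}H1 := ler_wpM2l M20 H1; have {}H2 := ler_wpM2l M20 H2.
  rewrite !ler_norml => /andP[? ?] /andP[? ?]; apply/andP; split; lra.
have ray (P1 Q1 : probability R R) a :
   (forall h, bounded_continuous h ->
     mean P1 (fun x => h (x, 0 : R)) = mean Q1 (fun x => h (x, 0 : R))) ->
   fine (P1 `]-oo, a]%classic) <= fine (Q1 `]-oo, a]%classic).
  move=> E; apply/ler_addgt0Pr => e e0.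
  have [b ab Hb] := fine_ray_lim Q1 a e0.
  have mray (c : R) : measurable `]-oo, c]%classic by exact: measurable_itv.
  have bi (c : R) := bmfun_indic (mray c).
  have br : bounded_continuous (fun z : R * R => ramp a b z.1).
    split.
      move=> z; apply: (cvg_comp fst (ramp a b)); first exact: cvg_fst.
      exact: continuous_ramp.
    exists 1 => z; have /andP[r0 r1] := ramp_bounds z.1 ab.
    rewrite ger0_norm; first by rewrite (le_trans r1)// indicE; case: (_ \in _).
    by rewrite (le_trans _ r0)// indicE.
  have br1 : bmfun (ramp a b).
    exact: (bmfun_compr (u := fun x : R => (x, 0 : R)) mZ (bmfun_continuous br)).
  apply: le_trans Hb; rewrite -!mean_indic//.
  apply: (@le_trans _ _ (mean P1 (ramp a b))).
    by apply: le_mean => // x; have /andP[] := ramp_bounds x ab.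
  rewrite (E _ br).
  by apply: le_mean => // x; have /andP[] := ramp_bounds x ab.
apply: eq_measure_ray => a.
have mray : measurable (`]-oo, a]%classic : set R) by exact: measurable_itv.
rewrite -(fineK (fin_num_measure P _ mray)) -(fineK (fin_num_measure Q _ mray)).
by congr EFin; apply/eqP; rewrite eq_le !ray// => h bh; rewrite PQh.
Qed.

End characteristic_functions.

Section gaussian.
Context {R : realType}.

(* [normal_prob] lives on [measurableTypeR R], which has the measurable sets
   of [R] but another display. *)
Lemma measurable_id_R : measurable_fun setT (fun x : measurableTypeR R => x : R).
Proof. by move=> _ A mA; rewrite setTI. Qed.

Definition gauss (s : R) : probability R R :=
  distribution (normal_prob 0 s) (mfun_of measurable_id_R).

Lemma mean_cos_gauss s t c : 0 < s ->
  mean (gauss s) (fun x => cos (t * x + c)) =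
  expR (- (s ^+ 2 * t ^+ 2 / 2)) * cos c.
Proof.
move=> s0; rewrite mean_distribution; last exact: bmfun_cos_affine.
exact: mean_cos_normal.
Qed.

End gaussian.

Section bivariate_gaussian.
Context {R : realType}.
Variables s11 s12 s22 : R.
Let Q (a b : R) := a ^+ 2 * s11 + 2 * a * b * s12 + b ^+ 2 * s22.
Hypothesis psd : forall a b, 0 <= Q a b.

Lemma cholesky : exists al be ga : R,
  [/\ al ^+ 2 = s11, al * be = s12 & be ^+ 2 + ga ^+ 2 = s22].
Proof.
have s11_ge0 : 0 <= s11 by have := psd 1 0; rewrite /Q; lra.
have s22_ge0 : 0 <= s22 by have := psd 0 1; rewrite /Q; lra.
have [s11_0|s11_neq0] := eqVneq s11 0.
  have [s12_0|s12_neq0] := eqVneq s12 0.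
    exists 0, 0, (Num.sqrt s22); rewrite sqr_sqrtr// s11_0 s12_0.
    by split; ring.
  (* At this point the form takes the value -1, so [s11 = 0] forces [s12 = 0]. *)
  have := psd (- (s22 + 1) / (2 * s12)) 1; rewrite /Q s11_0.
  have -> : forall x : R, x ^+ 2 * 0 + 2 * x * 1 * s12 + 1 ^+ 2 * s22 =
    x * (2 * s12) + s22 by move=> x; ring.
  by rewrite divfK ?mulf_neq0//; lra.
have s11_gt0 : 0 < s11 by rewrite lt_neqAle eq_sym s11_neq0.
have sq_neq0 : Num.sqrt s11 != 0 by rewrite gt_eqF// sqrtr_gt0.
pose be := s12 / Num.sqrt s11.
have be2 : be ^+ 2 = s12 ^+ 2 / s11 by rewrite exprMn exprVn sqr_sqrtr.
exists (Num.sqrt s11), be, (Num.sqrt (s22 - be ^+ 2)); split.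
- by rewrite sqr_sqrtr.
- by rewrite /be mulrC divfK.
- rewrite sqr_sqrtr; first by rewrite addrC subrK.
  have := psd (- (s12 / s11)) 1; rewrite be2 /Q.
  by rewrite (_ : _ + _ + _ = s22 - s12 ^+ 2 / s11)//; field.
Qed.

(** [L] is the image of two independent standard normal variables under the triangular factor from
    [cholesky]. Its linear combinations are recognised by their cosine means; those of variance 0
    are the Dirac case of [normal_law]. *)
Lemma gaussian_law_exists : exists L : probability (R * R)%type R,
  bivariate_normal L /\
  forall a b c, mean L (fun z => cos (a * z.1 + b * z.2 + c)) =
    expR (- (Q a b / 2)) * cos c.
Proof.
have [al [be [ga [E11 E12 E22]]]] := cholesky.
have mlin (x y : R) : measurable_fun setT (fun z : R * R => x * z.1 + y * z.2).
  by apply: measurable_funD; exact: measurable_funM.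
have mA : measurable_fun setT
    (fun z : R * R => (al * z.1 + 0 * z.2, be * z.1 + ga * z.2)).
  by apply: measurable_fun_pair; exact: mlin.
pose N := gauss (1 : R).
pose L : probability (R * R)%type R := distribution (N \x N)%E (mfun_of mA).
have bcos (a b c : R) : bmfun (fun z : R * R => cos (a * z.1 + b * z.2 + c)).
  by apply: bmfun_cos; apply: measurable_funD => //; exact: mlin.
have char a b c : mean L (fun z => cos (a * z.1 + b * z.2 + c)) =
    expR (- (Q a b / 2)) * cos c.
  rewrite mean_distribution//.
  rewrite (@eq_mean _ _ _ _ _ (fun z => cos ((a * al + b * be) * z.1 + (b * ga) * z.2 + c))).
    rewrite mean_prod//=.
    rewrite (@eq_mean _ _ _ _ _ (fun x => expR (- (1 ^+ 2 * (b * ga) ^+ 2 / 2)) *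
        cos ((a * al + b * be) * x + c))).
      rewrite meanZ; last exact: bmfun_cos_affine.
      rewrite mean_cos_gauss// mulrA -expRD; congr (expR _ * _).
      by rewrite /Q -E11 -E12 -E22; field.
    move=> x; rewrite -mean_cos_gauss//; apply: eq_mean => y; congr cos; ring.
  move=> z /=; congr cos; ring.
exists L; split=> // a b.
exists 0, (Num.sqrt (Q a b)); split; first exact: sqrtr_ge0.
move=> A mA'.
have charab t c : mean (distribution L (mfun_of (mlin a b)))
    (fun x => cos (t * x + c)) = expR (- (Q a b * t ^+ 2 / 2)) * cos c.
  rewrite mean_distribution; last exact: bmfun_cos_affine.
  rewrite (@eq_mean _ _ _ _ _ (fun z => cos ((t * a) * z.1 + (t * b) * z.2 + c))).
    by rewrite char; congr (expR _ * _); rewrite /Q; field.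
  by move=> z /=; congr cos; ring.
pose D : probability R R := distribution L (mfun_of (mlin a b)).
have charD t c : mean D _ = _ := charab t c.
case: ifPn => [/eqP sq0|sq_neq0].
  have Q0 : Q a b = 0 by rewrite -(sqr_sqrtr (psd a b)) sq0 expr0n.
  apply: (@char_fun_unique R D \d_(0 : R)) => //.
  move=> t c; rewrite charD Q0 !mul0r oppr0 expR0 mul1r.
  rewrite /mean /Rintegral integral_dirac//=; last first.
    by apply/measurable_EFinP; exact: bmfun_meas (bmfun_cos_affine t c).
  by rewrite indicT mul1r mulr0 add0r.
apply: (@char_fun_unique R D (gauss (Num.sqrt (Q a b)))) => //.
move=> t c; rewrite charD mean_cos_gauss ?sqr_sqrtr//.
by rewrite lt_neqAle eq_sym sq_neq0 sqrtr_ge0.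
Qed.

End bivariate_gaussian.

(** * Independent families *)

Section joint_law.
Context {R : realType} {I : finType}.
Local Notation V := (#|I|.-tuple R).

Definition coords (t : V) (i : I) : R := tnth t (enum_rank i).

Lemma measurable_coords i : measurable_fun setT (fun t : V => coords t i).
Proof. exact: measurable_tnth. Qed.

Definition box (A : I -> set R) : set V := \bigcap_(i in [set: I]) (coords^~ i) @^-1` A i.

Lemma measurable_box (A : I -> set R) :
  (forall i, measurable (A i)) -> measurable (box A).
Proof.
move=> mA; apply: fin_bigcap_measurable => // i _; rewrite -[X in measurable X]setTI.
exact: measurable_coords.
Qed.

(** Boxes are stable under intersection and generate the sigma-algebra of tuples: a condition on one
    coordinate is a box whose other sides are the whole line. *)
Lemma eq_measure_box (P Q : probability V R) :
  (forall A, (forall i, measurable (A i)) -> P (box A) = Q (box A)) ->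
  forall B, measurable B -> P B = Q B.
Proof.
move=> PQ B mB.
pose G := [set B : set V | exists2 A, (forall i, measurable (A i)) & B = box A].
apply: (measure_unique G (fun=> setT)) => //.
- apply/seteqP; split.
    apply: smallest_sub; first exact: smallest_sigma_algebra.
    rewrite -bigcup_seq => B' [k /= _ [C mC <-]]; apply: sub_sigma_algebra.
    exists (fun i => if i == enum_val k then C else setT) => [i|]; first by case: ifP.
    apply/seteqP; split => t /= Ht.
      by move=> i _ /=; case: ifP => // /eqP ->; rewrite /coords enum_valK; case: Ht.
    by split => //; have := Ht (enum_val k) Logic.I; rewrite /= eqxx /coords enum_valK.
  apply: smallest_sub; first exact: sigma_algebra_measurable.
  by move=> _ [A mA ->]; exact: measurable_box.
- move=> _ _ [A mA ->] [A' mA' ->]; exists (fun i => A i `&` A' i).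
    by move=> i; exact: measurableI.
  by rewrite /box -bigcapI.
- move=> _; exists (fun=> setT) => //; apply/seteqP; split => //.
- by rewrite bigcup_const.
- by move=> _ [A mA ->]; exact: PQ.
- by move=> _; rewrite (le_lt_trans (probability_le1 _ _))// ltry.
Qed.

Definition joint_tuple {T : Type} (Z : I -> T -> R) (w : T) : V :=
  [tuple Z (enum_val k) w | k < #|I|].

Lemma coords_joint (T : Type) (Z : I -> T -> R) w : coords (joint_tuple Z w) = Z^~ w.
Proof. by apply/funext => i; rewrite /coords tnth_mktuple enum_rankK. Qed.

Lemma measurable_joint_tuple d (T : measurableType d) (Z : I -> T -> R) :
  (forall i, measurable_fun setT (Z i)) -> measurable_fun setT (joint_tuple Z).
Proof.
move=> mZ; apply/measurable_fun_tnthP => k /=.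
by rewrite (_ : _ \o _ = Z (enum_val k))//; apply/funext => w /=; rewrite tnth_mktuple.
Qed.

(** Measurability of a functional is tested on tuples, so that the same [H] can be applied to
    families living on different probability spaces. *)
Definition bmjoint (H : (I -> R) -> R) := bmfun (H \o coords).

Lemma bmjoint_comp d (T : measurableType d) (Z : I -> T -> R) H :
  (forall i, measurable_fun setT (Z i)) -> bmjoint H -> bmfun (fun w => H (Z^~ w)).
Proof.
move=> /measurable_joint_tuple mZ /(bmfun_compr mZ); apply: eq_bmfun => w /=.
by rewrite coords_joint.
Qed.

Lemma eq_joint_law d d' (T : measurableType d) (T' : measurableType d')
    (P : probability T R) (P' : probability T' R)
    (Z : I -> T -> R) (Z' : I -> T' -> R) :
  (forall i, measurable_fun setT (Z i)) -> (forall i, measurable_fun setT (Z' i)) ->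
  (forall A, (forall i, measurable (A i)) ->
    P (\bigcap_(i in [set: I]) Z i @^-1` A i) =
    P' (\bigcap_(i in [set: I]) Z' i @^-1` A i)) ->
  forall H, bmjoint H -> mean P (fun w => H (Z^~ w)) = mean P' (fun w => H (Z'^~ w)).
Proof.
move=> /measurable_joint_tuple mZ /measurable_joint_tuple mZ' PP' H bH.
have E d1 (T1 : measurableType d1) (P1 : probability T1 R) (Z1 : I -> T1 -> R)
    (m1 : measurable_fun setT (joint_tuple Z1)) :
    mean P1 (fun w => H (Z1^~ w)) = mean (distribution P1 (mfun_of m1)) (H \o coords).
  by rewrite mean_distribution//; apply: eq_mean => w /=; rewrite coords_joint.
rewrite (E _ _ _ _ mZ) (E _ _ _ _ mZ'); apply: eq_mean_measure.
apply: eq_measure_box => A mA.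
have boxE (T1 : Type) (Z1 : I -> T1 -> R) :
    joint_tuple Z1 @^-1` box A = \bigcap_(i in [set: I]) Z1 i @^-1` A i.
  apply/seteqP; split => w /= Hw i _; have := Hw i Logic.I;
  by rewrite /= coords_joint.
by rewrite /= /distribution /pushforward /= !boxE PP'.
Qed.

End joint_law.

Section independence.
Context {R : realType} {I : finType} {d : measure_display} {T : measurableType d}.
Variables (P : probability T R) (Z : I -> T -> R) (mu : I -> probability R R).

(** Independence and marginal laws in one product formula; a subfamily is reached by taking the
    other sides equal to the whole line. *)
Definition indep_law := (forall i, measurable_fun setT (Z i)) /\
  forall A : I -> set R, (forall i, measurable (A i)) ->
    P (\bigcap_(i in [set: I]) Z i @^-1` A i) = (\prod_i fine (mu i (A i)))%:E.

Definition upd (z : I -> R) (i : I) (x : R) (j : I) : R := if j == i then x else z j.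

Hypothesis indepZ : indep_law.

Lemma measurable_upd d' (T' : measurableType d') (Z' : I -> T' -> R) (f : T' -> R) i j :
  (forall k, measurable_fun setT (Z' k)) -> measurable_fun setT f ->
  measurable_fun setT (fun w => upd (Z'^~ w) i (f w) j).
Proof. by move=> mZ mf; rewrite /upd; case: (j == i). Qed.

(** Redrawing coordinate [i] independently of everything else leaves the joint law unchanged,
    because on a rectangle the factor of index [i] splits off. The inner mean plays the part of the
    conditional expectation given the other coordinates, here and in all orthogonality arguments. *)
Lemma mean_resample (i : I) H : bmjoint H ->
  mean P (fun w => H (Z^~ w)) =
  mean P (fun w => mean (mu i) (fun x => H (upd (Z^~ w) i x))).
Proof.
move=> bH; have [mZ PZ] := indepZ.
pose Z2 j (xw : R * T) := upd (Z^~ xw.2) i xw.1 j.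
have mZ2 j : measurable_fun setT (Z2 j).
  apply: (measurable_upd (Z' := fun k xw => Z k xw.2)) => // k.
  exact: measurableT_comp.
rewrite (@eq_joint_law _ _ _ _ _ _ P (mu i \x P)%E Z Z2 mZ mZ2 _ H bH).
  by rewrite mean_prod_swap//; exact: bmjoint_comp.
move=> A mA; rewrite PZ//.
pose A' j := if j == i then setT else A j.
have -> : \bigcap_(j in [set: I]) Z2 j @^-1` A j =
    A i `*` \bigcap_(j in [set: I]) Z j @^-1` A' j.
  apply/seteqP; split => -[x w] /=.
    move=> Hxw; split; first by have := Hxw i Logic.I; rewrite /Z2 /upd /= eqxx.
    move=> j _; have := Hxw j Logic.I; rewrite /Z2 /upd /A' /=.
    by case: ifP.
  move=> [xA Hw] j _; have := Hw j Logic.I; rewrite /Z2 /upd /A' /=.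
  by case: ifP => // /eqP ->.
have mA' j : measurable (A' j) by rewrite /A'; case: ifP.
have mB : measurable (\bigcap_(j in [set: I]) Z j @^-1` A' j).
  apply: fin_bigcap_measurable => // j _; rewrite -[X in measurable X]setTI.
  exact: mZ.
apply/esym; etransitivity; first exact: (product_measure1E (mu i) P (mA i) mB).
rewrite [X in (_ * X)%E](_ : _ = (\prod_j fine (mu j (A' j)))%:E); last exact: PZ.
rewrite (bigD1 i)//= [in RHS](bigD1 i)//= /A' eqxx.
rewrite probability_setT mul1r EFinM fineK ?fin_num_measure//; congr (_ * _%:E)%E.
by apply: eq_bigr => j /negbTE ->.
Qed.

Lemma mean_coord i (f : R -> R) : bmfun f -> mean P (fun w => f (Z i w)) = mean (mu i) f.
Proof.
move=> bf; rewrite (mean_resample i (H := fun z => f (z i))).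
  rewrite (@eq_mean _ _ _ _ _ (fun=> mean (mu i) f)) ?mean_cst// => w.
  by apply: eq_mean => x; rewrite /upd eqxx.
by apply: (bmfun_compr _ bf); exact: measurable_coords.
Qed.

End independence.

(** * Lindeberg's replacement argument *)

Section taylor.
Context {R : realType}.

Lemma sin_le_norm (x : R) : `|sin x| <= `|x|.
Proof.
have [c] : exists2 c, c \in `[Num.min 0 x, Num.max 0 x]%R &
    sin (Num.max 0 x) - sin (Num.min 0 x) = cos c * (Num.max 0 x - Num.min 0 x).
  apply: (@MVT_segment _ sin cos) => //; first by rewrite ge_min le_max lexx.
  by apply/continuous_subspaceT => z; exact: continuous_sin.
move=> _; case: (leP 0 x) => x0; rewrite ?(sin0, subr0, sub0r).
  by move=> ->; rewrite normrM ler_piMl// cos_max.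
by rewrite -normrN => ->; rewrite normrM normrN ler_piMl// cos_max.
Qed.

Lemma cos_sub1_le (x : R) : `|cos x - 1| <= x ^+ 2 / 2.
Proof.
have -> : cos x - 1 = - (2 * sin (x / 2) ^+ 2).
  rewrite {1}(_ : x = (x / 2) *+ 2); last by field.
  by rewrite cos_mulr2n sin2cos2; ring.
rewrite normrN normrM normrX ger0_norm// (_ : x ^+ 2 / 2 = 2 * `|x / 2| ^+ 2).
  by rewrite ler_pM2l// lerXn2r ?nnegrE// sin_le_norm.
by rewrite real_normK ?num_real//; field.
Qed.

Lemma sin_sub_le (x : R) : `|sin x - x| <= `|x| ^+ 3 / 2.
Proof.
have [c] : exists2 c, c \in `[Num.min 0 x, Num.max 0 x]%R &
    sin (Num.max 0 x) - sin (Num.min 0 x) = cos c * (Num.max 0 x - Num.min 0 x).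
  apply: (@MVT_segment _ sin cos) => //; first by rewrite ge_min le_max lexx.
  by apply/continuous_subspaceT => z; exact: continuous_sin.
have key : `|c| <= `|x| -> sin x = cos c * x -> `|sin x - x| <= `|x| ^+ 3 / 2.
  move=> cx ->; rewrite -[X in _ - X]mul1r -mulrBl normrM exprSr mulrAC.
  rewrite ler_wpM2r// (le_trans (cos_sub1_le c))// ler_pM2r ?invr_gt0//.
  by rewrite -[c ^+ 2]real_normK ?num_real// lerXn2r ?nnegrE.
rewrite in_itv/=; case: (leP 0 x) => x0 /andP[c1 c2].
  by rewrite sin0 !subr0 => E; apply: key => //; rewrite !ger0_norm.
rewrite sin0 !sub0r mulrN => /oppr_inj E; apply: key => //.
by rewrite !ler0_norm ?lerN2// ltW.
Qed.

(** Half-angle formula: with y = x/2 the remainder is 2 (y - sin y)(y + sin y), at most 2 (|y|^3 /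
    2)(2 |y|). *)
Lemma cos_taylor (x : R) : `|cos x - (1 - x ^+ 2 / 2)| <= x ^+ 4 / 8.
Proof.
set y := x / 2.
have -> : cos x - (1 - x ^+ 2 / 2) = 2 * ((y - sin y) * (y + sin y)).
  rewrite {1}(_ : x = y *+ 2); last by rewrite /y; field.
  rewrite cos_mulr2n cos2sin2 (_ : x = 2 * y); first by field.
  by rewrite /y; field.
rewrite normrM normrM ger0_norm// distrC.
have h1 := sin_sub_le y.
have h2 : `|y + sin y| <= 2 * `|y|.
  by rewrite (le_trans (ler_normD _ _))//; have := sin_le_norm y; lra.
apply: (@le_trans _ _ (2 * ((`|y| ^+ 3 / 2) * (2 * `|y|)))).
  by rewrite ler_pM2l// ler_pM.
have -> : x ^+ 4 = 16 * (`|y| ^+ 2) ^+ 2.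
  by rewrite real_normK ?num_real// /y; field.
by rewrite le_eqVlt; apply/orP; left; apply/eqP; field.
Qed.

Lemma cos_lipschitz (x y : R) : `|cos x - cos y| <= `|x - y|.
Proof.
set s := (x + y) / 2; set t := (x - y) / 2.
rewrite (_ : cos x = cos (s + t)); last by congr cos; rewrite /s /t; field.
rewrite (_ : cos y = cos (s - t)); last by congr cos; rewrite /s /t; field.
rewrite cosD cosB (_ : _ - _ = - (2 * (sin s * sin t))); last by ring.
rewrite (_ : x - y = 2 * t); last by rewrite /t; field.
rewrite normrN (normrM 2) (normrM 2) ler_pM2l ?normr_gt0// normrM.
by rewrite (le_trans _ (sin_le_norm t))// ler_piMl// sin_max.
Qed.

(** The upper bound is multiplied by exp y >= 1 + y and reduces to (1 - y + y^2)(1 + y) = 1 + y^3 >=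
    1. *)
Lemma expRN_taylor (y : R) : 0 <= y -> `|expR (- y) - (1 - y)| <= y ^+ 2.
Proof.
move=> y0; have h1 : 1 - y <= expR (- y) by exact: expR_ge1Dx.
rewrite ger0_norm ?subr_ge0// expRN lerBlDl.
rewrite -(@ler_pM2r _ (expR y)) ?expR_gt0// mulVf ?gt_eqF ?expR_gt0//.
have h2 : 1 + y <= expR y by exact: expR_ge1Dx.
apply: (@le_trans _ _ ((1 - y + y ^+ 2) * (1 + y))); last first.
  by rewrite ler_wpM2l//; nra.
have := exprn_ge0 3 y0; nra.
Qed.

End taylor.

Section lindeberg.
Context {R : realType}.

(** A small centred variable is exchanged for a Gaussian N of the same variance v. The Gaussian is
    already integrated out, as E cos(N + u) = exp(- v/2) cos u. *)
Lemma lindeberg_step (mu : probability R R) (phi : R -> R) (B u : R) :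
  bmfun phi -> 0 <= B -> B <= 1 -> (forall x, `|phi x| <= B) -> mean mu phi = 0 ->
  `|mean mu (fun x => cos (phi x + u)) -
    expR (- (mean mu (fun x => phi x ^+ 2) / 2)) * cos u| <= B ^+ 3.
Proof.
move=> bphi B0 B1 phiB m0; set v := mean mu (fun x => phi x ^+ 2).
have bc : bmfun (fun x => cos (phi x)) by apply: bmfun_cos; case: bphi.
have bs : bmfun (fun x => sin (phi x)) by apply: bmfun_sin; case: bphi.
have b2 : bmfun (fun x => phi x ^+ 2) by exact: bmfunX.
have phi2 x : phi x ^+ 2 <= B ^+ 2.
  by rewrite -real_normK ?num_real// lerXn2r ?nnegrE.
have v0 : 0 <= v by apply: mean_ge0 => x; apply: sqr_ge0.
have vB : v <= B ^+ 2 by exact: le_mean_cst.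
have B2 : B ^+ 2 <= 1 by rewrite exprn_ile1.
have B40 : B ^+ 4 <= B ^+ 3 by rewrite ler_wiXn2l.
have E : mean mu (fun x => cos (phi x + u)) =
    mean mu (fun x => cos (phi x)) * cos u - mean mu (fun x => sin (phi x)) * sin u.
  rewrite [X in X - _]mulrC [X in _ - X]mulrC -!meanZ// -meanB; [|exact: bmfunZ..].
  by apply: eq_mean => x; rewrite cosD; ring.
have Ec : `|mean mu (fun x => cos (phi x)) - (1 - v / 2)| <= B ^+ 4 / 8.
  have -> : 1 - v / 2 = mean mu (fun x => 1 - 2^-1 * phi x ^+ 2).
    by rewrite meanB ?mean_cst ?meanZ ?[2^-1 * _]mulrC//; [exact: bmfun_cst|exact: bmfunZ].
  have bq : bmfun (fun x => 1 - 2^-1 * phi x ^+ 2).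
    by apply: bmfunB; [exact: bmfun_cst|exact: bmfunZ].
  rewrite -meanB//; apply: norm_mean_le; first exact: bmfunB.
  move=> x; rewrite [2^-1 * _]mulrC (le_trans (cos_taylor _))// ler_pM2r ?invr_gt0//.
  by rewrite (exprM _ 2 2) (exprM _ 2 2) lerXn2r ?nnegrE ?sqr_ge0.
have Es : `|mean mu (fun x => sin (phi x))| <= B ^+ 3 / 2.
  rewrite -[mean mu (fun x => sin _)]subr0 -m0 -meanB//.
  apply: norm_mean_le; first exact: bmfunB.
  move=> x; rewrite (le_trans (sin_sub_le _))// ler_pM2r ?invr_gt0//.
  by rewrite lerXn2r ?nnegrE.
have Ee : `|expR (- (v / 2)) - (1 - v / 2)| <= B ^+ 4 / 4.
  rewrite (le_trans (expRN_taylor _)) ?divr_ge0//.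
  rewrite (_ : (v / 2) ^+ 2 = v ^+ 2 / 4); last by field.
  by rewrite ler_pM2r ?invr_gt0// (exprM _ 2 2) lerXn2r ?nnegrE ?sqr_ge0.
rewrite E; set C := mean mu (fun x => cos _) in Ec *.
set S := mean mu (fun x => sin _) in Es *; set X := expR _ in Ee *.
rewrite (_ : _ - _ = (C - (1 - v / 2)) * cos u - (X - (1 - v / 2)) * cos u - S * sin u);
  last by ring.
have mul1 (a b M : R) : `|a| <= M -> `|b| <= 1 -> `|a * b| <= M.
  move=> aM b1; rewrite normrM (le_trans _ aM)// ler_piMr//.
have c1 := mul1 _ _ _ Ec (cos_max u).
have c2 := mul1 _ _ _ Ee (cos_max u).
have c3 := mul1 _ _ _ Es (sin_max u).
have B30 : 0 <= B ^+ 3 by rewrite exprn_ge0.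
(* The three errors are B^4/8, B^4/4 and B^3/2; their sum is at most B^3 because B <= 1. *)
rewrite (le_trans (ler_normB _ _))// (le_trans (lerD (ler_normB _ _) c3))//.
by lra.
Qed.

Context {I : finType} {d : measure_display} {T : measurableType d}.
Variables (P : probability T R) (Z : I -> T -> R) (mu : I -> probability R R).
Hypothesis indepZ : indep_law P Z mu.

(** Induction on the list of summands. The head is averaged with the others frozen, which turns it
    into the factor exp(- vi/2) at the cost [B i ^+ 3]; this factor is at most 1, so the error of
    the tail is not amplified. *)
Lemma lindeberg (phi : I -> R -> R) (B : I -> R) (c : R) :
  (forall i, bmfun (phi i)) -> (forall i, 0 <= B i <= 1) ->
  (forall i x, `|phi i x| <= B i) -> (forall i, mean (mu i) (phi i) = 0) ->
  `|mean P (fun w => cos (\sum_i phi i (Z i w) + c)) -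
    expR (- ((\sum_i mean (mu i) (fun x => phi i x ^+ 2)) / 2)) * cos c| <=
  \sum_i B i ^+ 3.
Proof.
move=> bphi B01 phiB m0; have [mZ _] := indepZ.
have : uniq (index_enum I) by exact: index_enum_uniq.
elim: (index_enum I) => [_|i s IH /= /andP[is_ us]].
  rewrite !big_nil mul0r oppr0 expR0 mul1r.
  under eq_mean do rewrite big_nil add0r.
  by rewrite mean_cst subrr normr0.
pose S (z : I -> R) := \sum_(j <- s) phi j (z j).
have bS : bmjoint S.
  apply: bmfun_sum => j _; apply: (bmfun_compr _ (bphi j)).
  exact: measurable_coords.
have SE w : \sum_(j <- s) phi j (Z j w) = S (Z^~ w) by [].
(* The tail does not involve coordinate [i], since the index list has no repetition. *)
have updS z x : S (upd z i x) = S z.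
  rewrite /S !big_seq; apply: eq_bigr => j js; rewrite /upd.
  by case: eqP js => // ->; rewrite (negbTE is_).
set v := \sum_(j <- s) _ in IH.
set vi := mean (mu i) (fun x => phi i x ^+ 2).
rewrite !big_cons -/v -/vi.
have vi0 : 0 <= vi by apply: mean_ge0 => x; exact: sqr_ge0.
have bcS : bmjoint (fun z => cos (S z + c)).
  apply: (bmfun_cos (f := fun t => S (coords t) + c)).
  by apply: measurable_funD => //; case: bS.
have bH : bmjoint (fun z => cos (phi i (z i) + (S z + c))).
  apply: (bmfun_cos (f := fun t => phi i (coords t i) + (S (coords t) + c))).
  apply: measurable_funD; last by apply: measurable_funD => //; case: bS.
  by have [] := bmfun_compr (measurable_coords i) (bphi i).
have E : mean P (fun w => cos (\sum_(j <- i :: s) phi j (Z j w) + c)) =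
    mean P (fun w => mean (mu i) (fun x => cos (phi i x + (S (Z^~ w) + c)))).
  rewrite (@eq_mean _ _ _ _ _ (fun w => (fun z => cos (phi i (z i) + (S z + c))) (Z^~ w))).
    rewrite (mean_resample indepZ i bH); apply: eq_mean => w; apply: eq_mean => x.
    by rewrite updS /upd eqxx.
  by move=> w; rewrite big_cons SE addrA.
rewrite E.
have bE : bmfun (fun w => mean (mu i) (fun x => cos (phi i x + (S (Z^~ w) + c)))).
  have bf : bmfun (fun wx : T * R => cos (phi i wx.2 + (S (Z^~ wx.1) + c))).
    apply: bmfun_cos; apply: measurable_funD.
      by apply: (measurableT_comp (f := phi i)) => //; case: (bphi i).
    apply: measurable_funD => //.
    apply: (measurableT_comp (f := fun w => S (Z^~ w))) => //.
    by case: (bmjoint_comp mZ bS).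
  exact: (bmfun_mean1 P (mu i) bf).
have bcSZ : bmfun (fun w => cos (S (Z^~ w) + c)) := bmjoint_comp mZ bcS.
pose e := expR (- (vi / 2)).
have e01 : 0 <= e <= 1.
  by rewrite /e expR_ge0/= -expR0 ler_expR oppr_le0 divr_ge0.
apply: (@le_trans _ _ (B i ^+ 3 + e * \sum_(j <- s) B j ^+ 3)); last first.
  case/andP: e01 => e0 e1; rewrite lerD2l ler_piMl// sumr_ge0// => j _.
  by rewrite exprn_ge0//; case/andP: (B01 j).
rewrite (_ : _ - _ = (mean P (fun w => mean (mu i) (fun x => cos (phi i x + (S (Z^~ w) + c))))
  - e * mean P (fun w => cos (S (Z^~ w) + c))) +
  e * (mean P (fun w => cos (S (Z^~ w) + c)) - expR (- (v / 2)) * cos c)); last first.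
  rewrite (_ : - ((vi + v) / 2) = - (vi / 2) + - (v / 2)); last by field.
  by rewrite expRD -/e; ring.
rewrite (le_trans (ler_normD _ _))// lerD//; last first.
  case/andP: e01 => e0 e1; rewrite normrM ger0_norm// ler_wpM2l//.
  exact: IH.
rewrite -meanZ// -meanB//; last exact: bmfunZ.
apply: norm_mean_le; first by apply: bmfunB => //; exact: bmfunZ.
by move=> w; case/andP: (B01 i) => ? ?; apply: lindeberg_step.
Qed.

End lindeberg.

(** * Two-sample U-statistics *)

Section orthogonality.
Context {R : realType} {d : measure_display} {T : measurableType d}.
Variable P : probability T R.

Lemma mean_sqr_orthogonal (J : finType) (D : J -> T -> R) (C : R) :
  (forall p, bmfun (D p)) -> (forall p w, `|D p w| <= C) ->
  (forall p q, p != q -> mean P (fun w => D p w * D q w) = 0) ->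
  mean P (fun w => (\sum_p D p w) ^+ 2) <= #|J|%:R * C ^+ 2.
Proof.
move=> bD DC orth.
rewrite (@eq_mean _ _ _ _ _ (fun w => \sum_p \sum_q D p w * D q w)); last first.
  by move=> w; rewrite expr2 big_distrlr.
rewrite mean_sum; last by move=> p _; apply: bmfun_sum => q _; exact: bmfunM.
rewrite (eq_bigr (fun p => mean P (fun w => D p w ^+ 2))); last first.
  move=> p _; rewrite mean_sum; last by move=> q _; exact: bmfunM.
  by rewrite (bigD1 p)//= [X in _ + X]big1 ?addr0// => q qp; rewrite orth// eq_sym.
apply: (@le_trans _ _ (\sum_(p : J) C ^+ 2)); last by rewrite sumr_const mulr_natl.
apply: ler_sum => p _; apply: le_mean_cst; first exact: bmfunX.
move=> w; rewrite -real_normK ?num_real// lerXn2r ?nnegrE//.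
by rewrite (le_trans _ (DC p w)).
Qed.

Lemma mean_sqr_average (J : finType) (D : J -> T -> R) (C : R) : (0 < #|J|)%N ->
  (forall p, bmfun (D p)) -> (forall p w, `|D p w| <= C) ->
  (forall p q, p != q -> mean P (fun w => D p w * D q w) = 0) ->
  mean P (fun w => (#|J|%:R^-1 * \sum_p D p w) ^+ 2) <= C ^+ 2 / #|J|%:R.
Proof.
move=> J0 bD DC orth.
have JJ : 0 < #|J|%:R :> R by rewrite ltr0n.
under eq_mean do rewrite exprMn.
rewrite meanZ; last by apply: bmfunX; apply: bmfun_sum.
have N2 : 0 <= #|J|%:R^-1 ^+ 2 :> R by exact: sqr_ge0.
rewrite (le_trans (ler_wpM2l N2 (mean_sqr_orthogonal bD DC orth)))//.
by rewrite le_eqVlt; apply/orP; left; apply/eqP; field; rewrite gt_eqF.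
Qed.

End orthogonality.

Section two_sample_statistics.
Context {R : realType} {I : finType} {d : measure_display} {T : measurableType d}.
Variables (P : probability T R) (Z : I -> T -> R) (muI : I -> probability R R).
Hypothesis indepZ : indep_law P Z muI.

(** [D] is centred in coordinate [i] and [D'] does not depend on it, so redrawing this coordinate
    makes the product average to 0. *)
Lemma mean_orthogonal (i : I) (D D' : (I -> R) -> R) : bmjoint D -> bmjoint D' ->
  (forall z x, D' (upd z i x) = D' z) ->
  (forall z, mean (muI i) (fun x => D (upd z i x)) = 0) ->
  mean P (fun w => D (Z^~ w) * D' (Z^~ w)) = 0.
Proof.
move=> bD bD' updD' mD; have [mZ _] := indepZ.
rewrite (mean_resample indepZ i (H := fun z => D z * D' z)); last exact: bmfunM.
have bu w : bmfun (fun x => D (upd (Z^~ w) i x)).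
  apply: (bmjoint_comp (Z := fun j x => upd (Z^~ w) i x j)) => // j.
  by apply: (measurable_upd (Z' := fun j _ => Z j w)) => // k; exact: measurable_cst.
rewrite (@eq_mean _ _ _ _ _ (fun=> 0)) ?mean_cst// => w.
rewrite (@eq_mean _ _ _ _ _ (fun x => D' (Z^~ w) * D (upd (Z^~ w) i x))).
  by rewrite meanZ// mD mulr0.
by move=> x; rewrite updD' mulrC.
Qed.

Variables (n m : nat) (p : 'I_n -> I) (q : 'I_m -> I) (mu rho : probability R R).
Hypotheses (n0 : (0 < n)%N) (m0 : (0 < m)%N).
Hypotheses (p_inj : injective p) (q_inj : injective q) (pq : forall i j, p i != q j).
Hypotheses (muX : forall i, muI (p i) = mu) (muY : forall j, muI (q j) = rho).

Lemma mean_sqr_lln (f : R -> R) (C : R) : bmfun f -> (forall x, `|f x| <= C) ->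
  mean P (fun w => (n%:R^-1 * \sum_i f (Z (p i) w) - mean mu f) ^+ 2) <=
  (2 * C) ^+ 2 / n%:R.
Proof.
move=> bf fC; have [mZ _] := indepZ.
pose D (i : 'I_n) (z : I -> R) := f (z (p i)) - mean mu f.
have bD i : bmjoint (D i).
  apply: bmfunB; last exact: bmfun_cst.
  by apply: (bmfun_compr _ bf); exact: measurable_coords.
have nn : n%:R != 0 :> R by rewrite pnatr_eq0 -lt0n.
have := @mean_sqr_average _ _ _ P _ (fun i w => D i (Z^~ w)) (2 * C).
rewrite card_ord => /(_ n0) H.
rewrite (@eq_mean _ _ _ _ _ (fun w => (n%:R^-1 * \sum_i D i (Z^~ w)) ^+ 2)).
  apply: H => [i|i w|i j ij].
  - exact: bmjoint_comp.
  - rewrite /D (le_trans (ler_normB _ _))// mulr_natl mulr2n lerD//.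
    exact: norm_mean_le.
  - apply: (@mean_orthogonal (p i)) => //.
      by move=> z x; rewrite /D /upd (inj_eq p_inj) eq_sym (negbTE ij).
    move=> z; rewrite /D /upd eqxx muX meanB//; last exact: bmfun_cst.
    by rewrite mean_cst subrr.
move=> w; rewrite /D sumrB sumr_const card_ord -[mean mu f *+ n]mulr_natl; congr (_ ^+ 2).
by field.
Qed.

Variables (k : R * R -> R) (B : R).
Hypotheses (bk : bmfun k) (kB : forall z, `|k z| <= B).

(** With [proj2] and [theta], the terms of the Hoeffding decomposition of the two-sample
    U-statistic. *)
Definition proj1 x := mean rho (fun y => k (x, y)).
Definition proj2 y := mean mu (fun x => k (x, y)).
Definition theta := mean mu proj1.

Let B0 : 0 <= B. Proof. by rewrite (le_trans _ (kB 0)). Qed.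

Lemma bmfun_kx x : bmfun (fun y => k (x, y)).
Proof. exact: (bmfun_compr (u := pair x)). Qed.

Lemma bmfun_ky y : bmfun (fun x => k (x, y)).
Proof. exact: (bmfun_compr (u := pair^~ y)). Qed.

Lemma bmfun_proj1 : bmfun proj1. Proof. exact: (bmfun_mean1 mu rho bk). Qed.

Lemma bmfun_proj2 : bmfun proj2.
Proof.
apply: (bmfun_mean1 (f := fun yx => k (yx.2, yx.1)) rho mu).
apply: (bmfun_compr (u := fun yx : R * R => (yx.2, yx.1)) _ bk).
exact: measurable_fun_pair.
Qed.

Lemma theta_proj2 : theta = mean rho proj2.
Proof. by rewrite /theta /proj1 /proj2 -(mean_prod mu rho bk) (mean_prod_swap mu rho bk). Qed.

Lemma proj1_le x : `|proj1 x| <= B.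
Proof. by apply: norm_mean_le => //; exact: bmfun_kx. Qed.

Lemma proj2_le y : `|proj2 y| <= B.
Proof. by apply: norm_mean_le => //; exact: bmfun_ky. Qed.

Lemma theta_le : `|theta| <= B.
Proof. by apply: norm_mean_le; [exact: bmfun_proj1|exact: proj1_le]. Qed.

(** The index maps [p] and [q] are kept general so that the bounds can be reused with the two
    samples exchanged, as is done for the second variance component. *)
Definition ustat w := (n%:R * m%:R)^-1 * \sum_i \sum_j k (Z (p i) w, Z (q j) w).

Definition proj1_hat w x := m%:R^-1 * \sum_j k (x, Z (q j) w).

Lemma bmjoint_k i j : bmjoint (fun z : I -> R => k (z i, z j)).
Proof.
apply: (bmfun_compr (u := fun t => (coords t i, coords t j)) _ bk).
by apply: measurable_fun_pair; exact: measurable_coords.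
Qed.

(** The differences k(X_i, Y_j) - proj1(X_i) are centred in Y_j for fixed X_i, hence orthogonal in
    j. *)
Lemma mean_sqr_proj1_hat i :
  mean P (fun w => (proj1_hat w (Z (p i) w) - proj1 (Z (p i) w)) ^+ 2) <=
  (2 * B) ^+ 2 / m%:R.
Proof.
have [mZ _] := indepZ.
pose D (j : 'I_m) (z : I -> R) := k (z (p i), z (q j)) - proj1 (z (p i)).
have bD j : bmjoint (D j).
  apply: bmfunB; first exact: bmjoint_k.
  by apply: (bmfun_compr _ bmfun_proj1); exact: measurable_coords.
have mm : m%:R != 0 :> R by rewrite pnatr_eq0 -lt0n.
have := @mean_sqr_average _ _ _ P _ (fun j w => D j (Z^~ w)) (2 * B).
rewrite card_ord => /(_ m0) H.
rewrite (@eq_mean _ _ _ _ _ (fun w => (m%:R^-1 * \sum_j D j (Z^~ w)) ^+ 2)).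
  apply: H => [j|j w|j j' jj].
  - exact: bmjoint_comp.
  - rewrite /D (le_trans (ler_normB _ _))// mulr_natl mulr2n lerD//.
    exact: proj1_le.
  - apply: (@mean_orthogonal (q j)) => //.
      move=> z x; rewrite /D /upd (inj_eq q_inj) [j' == j]eq_sym (negbTE jj).
      by rewrite (negbTE (pq _ _)).
    move=> z; rewrite /D /upd eqxx (negbTE (pq _ _)) muY meanB//.
    + by rewrite mean_cst subrr.
    + exact: bmfun_kx.
    + exact: bmfun_cst.
move=> w; rewrite /D sumrB sumr_const card_ord -[proj1 _ *+ m]mulr_natl /proj1_hat; congr (_ ^+ 2).
by field.
Qed.

(** The terms of the Hoeffding remainder are centred in each argument, so distinct pairs are
    orthogonal: pairs with different first index are averaged over X_i, the others over Y_j. Even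
    after multiplication by n the bound is of order 1/m, so the linear part carries the limit. *)
Lemma mean_sqr_degenerate :
  mean P (fun w => (ustat w - theta - (n%:R^-1 * \sum_i (proj1 (Z (p i) w) - theta) +
    m%:R^-1 * \sum_j (proj2 (Z (q j) w) - theta))) ^+ 2) <=
  (4 * B) ^+ 2 / (n%:R * m%:R).
Proof.
have [mZ _] := indepZ.
pose D (ij : 'I_n * 'I_m) (z : I -> R) :=
  k (z (p ij.1), z (q ij.2)) - proj1 (z (p ij.1)) - proj2 (z (q ij.2)) + theta.
have bproj i j : bmjoint (fun z : I -> R => proj1 (z i)) /\
    bmjoint (fun z : I -> R => proj2 (z j)).
  split; first by apply: (bmfun_compr _ bmfun_proj1); exact: measurable_coords.
  by apply: (bmfun_compr _ bmfun_proj2); exact: measurable_coords.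
have bD ij : bmjoint (D ij).
  have [b1 b2] := bproj (p ij.1) (q ij.2).
  by apply: bmfunD (bmfun_cst _); apply: bmfunB b2; apply: bmfunB b1; exact: bmjoint_k.
have nn : n%:R != 0 :> R by rewrite pnatr_eq0 -lt0n.
have mm : m%:R != 0 :> R by rewrite pnatr_eq0 -lt0n.
have := @mean_sqr_average _ _ _ P _ (fun ij w => D ij (Z^~ w)) (4 * B).
rewrite card_prod !card_ord muln_gt0 n0 m0 => /(_ isT); rewrite natrM => H.
rewrite (@eq_mean _ _ _ _ _ (fun w => ((n%:R * m%:R)^-1 * \sum_ij D ij (Z^~ w)) ^+ 2)).
  apply: H => [ij|ij w|[i j] [i' j'] ij].
  - exact: bmjoint_comp.
  - rewrite /D (_ : 4 * B = B + B + B + B); last by ring.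
    rewrite (le_trans (ler_normD _ _))// lerD ?theta_le//.
    rewrite (le_trans (ler_normB _ _))// lerD ?proj2_le//.
    by rewrite (le_trans (ler_normB _ _))// lerD ?proj1_le.
  - have [ii|ii] := eqVneq i i'; last first.
      apply: (@mean_orthogonal (p i)) => //.
        move=> z x; rewrite /D /upd /= (inj_eq p_inj) [i' == i]eq_sym (negbTE ii).
        by rewrite ![q _ == _]eq_sym !(negbTE (pq _ _)).
      move=> z; rewrite /D /upd /= eqxx muX ![q _ == _]eq_sym !(negbTE (pq _ _)).
      have b1 := bmfun_ky (z (q j)); have b2 := bmfun_proj1.
      rewrite meanD; [|by apply: bmfunB (bmfun_cst _); exact: bmfunB|exact: bmfun_cst].
      rewrite meanB; [|exact: bmfunB|exact: bmfun_cst].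
      by rewrite meanB// !mean_cst -/theta -/(proj2 _); ring.
    have jj : j != j' by apply: contra_neq ij => ->; rewrite ii.
    apply: (@mean_orthogonal (q j)) => //.
      move=> z x; rewrite /D /upd /= (inj_eq q_inj) [j' == j]eq_sym (negbTE jj).
      by rewrite !(negbTE (pq _ _)).
    move=> z; rewrite /D /upd /= eqxx muY !(negbTE (pq _ _)).
    have b1 := bmfun_kx (z (p i)); have b2 := bmfun_proj2.
    rewrite meanD; [|by apply: bmfunB => //; exact: bmfunB (bmfun_cst _)|exact: bmfun_cst].
    rewrite meanB//; last exact: bmfunB (bmfun_cst _).
    by rewrite meanB ?mean_cst -?theta_proj2 -/(proj1 _)//; [ring|exact: bmfun_cst].
move=> w; congr (_ ^+ 2).
pose S2 := \sum_j proj2 (Z (q j) w).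
have -> : \sum_ij D ij (Z^~ w) = \sum_i \sum_j k (Z (p i) w, Z (q j) w) -
    m%:R * \sum_i proj1 (Z (p i) w) - n%:R * S2 + n%:R * m%:R * theta.
  rewrite -(pair_big xpredT xpredT (fun i j => D (i, j) (Z^~ w)))/=.
  transitivity (\sum_i ((\sum_j k (Z (p i) w, Z (q j) w)) - m%:R * proj1 (Z (p i) w) -
      S2 + m%:R * theta)).
    apply: eq_bigr => i _; rewrite /D big_split/= !sumrB !sumr_const card_ord.
    by rewrite !mulr_natl.
  rewrite big_split/= !sumrB -mulr_sumr !sumr_const card_ord.
  by rewrite -[S2 *+ n]mulr_natl -[(m%:R * theta) *+ n]mulr_natl mulrA.
rewrite !sumrB !sumr_const !card_ord -/S2 /ustat.
rewrite -[theta *+ n]mulr_natl -[theta *+ m]mulr_natl; field.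
by rewrite nn mm.
Qed.

End two_sample_statistics.

Section two_sample_bounds.
Context {R : realType} {I : finType} {d : measure_display} {T : measurableType d}.
Variables (P : probability T R) (Z : I -> T -> R) (muI : I -> probability R R).
Hypothesis indepZ : indep_law P Z muI.
Variables (n m : nat) (p : 'I_n -> I) (q : 'I_m -> I) (mu rho : probability R R).
Hypotheses (n0 : (0 < n)%N) (m0 : (0 < m)%N).
Hypotheses (p_inj : injective p) (q_inj : injective q) (pq : forall i j, p i != q j).
Hypotheses (muX : forall i, muI (p i) = mu) (muY : forall j, muI (q j) = rho).

Let rn0 : 0 < Num.sqrt n%:R :> R. Proof. by rewrite sqrtr_gt0 ltr0n. Qed.
Let rm0 : 0 < Num.sqrt m%:R :> R. Proof. by rewrite sqrtr_gt0 ltr0n. Qed.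
Let nE : n%:R = Num.sqrt n%:R ^+ 2 :> R. Proof. by rewrite sqr_sqrtr. Qed.
Let mE : m%:R = Num.sqrt m%:R ^+ 2 :> R. Proof. by rewrite sqr_sqrtr. Qed.
Let nn : n%:R != 0 :> R. Proof. by rewrite pnatr_eq0 -lt0n. Qed.
Let mm : m%:R != 0 :> R. Proof. by rewrite pnatr_eq0 -lt0n. Qed.

Lemma mean_norm_lln (f : R -> R) (C : R) : bmfun f -> (forall x, `|f x| <= C) ->
  mean P (fun w => `|n%:R^-1 * \sum_i f (Z (p i) w) - mean mu f|) <=
  2 * C / Num.sqrt n%:R.
Proof.
move=> bf fC; have [mZ _] := indepZ.
have C0 : 0 <= C by rewrite (le_trans _ (fC 0)).
apply: mean_norm_sqrt.
- apply: bmfunB; last exact: bmfun_cst.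
  by apply: bmfunZ; apply: bmfun_sum => i _; exact: bmfun_compr.
- by rewrite divr_ge0 ?mulr_ge0// ltW.
- by rewrite expr_div_n -nE; apply: (mean_sqr_lln indepZ n0 p_inj muX).
Qed.

Variables (k : R * R -> R) (B : R).
Hypotheses (bk : bmfun k) (kB : forall z, `|k z| <= B).

Let B0 : 0 <= B. Proof. by rewrite (le_trans _ (kB 0)). Qed.
Local Notation proj1 := (proj1 rho k).
Local Notation proj2 := (proj2 mu k).
Local Notation theta := (theta mu rho k).
Local Notation ustat := (ustat Z p q k).
Local Notation proj1_hat := (proj1_hat Z q k).

Lemma ustatE w : ustat w = n%:R^-1 * \sum_i proj1_hat w (Z (p i) w).
Proof.
by rewrite /ustat -mulr_sumr mulrA invfM.
Qed.

Lemma ustat_le w : `|ustat w| <= B.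
Proof.
rewrite normrM ger0_norm ?invr_ge0 ?mulr_ge0// mulrC.
rewrite ler_pdivrMr ?mulr_gt0 ?ltr0n//.
rewrite (le_trans (ler_norm_sum _ _ _))//.
apply: (@le_trans _ _ (\sum_(i < n) \sum_(j < m) B)).
  by apply: ler_sum => i _; rewrite (le_trans (ler_norm_sum _ _ _))// ler_sum.
by rewrite !sumr_const !card_ord -mulrnA mulnC -natrM mulr_natr.
Qed.

Lemma proj1_hat_le w x : `|proj1_hat w x| <= B.
Proof.
rewrite normrM ger0_norm ?invr_ge0// mulrC ler_pdivrMr ?ltr0n//.
rewrite (le_trans (ler_norm_sum _ _ _))//.
apply: (@le_trans _ _ (\sum_(j < m) B)); first exact: ler_sum.
by rewrite sumr_const card_ord mulr_natr.
Qed.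

Lemma bmfun_kXY i j : bmfun (fun w => k (Z i w, Z j w)).
Proof. have [mZ _] := indepZ; exact: (bmjoint_comp mZ (bmjoint_k bk i j)). Qed.

Lemma bmfun_ustat : bmfun ustat.
Proof.
apply: bmfunZ; apply: bmfun_sum => i _; apply: bmfun_sum => j _.
exact: bmfun_kXY.
Qed.

Lemma bmfun_proj1_hat i : bmfun (fun w => proj1_hat w (Z (p i) w)).
Proof. by apply: bmfunZ; apply: bmfun_sum => j _; exact: bmfun_kXY. Qed.

Lemma bmfun_proj1X i : bmfun (fun w => proj1 (Z (p i) w)).
Proof. by have [mZ _] := indepZ; apply: bmfun_compr (bmfun_proj1 mu rho bk). Qed.

Lemma mean_norm_proj1_hat :
  mean P (fun w => n%:R^-1 * \sum_i `|proj1_hat w (Z (p i) w) - proj1 (Z (p i) w)|) <=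
  2 * B / Num.sqrt m%:R.
Proof.
have bi i : bmfun (fun w => proj1_hat w (Z (p i) w) - proj1 (Z (p i) w)).
  by apply: bmfunB; [exact: bmfun_proj1_hat|exact: bmfun_proj1X].
rewrite meanZ; last by apply: bmfun_sum => i _; exact: bmfun_norm.
rewrite mean_sum; last by move=> i _; exact: bmfun_norm.
rewrite mulrC ler_pdivrMr ?ltr0n//.
apply: (@le_trans _ _ (\sum_(i < n) 2 * B / Num.sqrt m%:R)).
  apply: ler_sum => i _; apply: mean_norm_sqrt => //.
    by rewrite divr_ge0 ?mulr_ge0// ltW.
  rewrite expr_div_n -mE.
  exact: (mean_sqr_proj1_hat indepZ mu m0 q_inj pq muY bk kB).
by rewrite sumr_const card_ord mulr_natr.
Qed.

Lemma norm_ustat_sub w : `|ustat w - theta| <=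
  n%:R^-1 * (\sum_i `|proj1_hat w (Z (p i) w) - proj1 (Z (p i) w)|) +
  `|n%:R^-1 * \sum_i proj1 (Z (p i) w) - theta|.
Proof.
rewrite ustatE (_ : _ - _ = n%:R^-1 * \sum_i (proj1_hat w (Z (p i) w) -
  proj1 (Z (p i) w)) + (n%:R^-1 * \sum_i proj1 (Z (p i) w) - theta)); last first.
  by rewrite sumrB; ring.
rewrite (le_trans (ler_normD _ _))// lerD2r normrM ger0_norm ?invr_ge0//.
by rewrite ler_wpM2l ?invr_ge0//; exact: ler_norm_sum.
Qed.

(** The variance of [proj1] with both laws replaced by empirical ones: the first variance component
    of the bootstrap given the data. *)
Definition var1_hat w := n%:R^-1 * \sum_i (proj1_hat w (Z (p i) w) - ustat w) ^+ 2.

Lemma bmfun_var1_hat : bmfun var1_hat.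
Proof.
apply: bmfunZ; apply: bmfun_sum => i _; apply: bmfunX.
by apply: bmfunB; [exact: bmfun_proj1_hat|exact: bmfun_ustat].
Qed.

(** a^2 - b^2 = (a + b)(a - b), where |a + b| <= 4 B and a - b is controlled by the error [E1] of
    the estimated projections and the error [E2] of their mean; [E3] is the law of large numbers for
    the squares. *)
Lemma mean_norm_var1_hat :
  mean P (fun w => `|var1_hat w - mean mu (fun x => (proj1 x - theta) ^+ 2)|) <=
  16 * B ^+ 2 * ((Num.sqrt n%:R)^-1 + (Num.sqrt m%:R)^-1).
Proof.
have [mZ _] := indepZ.
set v := mean mu _.
have bp1 : bmfun proj1 := bmfun_proj1 mu rho bk.
have bf : bmfun (fun x => (proj1 x - theta) ^+ 2).
  by apply: bmfunX; apply: bmfunB => //; exact: bmfun_cst.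
have p1B x : `|proj1 x - theta| <= 2 * B.
  rewrite (le_trans (ler_normB _ _))// mulr_natl mulr2n lerD//.
    exact: proj1_le.
  exact: theta_le.
have fC x : `|(proj1 x - theta) ^+ 2| <= 4 * B ^+ 2.
  rewrite normrX (_ : 4 * B ^+ 2 = (2 * B) ^+ 2); last by ring.
  by rewrite lerXn2r ?nnegrE ?mulr_ge0.
pose E1 w := n%:R^-1 * (\sum_i `|proj1_hat w (Z (p i) w) - proj1 (Z (p i) w)|).
pose E2 w := `|n%:R^-1 * \sum_i proj1 (Z (p i) w) - theta|.
pose E3 w := `|n%:R^-1 * \sum_i (proj1 (Z (p i) w) - theta) ^+ 2 - v|.
have bE1 : bmfun E1.
  apply: bmfunZ; apply: bmfun_sum => i _; apply: bmfun_norm.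
  by apply: bmfunB; [exact: bmfun_proj1_hat|exact: bmfun_proj1X].
have bE2 : bmfun E2.
  apply: bmfun_norm; apply: bmfunB (bmfun_cst _); apply: bmfunZ.
  by apply: bmfun_sum => i _; exact: bmfun_proj1X.
have bE3 : bmfun E3.
  apply: bmfun_norm; apply: bmfunB (bmfun_cst _); apply: bmfunZ.
  by apply: bmfun_sum => i _; apply: (bmfun_compr _ bf).
have le w : `|var1_hat w - v| <= 8 * B * E1 w + 4 * B * E2 w + E3 w.
  have -> : var1_hat w - v =
      n%:R^-1 * \sum_i ((proj1_hat w (Z (p i) w) - ustat w) ^+ 2 -
        (proj1 (Z (p i) w) - theta) ^+ 2) +
      (n%:R^-1 * \sum_i (proj1 (Z (p i) w) - theta) ^+ 2 - v).
    by rewrite sumrB /var1_hat; ring.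
  rewrite (le_trans (ler_normD _ _))// lerD2r normrM ger0_norm ?invr_ge0//.
  have : n%:R^-1 * \sum_i `|proj1_hat w (Z (p i) w) - proj1 (Z (p i) w)| =
      E1 w by [].
  rewrite (le_trans (ler_wpM2l _ (ler_norm_sum _ _ _))) ?invr_ge0//.
  apply: (@le_trans _ _ (n%:R^-1 * \sum_i (4 * B * (`|proj1_hat w (Z (p i) w) -
      proj1 (Z (p i) w)| + (E1 w + E2 w))))).
    rewrite ler_wpM2l ?invr_ge0// ler_sum// => i _.
    have hs : `|(proj1_hat w (Z (p i) w) - ustat w) + (proj1 (Z (p i) w) - theta)| <=
        4 * B.
      rewrite (le_trans (ler_normD _ _))// (_ : 4 * B = B + B + 2 * B); last by ring.
      rewrite lerD// (le_trans (ler_normB _ _))// lerD ?ustat_le//.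
      exact: proj1_hat_le.
    have hd : `|(proj1_hat w (Z (p i) w) - ustat w) - (proj1 (Z (p i) w) - theta)| <=
        `|proj1_hat w (Z (p i) w) - proj1 (Z (p i) w)| + (E1 w + E2 w).
      rewrite (_ : _ - _ = (proj1_hat w (Z (p i) w) - proj1 (Z (p i) w)) -
        (ustat w - theta)); last by ring.
      by rewrite (le_trans (ler_normB _ _))// lerD2l; exact: norm_ustat_sub.
    by rewrite subr_sqr mulrC normrM ler_pM.
  rewrite -mulr_sumr big_split/= sumr_const card_ord -[(E1 w + E2 w) *+ n]mulr_natl.
  have -> : n%:R^-1 * (4 * B * (\sum_i `|proj1_hat w (Z (p i) w) - proj1 (Z (p i) w)| +
      n%:R * (E1 w + E2 w))) = 4 * B * (E1 w + (E1 w + E2 w)).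
    by rewrite /E1; field.
  lra.
apply: (@le_trans _ _ (mean P (fun w => 8 * B * E1 w + 4 * B * E2 w + E3 w))).
  apply: le_mean => //.
    by apply: bmfun_norm; apply: bmfunB (bmfun_cst _); exact: bmfun_var1_hat.
  by apply: bmfunD => //; apply: bmfunD; exact: bmfunZ.
rewrite meanD//; last by apply: bmfunD; exact: bmfunZ.
rewrite meanD//; [|exact: bmfunZ..].
rewrite (meanZ P _ bE1) (meanZ P _ bE2).
have h1 : mean P E1 <= 2 * B / Num.sqrt m%:R := mean_norm_proj1_hat.
have h2 : mean P E2 <= 2 * B / Num.sqrt n%:R.
  by apply: mean_norm_lln => //; exact: proj1_le.
have h3 : mean P E3 <= 2 * (4 * B ^+ 2) / Num.sqrt n%:R by exact: mean_norm_lln.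
have B8 : 0 <= 8 * B by rewrite mulr_ge0.
have B4 : 0 <= 4 * B by rewrite mulr_ge0.
apply: (le_trans (lerD (lerD (ler_wpM2l B8 h1) (ler_wpM2l B4 h2)) h3)).
by rewrite le_eqVlt; apply/orP; left; apply/eqP; ring.
Qed.

End two_sample_bounds.

Section two_sample_clt.
Context {R : realType} {d : measure_display} {T : measurableType d} {n m : nat}.
Variables (P : probability T R) (Z : 'I_n + 'I_m -> T -> R) (mu rho : probability R R).
Hypothesis indepZ : indep_law P Z (fun i => if i is inl _ then mu else rho).
Hypotheses (n0 : (0 < n)%N) (m0 : (0 < m)%N).
Variables (k : R * R -> R) (B : R).
Hypotheses (bk : bmfun k) (kB : forall z, `|k z| <= B).

Let B0 : 0 <= B. Proof. by rewrite (le_trans _ (kB 0)). Qed.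
Local Notation proj1 := (proj1 rho k).
Local Notation proj2 := (proj2 mu k).
Local Notation theta := (theta mu rho k).
Local Notation ustat := (ustat Z inl inr k).
Local Notation rn := (Num.sqrt (n%:R : R)).
Local Notation rm := (Num.sqrt (m%:R : R)).

Definition asym_var : R := mean mu (fun x => (proj1 x - theta) ^+ 2) +
  n%:R / m%:R * mean rho (fun y => (proj2 y - theta) ^+ 2).

(** The cubed bounds of the n + m summands of the linear part, then the Hoeffding remainder, sqrt n
    times 4 B / sqrt (n m). *)
Definition clt_error : R :=
  n%:R * (2 * B * rn / n%:R) ^+ 3 + m%:R * (2 * B * rn / m%:R) ^+ 3 + 4 * B / rm.

(** The cosine is 1-Lipschitz, so the U-statistic may be replaced by its linear part, a sum of n + m
    independent centred terms to which [lindeberg] applies. The two conditions keep the bounds of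
    these terms below 1. *)
Lemma ustat_clt (c : R) : 2 * B * rn / n%:R <= 1 -> 2 * B * rn / m%:R <= 1 ->
  `|mean P (fun w => cos (rn * (ustat w - theta) + c)) -
    expR (- (asym_var / 2)) * cos c| <= clt_error.
Proof.
move=> Bn Bm; have [mZ _] := indepZ.
have nn : n%:R != 0 :> R by rewrite pnatr_eq0 -lt0n.
have mm : m%:R != 0 :> R by rewrite pnatr_eq0 -lt0n.
have rn0 : 0 < rn by rewrite sqrtr_gt0 ltr0n.
have rm0 : 0 < rm by rewrite sqrtr_gt0 ltr0n.
have nE : n%:R = rn ^+ 2 by rewrite sqr_sqrtr.
have mE : m%:R = rm ^+ 2 by rewrite sqr_sqrtr.
have b1 : bmfun (fun x => proj1 x - theta).
  by apply: bmfunB (bmfun_cst _); exact: bmfun_proj1.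
have b2 : bmfun (fun x => proj2 x - theta).
  by apply: bmfunB (bmfun_cst _); exact: bmfun_proj2.
have p1B x : `|proj1 x - theta| <= 2 * B.
  by rewrite (le_trans (ler_normB _ _))// mulr_natl mulr2n lerD ?proj1_le ?theta_le.
have p2B x : `|proj2 x - theta| <= 2 * B.
  by rewrite (le_trans (ler_normB _ _))// mulr_natl mulr2n lerD ?proj2_le ?theta_le.
pose phi (i : 'I_n + 'I_m) (x : R) :=
  if i is inl _ then rn / n%:R * (proj1 x - theta) else rn / m%:R * (proj2 x - theta).
pose Bi (i : 'I_n + 'I_m) := if i is inl _ then 2 * B * rn / n%:R else 2 * B * rn / m%:R.
have bphi i : bmfun (phi i) by case: i => i; exact: bmfunZ.
have B01 i : 0 <= Bi i <= 1.
  by case: i => i; rewrite /Bi ?Bn ?Bm andbT divr_ge0// mulr_ge0 ?mulr_ge0// ltW.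
have phiB i x : `|phi i x| <= Bi i.
  case: i => i; rewrite /phi /Bi normrM ger0_norm ?divr_ge0 ?(ltW rn0)//.
    by rewrite -mulrA [X in _ <= X]mulrC ler_wpM2l ?divr_ge0 ?(ltW rn0).
  by rewrite -mulrA [X in _ <= X]mulrC ler_wpM2l ?divr_ge0 ?(ltW rn0).
have mphi i : mean (if i is inl _ then mu else rho) (phi i) = 0.
  case: i => i; rewrite /phi meanZ// meanB ?mean_cst.
  - by rewrite -/theta subrr mulr0.
  - exact: (bmfun_proj1 mu rho bk).
  - exact: bmfun_cst.
  - by rewrite theta_proj2// subrr mulr0.
  - exact: (bmfun_proj2 mu rho bk).
  - exact: bmfun_cst.
have := lindeberg indepZ c bphi B01 phiB mphi.
have E1 : \sum_i Bi i ^+ 3 = n%:R * (2 * B * rn / n%:R) ^+ 3 + m%:R * (2 * B * rn / m%:R) ^+ 3.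
  by rewrite big_sumType/= !sumr_const !card_ord !mulr_natl.
rewrite E1.
have E2 : \sum_i mean (if i is inl _ then mu else rho) (fun x => phi i x ^+ 2) = asym_var.
  rewrite big_sumType/= !sumr_const !card_ord /asym_var.
  rewrite (@eq_mean _ _ _ mu _ (fun x => (rn / n%:R) ^+ 2 * (proj1 x - theta) ^+ 2));
    last by move=> x; rewrite exprMn.
  rewrite (@eq_mean _ _ _ rho _ (fun x => (rn / m%:R) ^+ 2 * (proj2 x - theta) ^+ 2));
    last by move=> x; rewrite exprMn.
  rewrite !meanZ; [|exact: bmfunX..].
  rewrite !expr_div_n -nE -[X in X + _]mulr_natl -[X in _ + X]mulr_natl; field.
  by rewrite nn mm.
rewrite E2 => H.
pose lin w := \sum_i phi i (Z i w).
have linE w : lin w = rn * (n%:R^-1 * \sum_i (proj1 (Z (inl i) w) - theta) +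
    m%:R^-1 * \sum_j (proj2 (Z (inr j) w) - theta)).
  by rewrite /lin big_sumType/= -!mulr_sumr; ring.
have blin : bmfun lin.
  apply: bmfun_sum => -[i|j] _; rewrite /phi; apply: bmfunZ.
    exact: (bmfun_compr (f := fun x => proj1 x - theta)).
  exact: (bmfun_compr (f := fun x => proj2 x - theta)).
have bU : bmfun (fun w => rn * (ustat w - theta)).
  by apply: bmfunZ; apply: bmfunB (bmfun_cst _); exact: (bmfun_ustat indepZ _ _ bk).
have diff : `|mean P (fun w => cos (rn * (ustat w - theta) + c)) -
    mean P (fun w => cos (lin w + c))| <= 4 * B / rm.
  have bc1 : bmfun (fun w => cos (rn * (ustat w - theta) + c)).
    by apply: bmfun_cos; apply: measurable_funD => //; case: bU.
  have bc2 : bmfun (fun w => cos (lin w + c)).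
    by apply: bmfun_cos; apply: measurable_funD => //; case: blin.
  rewrite -meanB// (le_trans (norm_mean _ (bmfunB bc1 bc2)))//.
  apply: (@le_trans _ _ (mean P (fun w => `|rn * (ustat w - theta) - lin w|))).
    apply: le_mean; [exact: bmfun_norm (bmfunB bc1 bc2)|exact: bmfun_norm (bmfunB bU blin)|].
    move=> w; rewrite (le_trans (cos_lipschitz _ _))//.
    by rewrite (_ : _ + c - _ = rn * (ustat w - theta) - lin w)//; ring.
  apply: mean_norm_sqrt; first exact: bmfunB.
    by rewrite divr_ge0 ?mulr_ge0// ltW.
  rewrite (@eq_mean _ _ _ _ _ (fun w => n%:R * (ustat w - theta -
    (n%:R^-1 * \sum_i (proj1 (Z (inl i) w) - theta) +
    m%:R^-1 * \sum_j (proj2 (Z (inr j) w) - theta))) ^+ 2)); last first.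
    by move=> w; rewrite linE -mulrBr exprMn -nE.
  rewrite meanZ; last first.
    apply: bmfunX; apply: bmfunB.
      by apply: bmfunB (bmfun_cst _); exact: (bmfun_ustat indepZ _ _ bk).
    apply: (@eq_bmfun _ _ _ _ (fun w => rn^-1 * lin w)); last exact: bmfunZ.
    by move=> w; rewrite linE mulKf// gt_eqF.
  have inl_inj : injective (@inl 'I_n 'I_m) by move=> ? ? [].
  have inr_inj : injective (@inr 'I_n 'I_m) by move=> ? ? [].
  have deg := mean_sqr_degenerate indepZ n0 m0 inl_inj inr_inj
    (fun _ _ => isT) (fun=> erefl) (fun=> erefl) bk kB.
  rewrite (le_trans (ler_wpM2l (ler0n _ _) deg))// [X in _ <= X]expr_div_n -mE.
  by rewrite le_eqVlt; apply/orP; left; apply/eqP; field; rewrite nn mm.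
rewrite (_ : _ - _ = (mean P (fun w => cos (rn * (ustat w - theta) + c)) -
  mean P (fun w => cos (lin w + c))) + (mean P (fun w => cos (lin w + c)) -
  expR (- (asym_var / 2)) * cos c)); last by ring.
by rewrite /clt_error (le_trans (ler_normD _ _))// addrC lerD.
Qed.

End two_sample_clt.

(** * Empirical laws *)

Section average_of_probabilities.
Context {d : measure_display} {T : measurableType d} {R : realType}.
Variables (n : nat) (Q : nat -> probability T R).

Let weight : {nonneg R} := NngNum (ltac:(by rewrite invr_ge0) : 0 <= n.+1%:R^-1 :> R).

Definition avg_prob : set T -> \bar R := mscale weight (msum Q n.+1).

HB.instance Definition _ := Measure.on avg_prob.

Let avg_prob_setT : avg_prob setT = 1%E.
Proof.
have sumQ : msum Q n.+1 setT = n.+1%:R%:E :> \bar R.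
  rewrite /msum (eq_bigr (fun=> (1 : R)%:E)); last by move=> k _; exact: probability_setT.
  by rewrite sumEFin sumr_const card_ord.
rewrite /avg_prob /mscale; transitivity ((n.+1%:R^-1)%:E * (n.+1%:R : R)%:E)%E.
  by congr (_ * _)%E; exact: sumQ.
by rewrite -EFinM mulVf.
Qed.

HB.instance Definition _ := @Measure_isProbability.Build _ _ R avg_prob avg_prob_setT.

(** Adding the bound [M] reduces to nonnegative functions, whose integral is additive in the
    measure. *)
Lemma mean_avg_prob (f : T -> R) : bmfun f ->
  mean avg_prob f = n.+1%:R^-1 * \sum_(k < n.+1) mean (Q k) f.
Proof.
have pos (g : T -> R) : bmfun g -> (forall x, 0 <= g x) ->
    mean avg_prob g = n.+1%:R^-1 * \sum_(k < n.+1) mean (Q k) g.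
  move=> bg g0; have mg : measurable_fun setT (EFin \o g).
    by apply/measurable_EFinP; case: bg.
  apply: EFin_inj; rewrite EFin_mean// ge0_integral_mscale//; last first.
    by move=> x _; rewrite lee_fin.
  rewrite ge0_integral_measure_sum//; last by move=> x _; rewrite lee_fin.
  rewrite EFinM -sumEFin; congr (_ * _)%E.
  by apply: eq_bigr => k _; rewrite EFin_mean.
move=> bf; have [M M0 fM] := bmfun_bound bf.
have bM : bmfun (fun x => f x + M) by apply: bmfunD (bmfun_cst _).
have shift (P : probability T R) : mean P f = mean P (fun x => f x + M) - M.
  by rewrite meanD ?mean_cst ?addrK//; exact: bmfun_cst.
rewrite shift pos//; last by move=> x; rewrite -lerBlDr sub0r lerNl (le_trans (ler_norm _))// normrN.
under [in RHS]eq_bigr do rewrite shift.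
by rewrite sumrB sumr_const card_ord -[M *+ _]mulr_natl; field.
Qed.

End average_of_probabilities.

Section empirical_law.
Context {R : realType}.

(** [avg_prob] averages one law more than its index, hence [n.-1]. For n = 0 the result is the Dirac
    mass at [x 0], so the identities below assume 0 < n. *)
Definition empirical (n : nat) (x : nat -> R) : probability R R :=
  avg_prob n.-1 (fun k => \d_(x k)).

Lemma mean_dirac {d} {T : measurableType d} (a : T) (f : T -> R) : bmfun f ->
  mean \d_a f = f a.
Proof.
move=> bf; rewrite /mean /Rintegral integral_dirac//=.
  by rewrite indicT mul1r.
by apply/measurable_EFinP; case: bf.
Qed.

Lemma mean_empirical n (x : nat -> R) (f : R -> R) : (0 < n)%N -> bmfun f ->
  mean (empirical n x) f = n%:R^-1 * \sum_(i < n) f (x i).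
Proof.
case: n => // n _ bf; rewrite mean_avg_prob//; congr (_ * _).
by apply: eq_bigr => k _; rewrite mean_dirac.
Qed.

Lemma empirical_ray n (x : nat -> R) y : (0 < n)%N ->
  fine (empirical n x `]-oo, y]%classic) = ecdf n x y.
Proof.
move=> n0; have mr : measurable (`]-oo, y]%classic : set R) by exact: measurable_itv.
rewrite -mean_indic// mean_empirical//; last exact: bmfun_indic.
by congr (_ * _); apply: eq_bigr => i _; rewrite indicE mem_setE in_itv.
Qed.

Lemma empirical_probE n (x : nat -> R) A : (0 < n)%N -> measurable A ->
  fine (empirical n x A) = empirical_prob n x A.
Proof.
move=> n0 mA; rewrite -mean_indic// mean_empirical//; exact: bmfun_indic.
Qed.

End empirical_law.

(** * Quantile transform and overlap index *)

Section uniform_law.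
Context {R : realType}.
Local Notation lambda := (@lebesgue_measure R).

Definition unif : probability R R :=
  distribution (uniform_prob (@ltr01 R)) (mfun_of (@measurable_id_R R)).

Let integrable01 (f : R -> R) : bmfun f ->
  lambda.-integrable [set` `[0, 1]] (EFin \o f).
Proof.
move=> [mf [M fM]]; apply: measurable_bounded_integrable => //.
- by rewrite /= lebesgue_measure_itv/= lte01 sube0 ltry.
- by apply: measurable_funTS.
- by exists M; split=> [|t Mt x _]; [exact: num_real|rewrite /= (le_trans (fM x))// ltW].
Qed.

Lemma mean_unif (f : R -> R) : bmfun f ->
  mean unif f = \int[lambda]_(x in `[0, 1]) f x.
Proof.
have pos (g : R -> R) : bmfun g -> (forall x, 0 <= g x) ->
    mean unif g = \int[lambda]_(x in `[0, 1]) g x.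
  move=> bg g0; rewrite mean_distribution//; congr fine.
  have := @integral_uniform R 0 1 ltr01 (EFin \o g).
  rewrite subr0 invr1 mul1e; apply; last by move=> x; rewrite lee_fin.
  by apply/measurable_EFinP; case: bg.
move=> bf; have [M M0 fM] := bmfun_bound bf.
have bM : bmfun (fun x => f x + M) by apply: bmfunD (bmfun_cst _).
rewrite -[LHS](addrK M) -[X in _ + X - _](mean_cst unif M) -meanD//; last exact: bmfun_cst.
rewrite pos//; last by move=> x; rewrite -lerBlDr sub0r lerNl (le_trans (ler_norm _))// normrN.
rewrite RintegralD//; [|exact: integrable01|exact: integrable01 (bmfun_cst M)].
rewrite Rintegral_cst// [X in fine X](_ : _ = 1%E) ?mulr1 ?addrK//.
by rewrite /= lebesgue_measure_itv/= lte01 sube0.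
Qed.

Local Notation I01 := (`]0, 1[%classic : set R).

(** The endpoints form a null set; this keeps the default values of [quantile] at levels 0 and 1 out
    of the integrals. *)
Lemma mean_unif_oo (f g : R -> R) : bmfun f ->
  (forall x, 0 < x < 1 -> f x = g x) -> mean unif f = \int[lambda]_(x in `[0, 1]) g x.
Proof.
move=> bf fg; rewrite mean_unif//.
have mi : measurable_fun I01 f by apply: measurable_funTS; case: bf.
have mg : measurable_fun I01 g.
  apply: eq_measurable_fun mi => x; rewrite inE/= in_itv/=; exact: fg.
have co h : measurable_fun I01 h ->
    \int[lambda]_(x in `[0, 1]) h x = \int[lambda]_(x in `]0, 1[) h x.
  move=> /measurable_EFinP mh; rewrite /Rintegral -integral_itv_bndo_bndc.
    by rewrite -integral_itv_obnd_cbnd.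
  exact/emeasurable_fun_itv_obnd_cbndP.
rewrite !co//; apply: eq_Rintegral => x; rewrite inE/= in_itv/=; exact: fg.
Qed.

Lemma le_mean_unif (f g : R -> R) : bmfun f -> bmfun g ->
  (forall x, 0 < x < 1 -> f x <= g x) -> mean unif f <= mean unif g.
Proof.
move=> bf bg fg; set D := \1_I01 : R -> R.
have bD : bmfun D by apply: bmfun_indic; exact: measurable_itv.
have E h : bmfun h -> mean unif h = mean unif (fun x => h x * D x).
  move=> bh; rewrite [RHS]mean_unif; last exact: bmfunM.
  apply: mean_unif_oo => // x x01.
  by rewrite /D indicE mem_setE in_itv/= x01 mulr1.
rewrite E// [leRHS]E//; apply: le_mean; [exact: bmfunM..|].
move=> x; rewrite /D indicE mem_setE in_itv/=.
by have [x01|_] := boolP (0 < x < 1); rewrite ?mulr1 ?mulr0// fg.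
Qed.

Definition clamp01 (x : R) : R := Num.max 0 (Num.min x 1).

Lemma unif_ray b (x : R) : fine (unif [set` Interval -oo%O (BSide b x)]) = clamp01 x.
Proof.
set A := [set` _]; have mA : measurable (A : set R) by exact: measurable_itv.
rewrite -mean_indic// mean_unif; last exact: bmfun_indic.
rewrite /Rintegral integral_indic//.
rewrite /clamp01; have [x0|x0] := ltP x 0.
  rewrite (_ : A `&` _ = set0) ?measure0.
    by rewrite min_l ?max_l ?(ltW x0)// (le_trans (ltW x0)).
  apply/seteqP; split => // y [] /=; rewrite /A/= !in_itv/= => yx /andP[y0 _].
  have : y <= x by move: yx; case: (b) => //= /ltW.
  by move=> /(le_trans y0); rewrite leNgt x0.
have [x1|x1] := leP x 1.
  rewrite (_ : A `&` _ = [set` Interval (BLeft 0) (BSide b x)]).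
    rewrite /= lebesgue_measure_itv/= max_r// lte_fin; case: ltP => xx /=.
      by rewrite subr0.
    by apply/eqP; rewrite eq_le x0.
  apply/seteqP; split => y /=; rewrite /A/= !in_itv/=; first by move=> [-> /andP[-> _]].
  move=> /andP[-> yx]; split => //=; have : y <= x by move: yx; case: (b) => //= /ltW.
  by move=> /le_trans; exact.
rewrite (_ : A `&` _ = [set` `[0, 1]]).
  by rewrite /= lebesgue_measure_itv/= lte01 sube0 max_r.
apply/seteqP; split => y /=; first by move=> [].
rewrite /A /= !in_itv/= => /andP[-> y1]; split => //.
by case: (b); rewrite /= ?(ltW (le_lt_trans y1 x1)) ?(le_lt_trans y1 x1).
Qed.


End uniform_law.

Section halves_of_the_uniform_law.
Context {R : realType}.

Lemma mean_ray (P : probability R R) b (x : R) :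
  mean P \1_([set` Interval -oo%O (BSide b x)]) =
  fine (P [set` Interval -oo%O (BSide b x)]).
Proof. by rewrite mean_indic. Qed.

Let m1 : measurable_fun setT (fun a : R => 1 - a / 2).
Proof. by apply: measurable_funB => //; exact: measurable_funM. Qed.

Let m2 : measurable_fun setT (fun a : R => a / 2).
Proof. exact: measurable_funM. Qed.

(** U/2 is uniform on [0, 1/2] and 1 - U/2 on [1/2, 1], and their equal mixture is uniform. The laws
    are compared on rays, which leaves a case analysis on the position of [x] relative to 0, 1/2 and
    1. *)
Lemma mean_unif_halves (f : R -> R) : bmfun f ->
  mean unif (fun a => f (1 - a / 2)) + mean unif (fun a => f (a / 2)) =
  2 * mean unif f.
Proof.
move=> bf.
pose Q k : probability R R := if k is 0%N then distribution unif (mfun_of m1)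
  else distribution unif (mfun_of m2).
suff E : forall A, measurable A -> avg_prob 1 Q A = unif A.
  rewrite -(eq_mean_measure f E) mean_avg_prob//.
  rewrite big_ord_recl big_ord_recl big_ord0/= addr0.
  rewrite (mean_distribution unif (mfun_of m1) bf).
  rewrite (mean_distribution unif (mfun_of m2) bf).
  by rewrite mulrA divff// mul1r.
apply: eq_measure_ray => x.
have mr : measurable (`]-oo, x]%classic : set R) by exact: measurable_itv.
rewrite -[LHS]fineK ?fin_num_measure// -[RHS]fineK ?fin_num_measure//; congr EFin.
rewrite -mean_indic// mean_avg_prob; last exact: bmfun_indic.
rewrite big_ord_recl big_ord_recl big_ord0/= addr0.
rewrite (mean_distribution unif (mfun_of m1) (bmfun_indic mr)).
rewrite (mean_distribution unif (mfun_of m2) (bmfun_indic mr)).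
rewrite (@eq_mean _ _ _ _ _ (fun a => 1 - \1_([set` Interval -oo%O (BLeft (2 - 2 * x))]) a));
  last first.
  move=> a; rewrite /= !indicE !mem_setE !in_itv/=.
  have -> : (1 - a / 2 <= x) = ~~ (a < 2 - 2 * x) by rewrite -leNgt; lra.
  by case: (a < _); rewrite ?subrr ?subr0.
rewrite meanB ?mean_cst; [|exact: bmfun_cst|by apply: bmfun_indic; exact: measurable_itv].
rewrite [X in _ + X](@eq_mean _ _ _ _ _ (\1_([set` Interval -oo%O (BRight (2 * x))])));
  last first.
  move=> a; rewrite /= !indicE !mem_setE !in_itv/=; congr (nat_of_bool _)%:R.
  by rewrite ler_pdivrMr// mulrC.
rewrite !mean_ray !unif_ray /clamp01.
have [x0|] := boolP (x < 0); last rewrite -leNgt => x0.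
  rewrite (min_l (_ : x <= 1)); last lra.
  rewrite (max_l (_ : x <= 0)); last lra.
  rewrite (min_r (_ : 1 <= 2 - 2 * x)); last lra.
  rewrite (min_l (_ : 2 * x <= 1)); last lra.
  rewrite (max_l (_ : 2 * x <= 0)); last lra.
  by rewrite max_r; lra.
have [x1|] := boolP (1 < x); last rewrite -leNgt => x1.
  rewrite (min_r (_ : 1 <= x)); last lra.
  rewrite (min_l (_ : 2 - 2 * x <= 1)); last lra.
  rewrite (max_l (_ : 2 - 2 * x <= 0)); last lra.
  rewrite (min_r (_ : 1 <= 2 * x)); last lra.
  by rewrite max_r; lra.
have {}x0 : 0 <= x by lra.
rewrite (min_l (_ : x <= 1))// (max_r (_ : 0 <= x))//.
have [xh|] := boolP (2 * x <= 1); last rewrite -ltNge => xh.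
  rewrite (min_l (_ : 2 * x <= 1))//.
  rewrite (min_r (_ : 1 <= 2 - 2 * x)); last lra.
  rewrite (max_r (_ : 0 <= 2 * x)); last lra.
  by rewrite max_r; lra.
rewrite (min_r (_ : 1 <= 2 * x)); last lra.
rewrite (min_l (_ : 2 - 2 * x <= 1)); last lra.
rewrite (max_r (_ : 0 <= 2 - 2 * x)); last lra.
by rewrite max_r; lra.
Qed.

End halves_of_the_uniform_law.

Section quantile_transform.
Context {R : realType}.
Variables (mu : probability R R) (F : R -> R).
Hypothesis FE : forall x, fine (mu `]-oo, x]%classic) = F x.

Let mr (x : R) : measurable (`]-oo, x]%classic : set R). Proof. exact: measurable_itv. Qed.

Lemma cdf_mono x y : x <= y -> F x <= F y.
Proof.
move=> xy; rewrite -!FE -!mean_indic//.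
apply: le_mean; [exact: bmfun_indic|exact: bmfun_indic|].
move=> z; rewrite !indicE !mem_setE !in_itv/= ler_nat.
by case: (leP z x) => // /le_trans/(_ xy) ->.
Qed.

Lemma cdf_bounds x : 0 <= F x <= 1.
Proof.
rewrite -FE -mean_indic// mean_ge0/=; last by move=> z; rewrite indicE.
apply: le_mean_cst; first exact: bmfun_indic.
by move=> z; rewrite indicE; case: (_ \in _).
Qed.

Lemma cdf_tails (e : R) : 0 < e -> exists2 t, 1 - e <= F t & F (- t) <= e.
Proof.
move=> e0.
have mZ : measurable_fun setT (fun x : R => (x, 0 : R)).
  by apply: measurable_fun_pair => //; exact: measurable_cst.
have [t t0] := tight (distribution mu (mfun_of mZ)) e0.
rewrite mean_distribution/=; last exact: bmfun_outside.
have bo := bmfun_outside t mZ => le.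
(* One more than [t], because an atom at distance exactly [t] from 0 lies inside the box. *)
exists (t + 1).
  rewrite lerBlDr -lerBlDl (le_trans _ le)// -FE -mean_indic// -[X in X - _](mean_cst mu 1).
  rewrite -meanB; [|exact: bmfun_cst|exact: bmfun_indic].
  apply: le_mean => //; first by apply: bmfunB; [exact: bmfun_cst|exact: bmfun_indic].
  move=> z; rewrite indicE mem_setE in_itv/= /outside/= normr0 (ltW t0) andbT.
  have [zt|zt] := leP z (t + 1); first by rewrite subrr.
  have -> : (`|z| <= t) = false by have := ler_norm z; lra.
  by rewrite subr0.
apply: le_trans le; rewrite -FE -mean_indic//.
apply: le_mean => //; first exact: bmfun_indic.
move=> z; rewrite indicE mem_setE in_itv/= /outside/= normr0 (ltW t0) andbT.
have [zt|//] := leP z (- (t + 1)).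
have -> // : (`|z| <= t) = false.
by have := ler_norm (- z); rewrite normrN; lra.
Qed.

(** The Galois connection between a distribution function and its generalised inverse. Its content
    is that the infimum is attained, which follows from right-continuity. *)
Lemma quantile_le (u x : R) : 0 < u < 1 -> (quantile F u <= x) = (u <= F x).
Proof.
move=> /andP[u0 u1]; rewrite /quantile; set S := [set y | u <= F y].
have S0 : S !=set0.
  have [|t Ft _] := @cdf_tails (1 - u); first by rewrite subr_gt0.
  by exists t; rewrite /S/=; lra.
have lbS : has_lbound S.
  have [|t _ Ft] := @cdf_tails (u / 2); first by rewrite divr_gt0.
  exists (- t) => y; rewrite /S/= => uy; rewrite leNgt; apply/negP => /ltW /cdf_mono.
  by lra.
have Sinf : u <= F (inf S).
  rewrite leNgt; apply/negP => lt.
  have [|b ab Fb] := @fine_ray_lim R mu (inf S) ((u - F (inf S)) / 2).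
    by rewrite divr_gt0// subr_gt0.
  have [y Sy yb] : exists2 y, S y & y < b.
    have [y Sy] := inf_adherent (ltac:(by rewrite subr_gt0) : 0 < b - inf S) (conj S0 lbS).
    by rewrite addrC subrK; exists y.
  move: Fb; rewrite !FE; have := cdf_mono (ltW yb); move: Sy; rewrite /S/=; lra.
apply/idP/idP => [|ux]; first by move/cdf_mono; exact: le_trans.
exact: ge_inf.
Qed.

(** The value 0 outside ]0, 1[ makes measurability independent of what [inf] returns there. *)
Definition qt (u : R) : R := if 0 < u < 1 then quantile F u else 0.

Lemma qt_le (u x : R) : 0 < u < 1 -> (qt u <= x) = (u <= F x).
Proof. by move=> u01; rewrite /qt u01 quantile_le. Qed.

Lemma qt_mono (u v : R) : 0 < u -> u <= v -> v < 1 -> qt u <= qt v.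
Proof.
move=> u0 uv v1; have v01 : 0 < v < 1 by rewrite v1 (lt_le_trans u0).
rewrite qt_le; last by rewrite u0 (le_lt_trans uv).
by rewrite (le_trans uv)// -qt_le.
Qed.

Lemma measurable_qt : measurable_fun setT qt.
Proof.
apply: (measurability _ (RGenOInfty.measurableE R)) => //.
move=> /= _ [_ [x ->] <-]; rewrite setTI.
have -> : qt @^-1` `]x, +oo[%classic =
    ((`]0, 1[%classic : set R) `&` `]F x, +oo[%classic) `|`
    (~` (`]0, 1[%classic : set R) `&` (if x < 0 then setT else set0)).
  apply/seteqP; split => u /=; rewrite !in_itv/= !andbT.
    rewrite ltNge; have [u01|u01] := boolP (0 < u < 1).
      by rewrite qt_le// -ltNge => ?; left.
    rewrite /qt (negbTE u01) -ltNge => ->; right.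
    by split=> //; exact/negP.
  move=> [[u01 Fx]|[/negP]]; first by rewrite ltNge qt_le// -ltNge.
  move=> u01; rewrite /qt (negbTE u01).
  by case: ifP.
apply: measurableU; apply: measurableI; [exact: measurable_itv|exact: measurable_itv|
  by apply: measurableC; exact: measurable_itv|].
by case: ifP.
Qed.

Lemma bmfun_qt (f s : R -> R) : measurable_fun setT s -> bmfun f ->
  bmfun (fun a => f (qt (s a))).
Proof.
move=> ms; apply: (bmfun_compr (u := qt \o s)).
exact: measurableT_comp measurable_qt ms.
Qed.

(** Inverse transform sampling: by [qt_le] the event qt U <= x is U <= F x, which has probability F
    x. *)
Lemma mean_qt (f : R -> R) : bmfun f -> mean unif (fun u => f (qt u)) = mean mu f.
Proof.
move=> bf; rewrite -(@mean_distribution _ _ _ _ _ unif (mfun_of measurable_qt))//.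
apply: eq_mean_measure; apply: eq_measure_ray => x.
rewrite -[LHS]fineK ?fin_num_measure// -[RHS]fineK ?fin_num_measure//; congr EFin.
have bx := bmfun_indic (R := R) (mr x); have bFx := bmfun_indic (R := R) (mr (F x)).
rewrite -mean_indic// (mean_distribution unif (mfun_of measurable_qt) bx) FE.
have := unif_ray false (F x); rewrite /clamp01.
have /andP[F0 F1] := cdf_bounds x; rewrite min_l// max_r// => <-.
rewrite -mean_ray; apply/eqP; rewrite eq_le; apply/andP; split.
  apply: le_mean_unif => //; first exact: bmfun_compr measurable_qt bx.
  by move=> u u01; rewrite /= !indicE !mem_setE !in_itv/= qt_le.
apply: le_mean_unif => //; first exact: bmfun_compr measurable_qt bx.
by move=> u u01; rewrite /= !indicE !mem_setE !in_itv/= qt_le.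
Qed.

Lemma rel_effectE (G : R -> R) : bmfun G -> rel_effect F G = mean mu G.
Proof.
move=> bG; rewrite -mean_qt// (mean_unif_oo (g := fun a => G (quantile F a))) //.
  exact: bmfun_qt.
by move=> u u01; rewrite /qt u01.
Qed.

End quantile_transform.

Section overlap.
Context {R : realType}.
Variables (mu : probability R R) (F G : R -> R).
Hypothesis FE : forall x, fine (mu `]-oo, x]%classic) = F x.
Hypotheses (G_mono : {homo G : x y / x <= y}) (G01 : forall x, 0 <= G x <= 1).

Lemma bmfun_nondecreasing : bmfun G.
Proof.
split; first exact: nondecreasing_measurable.
by exists 1 => x; have /andP[G0 G1] := G01 x; rewrite ger0_norm.
Qed.

Let bG := bmfun_nondecreasing.
Local Notation q := (qt F).
Let mhi : measurable_fun setT (fun a : R => 1 - a / 2).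
Proof. by apply: measurable_funB => //; exact: measurable_funM. Qed.
Let mlo : measurable_fun setT (fun a : R => a / 2).
Proof. exact: measurable_funM. Qed.

Definition upper_dev c a := G (q (1 - a / 2)) - c.
Definition lower_dev c a := G (q (a / 2)) - c.

Let bhi c : bmfun (upper_dev c).
Proof. by apply: bmfunB (bmfun_cst _); exact: (bmfun_qt FE mhi bG). Qed.
Let blo c : bmfun (lower_dev c).
Proof. by apply: bmfunB (bmfun_cst _); exact: (bmfun_qt FE mlo bG). Qed.

(** Excess of the absolute over the signed deviations from [c] in the upper and lower halves of the
    levels. Both parts are nonnegative, and both vanish when [c] separates the two halves. *)
Definition overlap_gap c a :=
  (`|upper_dev c a| - upper_dev c a) + (`|lower_dev c a| + lower_dev c a).

Let bgap c : bmfun (overlap_gap c).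
Proof.
by apply: bmfunD; [apply: bmfunB|apply: bmfunD] => //; exact: bmfun_norm.
Qed.

(** By [mean_unif_halves], 2 E|G(X) - c| is the sum of the mean absolute deviations in the two
    halves, while [c] cancels in the difference that defines I_2. *)
Lemma overlap_gapE c :
  2 * mean mu (fun x => `|G x - c|) - overlap_index F G = mean unif (overlap_gap c).
Proof.
have bGc : bmfun (fun x => `|G x - c|).
  by apply: bmfun_norm; apply: bmfunB (bmfun_cst _).
have bq : bmfun (fun u => `|G (q u) - c|) by exact: (bmfun_qt FE (s := id) _ bGc).
have bn1 := bmfun_norm (bhi c); have bn2 := bmfun_norm (blo c).
rewrite -(mean_qt FE bGc) -(mean_unif_halves bq).
have -> : overlap_index F G = mean unif (upper_dev c) - mean unif (lower_dev c).
  rewrite /overlap_index.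
  rewrite -(mean_unif_oo (f := fun a => G (q (1 - a / 2)))); last 2 first.
  - exact: (bmfun_qt FE mhi bG).
  - move=> a /andP[a0 a1]; rewrite /qt ifT//; lra.
  rewrite -(mean_unif_oo (f := fun a => G (q (a / 2)))); last 2 first.
  - exact: (bmfun_qt FE mlo bG).
  - move=> a /andP[a0 a1]; rewrite /qt ifT//; lra.
  rewrite !meanB ?mean_cst; first by ring.
  - exact: (bmfun_qt FE mlo bG).
  - exact: bmfun_cst.
  - exact: (bmfun_qt FE mhi bG).
  - exact: bmfun_cst.
rewrite [RHS](@meanD _ _ _ unif (fun a => `|upper_dev c a| - upper_dev c a)
  (fun a => `|lower_dev c a| + lower_dev c a)); [|exact: bmfunB|exact: bmfunD].
by rewrite (meanB unif bn1 (bhi c)) (meanD unif bn2 (blo c)); ring.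
Qed.

Lemma overlap_gap_ge0 c a : 0 <= overlap_gap c a.
Proof.
apply: addr_ge0; first by rewrite subr_ge0 ler_norm.
by rewrite -lerBlDr sub0r -[`|_|]normrN ler_norm.
Qed.

(** Together with [overlap_median] this makes I_2 the minimum over c of 2 E|G(X) - c|. *)
Lemma overlap_le c : overlap_index F G <= 2 * mean mu (fun x => `|G x - c|).
Proof.
rewrite -subr_ge0 overlap_gapE; apply: mean_ge0 => a.
exact: overlap_gap_ge0.
Qed.

(** By monotonicity, the values of [G] at upper levels lie above its value at the median and those
    at lower levels below, so the gap is 0. *)
Lemma overlap_median :
  overlap_index F G = 2 * mean mu (fun x => `|G x - G (q (1 / 2))|).
Proof.
apply/eqP; rewrite eq_sym -subr_eq0 overlap_gapE; apply/eqP.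
rewrite -[RHS](mean_cst unif 0).
suff E : mean unif (overlap_gap (G (q (1 / 2)))) <= mean unif (fun=> 0).
  apply/eqP; rewrite eq_le E mean_cst mean_ge0// => a.
  exact: overlap_gap_ge0.
apply: le_mean_unif => //; first exact: bmfun_cst.
move=> a /andP[a0 a1]; rewrite /overlap_gap.
rewrite ger0_norm; last by rewrite subr_ge0; apply: G_mono; apply: (qt_mono FE); lra.
rewrite ler0_norm; first by rewrite subrr addNr addr0.
by rewrite subr_le0; apply: G_mono; apply: (qt_mono FE); lra.
Qed.

(* Only levels between 1/2 and [F x0] contribute to the gap, and there the
   quantiles stay within [eta] of [x0]. *)
Lemma overlap_gap_le (x0 eta kappa : R) : 0 <= eta ->
  (F (x0 - eta) < 1 / 2 <= F (x0 + eta) -> G (x0 + eta) - G (x0 - eta) <= kappa) ->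
  (~~ (F (x0 - eta) < 1 / 2 <= F (x0 + eta)) -> 1 <= kappa) ->
  2 * mean mu (fun x => `|G x - G x0|) - overlap_index F G <=
  2 * kappa * `|2 * F x0 - 1|.
Proof.
move=> eta0 good bad; rewrite overlap_gapE.
set t := F x0.
have kappa0 : 0 <= kappa.
  have [/good|/bad] := boolP (F (x0 - eta) < 1 / 2 <= F (x0 + eta)).
    by apply: le_trans; rewrite subr_ge0 G_mono//; lra.
  exact: le_trans.
(* The upper part of the gap is 0 for a < 2 - 2t and the lower part for a <= 2t. At most one of the
   two complements has positive mass in ]0, 1[, and this mass is |2t - 1|. *)
pose A1 : set R := [set` Interval -oo%O (BLeft (2 - 2 * t))].
pose A2 : set R := [set` Interval -oo%O (BRight (2 * t))].
have mA1 : measurable A1 by exact: measurable_itv.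
have mA2 : measurable A2 by exact: measurable_itv.
have b1 : bmfun (\1_A1 : R -> R) := bmfun_indic mA1.
have b2 : bmfun (\1_A2 : R -> R) := bmfun_indic mA2.
have bb : bmfun (fun a => 2 * kappa * ((1 - \1_A1 a) + (1 - \1_A2 a))).
  by apply: bmfunZ; apply: bmfunD; apply: bmfunB => //; exact: bmfun_cst.
apply: (@le_trans _ _ (mean unif (fun a => 2 * kappa * ((1 - \1_A1 a) + (1 - \1_A2 a))))).
  apply: le_mean_unif => // a /andP[a0 a1]; rewrite /overlap_gap mulrDr lerD//.
    rewrite indicE mem_setE in_itv/=.
    have [aA|aA] := ltP a (2 - 2 * t).
      rewrite subrr mulr0 subr_le0 ger0_norm// subr_ge0 G_mono// ltW// ltNge.
      by rewrite (qt_le FE) -/t; lra.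
    rewrite subr0 mulr1.
    have U : `|upper_dev (G x0) a| <= kappa.
      have qx : q (1 - a / 2) <= x0 by rewrite (qt_le FE) -/t; lra.
      rewrite ler0_norm ?subr_le0 ?G_mono// opprB.
      have [/[dup] /good H /andP[lo _]|/bad] := boolP (F (x0 - eta) < 1 / 2 <= F (x0 + eta)).
        apply: le_trans H; apply: lerB; first by apply: G_mono; lra.
        by apply: G_mono; apply: ltW; rewrite ltNge (qt_le FE); lra.
      by have := G01 x0; have := G01 (q (1 - a / 2)); lra.
    by have := ler_norm (- upper_dev (G x0) a); rewrite normrN; lra.
  rewrite indicE mem_setE in_itv/=.
  have [aA|aA] := leP a (2 * t).
    rewrite subrr mulr0 ler0_norm ?addNr// subr_le0 G_mono// (qt_le FE) -/t; lra.
  rewrite subr0 mulr1.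
  have U : `|lower_dev (G x0) a| <= kappa.
    have qx : x0 < q (a / 2) by rewrite ltNge (qt_le FE) -/t; lra.
    rewrite ger0_norm ?subr_ge0 ?G_mono ?(ltW qx)// /lower_dev.
    have [/[dup] /good H /andP[_ hi]|/bad] := boolP (F (x0 - eta) < 1 / 2 <= F (x0 + eta)).
      apply: le_trans H; apply: lerB; last by apply: G_mono; lra.
      by apply: G_mono; rewrite (qt_le FE); lra.
    by have := G01 x0; have := G01 (q (a / 2)); lra.
  by have := ler_norm (lower_dev (G x0) a); lra.
rewrite meanZ; last by apply: bmfunD; apply: bmfunB => //; exact: bmfun_cst.
rewrite ler_wpM2l ?mulr_ge0//.
rewrite meanD; [|apply: bmfunB => //; exact: bmfun_cst..].
rewrite meanB//; last exact: bmfun_cst.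
rewrite meanB//; last exact: bmfun_cst.
rewrite mean_cst !mean_ray !unif_ray /clamp01.
have /andP[t0 t1] := cdf_bounds FE x0; rewrite -/t in t0 t1.
rewrite (max_r (_ : 0 <= Num.min (2 - 2 * t) 1)); last by rewrite le_min ler01 andbT; lra.
rewrite (max_r (_ : 0 <= Num.min (2 * t) 1)); last by rewrite le_min ler01 andbT; lra.
have [th|] := boolP (2 * t <= 1); last rewrite -ltNge => th.
  rewrite (min_r (_ : 1 <= 2 - 2 * t)); last lra.
  rewrite (min_l (_ : 2 * t <= 1))// ler0_norm; lra.
rewrite (min_l (_ : 2 - 2 * t <= 1)); last lra.
rewrite (min_r (_ : 1 <= 2 * t)); last lra.
by rewrite ger0_norm; lra.
Qed.

End overlap.

Section kernels.
Context {R : realType}.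

Definition rel_kernel (z : R * R) : R := (z.2 <= z.1)%R%:R.

Definition overlap_kernel (x0 : R) (z : R * R) : R :=
  2 * `|rel_kernel z - rel_kernel (x0, z.2)|.

Lemma rel_kernel_le z : `|rel_kernel z| <= 1.
Proof. by rewrite /rel_kernel; case: (z.2 <= z.1); rewrite ?normr0 ?normr1. Qed.

Lemma bmfun_rel_kernel d (T : measurableType d) (f g : T -> R) :
  measurable_fun setT f -> measurable_fun setT g ->
  bmfun (fun w => rel_kernel (f w, g w)).
Proof.
move=> mf mg; split; last first.
  by exists 1 => w; exact: rel_kernel_le.
rewrite (_ : (fun w => _) = \1_([set w | g w <= f w])).
  apply: measurable_indic; rewrite -[X in measurable X]setTI.
  exact: (measurable_fun_le measurableT mg mf).
by apply/funext => w; rewrite indicE /rel_kernel/= mem_setE.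
Qed.

Lemma bmfun_overlap_kernel d (T : measurableType d) (x0 : R) (f g : T -> R) :
  measurable_fun setT f -> measurable_fun setT g ->
  bmfun (fun w => overlap_kernel x0 (f w, g w)).
Proof.
move=> mf mg; apply: bmfunZ; apply: bmfun_norm.
by apply: bmfunB; apply: bmfun_rel_kernel => //; exact: measurable_cst.
Qed.

Lemma overlap_kernel_le x0 z : `|overlap_kernel x0 z| <= 2.
Proof.
rewrite /overlap_kernel /rel_kernel/=; case: (z.2 <= z.1); case: (z.2 <= x0);
by rewrite ?subrr ?subr0 ?sub0r ?normrN ?normr1 ?normr0 ?mulr0 ?mulr1 ?normr0 ?ger0_norm.
Qed.

Section population.
Variables (mu rho : probability R R) (G : R -> R).
Hypothesis GE : forall x, fine (rho `]-oo, x]%classic) = G x.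

Lemma mean_rel_kernel x : mean rho (fun y => rel_kernel (x, y)) = G x.
Proof.
rewrite -GE -mean_indic; last exact: measurable_itv.
by apply: eq_mean => y; rewrite /rel_kernel indicE mem_setE in_itv.
Qed.

(** The two indicators are ordered in the same way for all y, according to the order of [x] and
    [x0], so the absolute value may be taken after averaging. *)
Lemma mean_overlap_kernel x0 x :
  mean rho (fun y => overlap_kernel x0 (x, y)) = 2 * `|G x - G x0|.
Proof.
have bk (a : R) : bmfun (fun y : R => rel_kernel (a, y)).
  by apply: bmfun_rel_kernel => //; exact: measurable_cst.
rewrite meanZ; last by apply: bmfun_norm; exact: bmfunB.
congr (_ * _).
have [xx|/ltW xx] := leP x x0.
  rewrite ler0_norm ?subr_le0 ?(cdf_mono GE)// opprB -!mean_rel_kernel -meanB//.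
  apply: eq_mean => y; rewrite ler0_norm ?opprB// subr_le0 /rel_kernel/= ler_nat.
  by case: (leP y x) => // /le_trans/(_ xx) ->.
rewrite ger0_norm ?subr_ge0 ?(cdf_mono GE)// -!mean_rel_kernel -meanB//.
apply: eq_mean => y; rewrite ger0_norm// subr_ge0 /rel_kernel/= ler_nat.
by case: (leP y x0) => // /le_trans/(_ xx) ->.
Qed.

Lemma theta_rel_kernel (F : R -> R) : (forall x, fine (mu `]-oo, x]%classic) = F x) ->
  theta mu rho rel_kernel = rel_effect F G.
Proof.
move=> FE; rewrite (rel_effectE FE).
  by apply: eq_mean => x; rewrite /proj1 mean_rel_kernel.
by apply: bmfun_nondecreasing => [x y|x]; [exact: (cdf_mono GE)|exact: (cdf_bounds GE)].
Qed.

Lemma theta_overlap_kernel x0 :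
  theta mu rho (overlap_kernel x0) = 2 * mean mu (fun x => `|G x - G x0|).
Proof.
rewrite /theta /proj1; under eq_mean do rewrite mean_overlap_kernel.
rewrite meanZ//; apply: bmfun_norm; apply: bmfunB (bmfun_cst _).
by apply: bmfun_nondecreasing => [x y|x]; [exact: (cdf_mono GE)|exact: (cdf_bounds GE)].
Qed.

End population.
End kernels.

Section empirical.
Context {R : realType}.
Variables (n m : nat) (x y : nat -> R).
Hypotheses (n0 : (0 < n)%N) (m0 : (0 < m)%N).

Let FE z : fine (empirical n x `]-oo, z]%classic) = ecdf n x z := empirical_ray x z n0.
Let GE z : fine (empirical m y `]-oo, z]%classic) = ecdf m y z := empirical_ray y z m0.

(** The empirical distribution function is constant between consecutive sample points: if the median
    [q] were none of them, the largest sample point below [q] would already reach its level. *)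
Lemma quantile_ecdf_half : exists l : 'I_n, qt (ecdf n x) (1 / 2) = x l.
Proof.
set q := qt _ _.
have h01 : 0 < (1 / 2 : R) < 1 by lra.
have qle z : (q <= z) = (1 / 2 <= ecdf n x z) := qt_le FE z h01.
have [//|no] := pselect (exists l : 'I_n, q = x l).
(* The default [q - 1] covers the case of no sample point below [q]. *)
pose z := \big[Num.max/(q - 1)]_(i < n | x i < q) x i.
have zq : z < q by apply/bigmax_ltP; split => //; rewrite ltrBlDr ltrDl.
have : ~~ (q <= z) by rewrite -ltNge.
rewrite qle (_ : ecdf n x z = ecdf n x q) -?qle ?lexx//.
congr (_ * _); apply: eq_bigr => i _; congr (nat_of_bool _)%:R.
apply/idP/idP => [/le_trans|]; first by apply; exact: ltW.
rewrite le_eqVlt => /orP[/eqP xq|xq]; last by rewrite /z le_bigmax_cond.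
by case: no; exists i.
Qed.

(** The least absolute deviation is attained at a sample point, hence a minimum over the sample.
    This finite formula makes the measurability of I_2 in the data visible. The default 2 is
    harmless, since the deviation from c = 0 is already at most 2. *)
Lemma overlap_ecdf : overlap_index (ecdf n x) (ecdf m y) =
  \big[Num.min/2]_(l < n)
    (2 * (n%:R^-1 * \sum_(i < n) `|ecdf m y (x i) - ecdf m y (x l)|)).
Proof.
have Gm : {homo ecdf m y : a b / a <= b} by exact: (cdf_mono GE).
have G01 := cdf_bounds GE.
have bG : bmfun (ecdf m y) by exact: bmfun_nondecreasing.
have bGc c : bmfun (fun a => `|ecdf m y a - c|).
  by apply: bmfun_norm; apply: bmfunB (bmfun_cst _).
have E c : mean (empirical n x) (fun a => `|ecdf m y a - c|) =
    n%:R^-1 * \sum_(i < n) `|ecdf m y (x i) - c| by rewrite mean_empirical.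
apply/eqP; rewrite eq_le; apply/andP; split.
  apply/bigmin_geP; split.
    rewrite (le_trans (overlap_le FE Gm G01 0))// -[leRHS]mulr1 ler_wpM2l//.
    apply: le_mean_cst => // a; rewrite subr0.
    by have /andP[? ?] := G01 a; rewrite ger0_norm.
  by move=> l _; rewrite -E; exact: (overlap_le FE Gm G01).
have [l ql] := quantile_ecdf_half.
rewrite (overlap_median FE Gm G01) ql E.
exact: bigmin_le.
Qed.

Lemma theta_empirical (k : R * R -> R) : bmfun k ->
  theta (empirical n x) (empirical m y) k =
  (n%:R * m%:R)^-1 * \sum_(i < n) \sum_(j < m) k (x i, y j).
Proof.
move=> bk; rewrite /theta mean_empirical//; last exact: (bmfun_proj1 (empirical n x)).
rewrite invfM -mulrA; congr (_ * _); rewrite mulr_sumr; apply: eq_bigr => i _.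
by rewrite /proj1 mean_empirical//; exact: bmfun_kx.
Qed.

End empirical.

Section measurability.
Context {R : realType} {d : measure_display} {T : measurableType d}.

Lemma bmfun_min (f g : T -> R) : bmfun f -> bmfun g ->
  bmfun (fun w => Num.min (f w) (g w)).
Proof.
move=> bf bg.
apply: (@eq_bmfun _ _ _ _ (fun w => 2^-1 * (f w + g w - `|f w - g w|))).
  move=> w; rewrite minEle; case: leP => fg.
    by rewrite ler0_norm ?subr_le0//; field.
  by rewrite gtr0_norm ?subr_gt0//; field.
apply: bmfunZ; apply: bmfunB; first exact: bmfunD.
by apply: bmfun_norm; exact: bmfunB.
Qed.

Lemma bmfun_bigmin n (c : R) (F : 'I_n -> T -> R) : (forall i, bmfun (F i)) ->
  bmfun (fun w => \big[Num.min/c]_(i < n) F i w).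
Proof.
move=> bF; elim: (index_enum _) => [|i s IH].
  by apply: (eq_bmfun _ (bmfun_cst c)) => w; rewrite big_nil.
by apply: (eq_bmfun _ (bmfun_min (bF i) IH)) => w; rewrite big_cons.
Qed.

Variables (n m : nat) (x y : nat -> T -> R).
Hypotheses (mx : forall i, (i < n)%N -> measurable_fun setT (x i)).
Hypotheses (my : forall j, (j < m)%N -> measurable_fun setT (y j)).
Hypotheses (n0 : (0 < n)%N) (m0 : (0 < m)%N).

Lemma bmfun_ecdf (z : T -> R) : measurable_fun setT z ->
  bmfun (fun w => ecdf m (y^~ w) (z w)).
Proof.
move=> mz; apply: bmfunZ; apply: bmfun_sum => j _.
exact: (bmfun_rel_kernel mz (my (ltn_ord j))).
Qed.

Lemma bmfun_overlap_ecdf :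
  bmfun (fun w => overlap_index (ecdf n (x^~ w)) (ecdf m (y^~ w))).
Proof.
apply: eq_bmfun => [w|]; first exact: overlap_ecdf.
apply: bmfun_bigmin => l; apply: bmfunZ; apply: bmfunZ; apply: bmfun_sum => i _.
by apply: bmfun_norm; apply: bmfunB; apply: bmfun_ecdf; apply: mx.
Qed.

Lemma rel_effect_ecdf (x' y' : nat -> R) : rel_effect (ecdf n x') (ecdf m y') =
  (n%:R * m%:R)^-1 * \sum_(i < n) \sum_(j < m) rel_kernel (x' i, y' j).
Proof.
rewrite -(theta_rel_kernel (mu := empirical n x') (rho := empirical m y'))//.
- by rewrite theta_empirical//; apply: bmfun_rel_kernel.
- by move=> z; exact: empirical_ray.
- by move=> z; exact: empirical_ray.
Qed.

Lemma bmfun_rel_effect_ecdf :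
  bmfun (fun w => rel_effect (ecdf n (x^~ w)) (ecdf m (y^~ w))).
Proof.
apply: eq_bmfun => [w|]; first exact: rel_effect_ecdf.
apply: bmfunZ; apply: bmfun_sum => i _; apply: bmfun_sum => j _.
by apply: bmfun_rel_kernel; [exact: mx|exact: my].
Qed.

End measurability.

(** * Resampling *)

Section finite_average.
Context {d : measure_display} {T : measurableType d} {R : realType} {J : finType}.
Variables (j0 : J) (Q : J -> probability T R).

Definition fin_avg : probability T R :=
  avg_prob #|J|.-1 (fun k => Q (nth j0 (enum J) k)).

Lemma mean_fin_avg (f : T -> R) : bmfun f ->
  mean fin_avg f = #|J|%:R^-1 * \sum_j mean (Q j) f.
Proof.
have J0 : (0 < #|J|)%N by apply/card_gt0P; exists j0.
move=> bf; rewrite mean_avg_prob// prednK//; congr (_ * _).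
rewrite (reindex (@enum_val J predT))/=; last first.
  exists enum_rank => i _; [exact: enum_valK|exact: enum_rankK].
apply: eq_bigr => k _; congr (mean (Q _) f).
by rewrite /enum_val; apply: set_nth_default; rewrite -cardE.
Qed.

End finite_average.

Section resampling.
Context {R : realType} {n m : nat}.
Hypotheses (n0 : (0 < n)%N) (m0 : (0 < m)%N).
Local Notation I := ('I_n + 'I_m)%type.
Local Notation J := ({ffun 'I_n -> 'I_n} * {ffun 'I_m -> 'I_m})%type.
Local Notation V := (#|{: I}|.-tuple R).

Definition sample (x y : nat -> R) (i : I) : R :=
  match i with inl a => x a | inr b => y b end.

Definition resample (z : I -> R) (j : J) (i : I) : R :=
  match i with inl a => z (inl (j.1 a)) | inr b => z (inr (j.2 b)) end.

Definition idJ : J := ([ffun a => a], [ffun b => b]).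

Definition boot_mean (H : (I -> R) -> R) (z : I -> R) : R :=
  #|{: J}|%:R^-1 * \sum_(j : J) H (resample z j).

(** Distributivity: a product of averages over the samples is the average of the products over all
    resampling maps. This is where the independence of the draws comes from. *)
Lemma boot_mean_box (A : I -> set R) (x y : nat -> R) :
  boot_mean (fun z => \prod_i \1_(A i) (z i)) (sample x y) =
  \prod_(a < n) empirical_prob n x (A (inl a)) *
  \prod_(b < m) empirical_prob m y (A (inr b)).
Proof.
have nn : n%:R != 0 :> R by rewrite pnatr_eq0 -lt0n.
have mm : m%:R != 0 :> R by rewrite pnatr_eq0 -lt0n.
rewrite /empirical_prob !big_split/= !prodr_const !card_ord !bigA_distr_bigA/=.
rewrite mulrACA /boot_mean card_prod !card_ffun !card_ord natrM !natrX; congr (_ * _).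
  by rewrite invfM !exprVn.
rewrite big_distrlr/= pair_big/=; apply: eq_bigr => -[j1 j2] _.
by rewrite big_sumType.
Qed.

Definition boot_law (z : I -> R) : probability V R :=
  fin_avg idJ (fun j => \d_(joint_tuple (fun i (_ : unit) => resample z j i) tt)).

Lemma mean_boot_law H z : bmjoint H ->
  mean (boot_law z) (fun t => H (coords t)) = boot_mean H z.
Proof.
move=> bH; rewrite mean_fin_avg//; congr (_ * _); apply: eq_bigr => j _.
by rewrite mean_dirac// coords_joint.
Qed.

(** With the data frozen, the resampled family satisfies [indep_law] with empirical marginals, so
    every bound proved for independent samples applies to it as it stands. *)
Lemma indep_boot_law (x y : nat -> R) :
  indep_law (boot_law (sample x y)) (fun i t => coords t i)
    (fun i => if i is inl _ then empirical n x else empirical m y).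
Proof.
split=> [|A mA]; first exact: measurable_coords.
rewrite -[LHS]fineK; last first.
  by apply: fin_num_measure; exact: (measurable_box mA).
congr EFin; rewrite -mean_indic; last exact: (measurable_box mA).
have bH : bmjoint (fun z : I -> R => \prod_i (\1_(A i) (z i) : R)).
  apply: bmfun_prod => i _; apply: (bmfun_compr (measurable_coords i)).
  exact: bmfun_indic.
transitivity (mean (boot_law (sample x y)) (fun t => \prod_i \1_(A i) (coords t i) : R)).
  apply: eq_mean => t; rewrite indicE.
  have [tA|tA] := boolP (t \in _).
    rewrite big1// => i _; rewrite indicE mem_set//.
    by move: tA; rewrite inE => /(_ i Logic.I).
  have [i nA] : exists i, ~ A i (coords t i).
    apply/existsNP => h; case/negP: tA; rewrite inE => i _; exact: h.
  by rewrite (bigD1 i)//= indicE memNset// mul0r.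
rewrite (mean_boot_law _ bH) boot_mean_box big_sumType/=.
by congr (_ * _); apply: eq_bigr => i _; rewrite empirical_probE.
Qed.

End resampling.

Section disintegration.
Context {R : realType} {d : measure_display} {Omega : measurableType d}.
Variables (P : probability Omega R) (n m : nat).
Variables (X Y Xs Ys : nat -> Omega -> R).
Hypotheses (mX : forall i, measurable_fun setT (X i)).
Hypotheses (mY : forall i, measurable_fun setT (Y i)).
Hypotheses (mXs : forall i, measurable_fun setT (Xs i)).
Hypotheses (mYs : forall i, measurable_fun setT (Ys i)).
Hypotheses (n0 : (0 < n)%N) (m0 : (0 < m)%N).
Local Notation I := ('I_n + 'I_m)%type.
Local Notation J := ({ffun 'I_n -> 'I_n} * {ffun 'I_m -> 'I_m})%type.

Definition data (i : I) (w : Omega) : R := sample (X^~ w) (Y^~ w) i.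
Definition boot (i : I) (w : Omega) : R := sample (Xs^~ w) (Ys^~ w) i.

Definition join2 (z z' : I -> R) (k : I + I) : R :=
  match k with inl i => z i | inr i => z' i end.

Lemma measurable_data i : measurable_fun setT (data i).
Proof. by case: i => i; [exact: mX|exact: mY]. Qed.

Lemma measurable_boot i : measurable_fun setT (boot i).
Proof. by case: i => i; [exact: mXs|exact: mYs]. Qed.

Lemma measurable_join2 j k :
  measurable_fun setT (fun w => join2 (data^~ w) (resample (data^~ w) j) k).
Proof.
case: k => [i|[a|b]]; first exact: measurable_data.
  exact: measurable_data.
exact: measurable_data.
Qed.

(** Lets the indicator of a data event be treated as a functional of the data vector when it is
    averaged over resampling maps. *)
Lemma data_sigma_preimage D : data_sigma n m X Y D ->
  exists2 B, measurable B & D = joint_tuple data @^-1` B.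
Proof.
move: D; rewrite /data_sigma.
suff : <<s [set E | (exists2 i, (i < n)%N &
                  preimage_set_system setT (X i) measurable E) \/
               (exists2 j, (j < m)%N &
                  preimage_set_system setT (Y j) measurable E)] >> `<=`
    preimage_set_system setT (joint_tuple data) measurable.
  by move=> sub D /sub [B mB <-]; exists B => //; rewrite setTI.
apply: smallest_sub; first exact/sigma_algebra_preimage/sigma_algebra_measurable.
have sub (i : I) (A : set R) : measurable A ->
    preimage_set_system setT (joint_tuple data) measurable (setT `&` data i @^-1` A).
  move=> mA; exists ((fun t : #|{: I}|.-tuple R => coords t i) @^-1` A).
    by rewrite -[X in measurable X]setTI; exact: measurable_coords.
  by congr (_ `&` _); apply/seteqP; split => w /=; rewrite coords_joint.
move=> E [[i ni [A mA <-]]|[i ni [A mA <-]]].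
  exact: (sub (inl (Ordinal ni))).
exact: (sub (inr (Ordinal ni))).
Qed.

Lemma data_sigma_box (A : I -> set R) : (forall i, measurable (A i)) ->
  data_sigma n m X Y (\bigcap_(i in [set: I]) data i @^-1` A i).
Proof.
move=> mA.
pose S : set (set Omega) := data_sigma n m X Y.
suff : forall s : seq I, S (\bigcap_(i in [set` s]) data i @^-1` A i).
  move=> /(_ (enum {: I})); rewrite (_ : [set` enum {: I}] = [set: I])//.
  by apply/seteqP; split => // i _; rewrite /= mem_enum.
elim=> [|i s IH].
  rewrite (_ : \bigcap_(i in _) _ = ~` set0); last first.
    by rewrite setC0; apply/seteqP; split => // w _ i.
  by apply: sigma_algebraC; exact: sigma_algebra0.
rewrite (_ : \bigcap_(j in _) _ =
  data i @^-1` A i `&` \bigcap_(j in [set` s]) data j @^-1` A j); last first.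
  apply/seteqP; split => w.
    move=> Hw; split; first by apply: Hw; rewrite /= mem_head.
    by move=> j js; apply: Hw; rewrite /= inE js orbT.
  by move=> [wi ws] j; rewrite /= inE => /orP[/eqP->//|js]; exact: ws.
rewrite -[X in S X]setCK setCI.
apply: sigma_algebraC; rewrite -bigcup2E; apply: sigma_algebra_bigcup => k.
have Si : S (data i @^-1` A i).
  apply: sub_sigma_algebra; have := mA i.
  case: i => i mAi; [left|right]; exists i => //.
    by exists (A (inl i)) => //; rewrite setTI.
  by exists (A (inr i)) => //; rewrite setTI.
rewrite /bigcup2; case: ifP => _; first exact: sigma_algebraC.
case: ifP => _; first exact: sigma_algebraC.
exact: sigma_algebra0.
Qed.

Hypothesis bootP : bootstrap_samples P n m X Y Xs Ys.

Lemma boot_box (A : I + I -> set R) : (forall k, measurable (A k)) ->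
  P (\bigcap_(k in [set: I + I]) (fun w => join2 (data^~ w) (boot^~ w) k) @^-1` A k) =
  (mean P (fun w => \1_(\bigcap_(i in [set: I]) data i @^-1` A (inl i)) w *
    boot_mean (fun z => \prod_i \1_(A (inr i)) (z i)) (data^~ w)))%:E.
Proof.
move=> mA; set D := \bigcap_(i in _) data i @^-1` _.
(* [bootstrap_samples] takes sets indexed by all naturals; indices beyond the sample size receive
   the whole line. *)
pose Ax k : set R := if insub k is Some a then A (inr (inl a)) else setT.
pose Ay k : set R := if insub k is Some b then A (inr (inr b)) else setT.
have mAx k : measurable (Ax k) by rewrite /Ax; case: insub.
have mAy k : measurable (Ay k) by rewrite /Ay; case: insub.
have Axi (a : 'I_n) : Ax a = A (inr (inl a)) by rewrite /Ax valK.
have Ayi (b : 'I_m) : Ay b = A (inr (inr b)) by rewrite /Ay valK.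
have SD : data_sigma n m X Y D := data_sigma_box (fun i => mA (inl i)).
have := bootP mAx mAy SD.
have -> : D `&` \bigcap_(i in `I_n) Xs i @^-1` Ax i `&` \bigcap_(j in `I_m) Ys j @^-1` Ay j =
    \bigcap_(k in [set: I + I]) (fun w => join2 (data^~ w) (boot^~ w) k) @^-1` A k.
  apply/seteqP; split => w /=.
    move=> [[Dw Xw] Yw] [i|[a|b]] _ /=; first exact: (Dw i Logic.I).
      by have := Xw a (ltn_ord a); rewrite /= Axi.
    by have := Yw b (ltn_ord b); rewrite /= Ayi.
  move=> Hw; split; [split|] => [i _|k kn|k km] /=.
  - exact: (Hw (inl i) Logic.I).
  - by rewrite (Axi (Ordinal kn)); exact: (Hw (inr (inl (Ordinal kn))) Logic.I).
  - by rewrite (Ayi (Ordinal km)); exact: (Hw (inr (inr (Ordinal km))) Logic.I).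
move=> ->.
have mD : measurable D.
  apply: fin_bigcap_measurable => // i _; rewrite -[X in measurable X]setTI.
  exact: measurable_data.
have bH : bmjoint (fun z : I -> R => boot_mean (fun z => \prod_i (\1_(A (inr i)) (z i) : R)) z).
  apply: bmfunZ; apply: bmfun_sum => j _; apply: bmfun_prod => -[a|b] _ /=;
    by apply: (bmfun_compr (measurable_coords _)); apply: bmfun_indic.
have bHd := bmjoint_comp measurable_data bH.
rewrite EFin_mean; last by apply: bmfunM => //; exact: bmfun_indic.
rewrite integral_mkcond; apply: eq_integral => w _.
rewrite patchE indicE; case: ifP => _; last by rewrite mul0r.
rewrite mul1r boot_mean_box//; congr (_ * _)%:E; apply: eq_bigr => i _.
  by rewrite Axi.
by rewrite Ayi.
Qed.

(** The right-hand side is a mean under [P'], the average over the maps j of the laws of the pair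
    (data, data resampled by j). By [boot_box] it agrees on boxes with the law of (data, bootstrap
    sample), hence everywhere. *)
Lemma mean_disintegration (H : (I + I -> R) -> R) : bmjoint H ->
  mean P (fun w => H (join2 (data^~ w) (boot^~ w))) =
  mean P (fun w => boot_mean (fun z => H (join2 (data^~ w) z)) (data^~ w)).
Proof.
move=> bH.
pose Zj (j : J) (k : I + I) w := join2 (data^~ w) (resample (data^~ w) j) k.
have mZj j k : measurable_fun setT (Zj j k) by exact: measurable_join2.
pose P' := fin_avg (@idJ n m) (fun j => distribution P (mfun_of (measurable_joint_tuple (mZj j)))).
have mP' (f : (I + I -> R) -> R) : bmjoint f ->
    mean P' (fun t => f (coords t)) =
    mean P (fun w => boot_mean (fun z => f (join2 (data^~ w) z)) (data^~ w)).
  move=> bf; have bj j : bmfun (fun w => f (Zj j ^~ w)) by exact: bmjoint_comp.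
  rewrite mean_fin_avg// /boot_mean meanZ; last by apply: bmfun_sum => j _; exact: bj.
  rewrite mean_sum; last by move=> j _; exact: bj.
  congr (_ * _); apply: eq_bigr => j _; rewrite mean_distribution//.
  by apply: eq_mean => w /=; rewrite coords_joint.
rewrite -(mP' _ bH).
apply: (@eq_joint_law _ _ _ _ _ _ P P' (fun k w => join2 (data^~ w) (boot^~ w) k)
   (fun k t => coords t k)) => //.
- by case=> i; [exact: measurable_data|exact: measurable_boot].
- exact: measurable_coords.
move=> A mA; rewrite boot_box// -[RHS]fineK; last first.
  by apply: fin_num_measure; exact: (measurable_box mA).
congr EFin; rewrite -mean_indic; last exact: (measurable_box mA).
have prodE (K : finType) (B : K -> set R) (z : K -> R) :
    \prod_k \1_(B k) (z k) = (`[< forall k, B k (z k) >])%:R :> R.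
  have [h|/existsNP[k nB]] := pselect (forall k, B k (z k)).
    by rewrite asboolT// big1// => k _; rewrite indicE mem_set.
  rewrite asboolF; last by move/(_ k).
  by rewrite (bigD1 k)//= indicE memNset// mul0r.
rewrite (@eq_mean _ _ _ P' _ (fun t => \prod_k (\1_(A k) (coords t k) : R))).
  rewrite (mP' (fun z => \prod_k (\1_(A k) (z k) : R))).
    apply: eq_mean => w; rewrite /boot_mean mulrCA; congr (_ * _).
    rewrite mulr_sumr; apply: eq_bigr => j _; rewrite [RHS]big_sumType/=; congr (_ * _).
    rewrite prodE indicE; congr (nat_of_bool _)%:R; apply/idP/asboolP.
      by rewrite inE => h i; exact: h.
    by move=> h; rewrite inE => i _; exact: h.
  apply: bmfun_prod => k _; apply: (bmfun_compr (measurable_coords k)).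
  exact: bmfun_indic.
move=> t; rewrite prodE indicE; congr (nat_of_bool _)%:R; apply/idP/asboolP.
  by rewrite inE => h i; exact: h.
by move=> h; rewrite inE => i _; exact: h.
Qed.

End disintegration.

(** * Weak convergence from cosines *)

Section levy.
Context {R : realType}.

(** If |z| > tau, then |z - u| >= tau/2 or |u| >= tau/2; the first case is paid for as in Markov's
    inequality, the second as in Chebyshev's. *)
Lemma outside_le (tau z1 z2 u1 u2 : R) : 0 < tau ->
  outside tau (z1, z2) <= 2 / tau * (`|z1 - u1| + `|z2 - u2|) +
    4 / tau ^+ 2 * (u1 ^+ 2 + u2 ^+ 2).
Proof.
move=> t0.
have p1 z : 0 <= 2 / tau * `|z| by rewrite mulr_ge0// divr_ge0// ltW.
have p2 u : 0 <= 4 / tau ^+ 2 * u ^+ 2 by rewrite mulr_ge0 ?divr_ge0 ?sqr_ge0.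
have side z u : (tau < `|z|) -> 1 <= 2 / tau * `|z - u| + 4 / tau ^+ 2 * u ^+ 2.
  move=> tz; have [d1|d1] := leP (tau / 2) `|z - u|.
    rewrite ler_wpDr ?p2// mulrAC ler_pdivlMr// mul1r; lra.
  have tu : tau / 2 <= `|u|.
    have := ler_normB z (z - u); rewrite (_ : z - (z - u) = u); last by ring.
    have := ler_normD (z - u) u; rewrite subrK; lra.
  rewrite ler_wpDl ?p1//.
  rewrite -[u ^+ 2]real_normK ?num_real// mulrAC ler_pdivlMr ?exprn_gt0// mul1r.
  rewrite (_ : 4 * _ = (2 * `|u|) ^+ 2); last by ring.
  by rewrite lerXn2r ?nnegrE ?(ltW t0) ?mulr_ge0//; lra.
have pos z u : 0 <= 2 / tau * `|z - u| + 4 / tau ^+ 2 * u ^+ 2 by rewrite addr_ge0.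
rewrite /outside/=.
have := pos z1 u1; have := pos z2 u2.
have := side z1 u1; have := side z2 u2.
have [h1|h1] := leP `|z1| tau; have [h2|h2] := leP `|z2| tau => s2 s1 q2 q1 /=;
  rewrite ?mulr1n ?mulr0n.
- by lra.
- by have := s2 isT; lra.
- by have := s1 isT; lra.
- by have := s1 isT; lra.
Qed.

Variables (L : probability (R * R)%type R) (Q : R -> R -> R).
Hypothesis charL : forall a b c,
  mean L (fun z => cos (a * z.1 + b * z.2 + c)) = expR (- (Q a b / 2)) * cos c.

(** A quantitative continuity theorem. [C] and [l] are chosen before the probability space, so one
    choice serves all sample sizes and all conditional laws. The pair (Z1, Z2) only has to be close
    in L1 to a pair (U1, U2) with controlled cosine means and second moments. *)
Lemma levy_bound (h : R * R -> R) (V e : R) : bounded_continuous h -> 0 <= V -> 0 < e ->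
  exists2 C, 0 <= C & exists l : seq (R * R * R * R),
  forall d (T : measurableType d) (P : probability T R) (Z1 Z2 U1 U2 : T -> R),
    bmfun Z1 -> bmfun Z2 -> bmfun U1 -> bmfun U2 ->
    mean P (fun w => U1 w ^+ 2 + U2 w ^+ 2) <= V ->
  `|mean P (fun w => h (Z1 w, Z2 w)) - mean L h| <=
    e + C * mean P (fun w => `|Z1 w - U1 w| + `|Z2 w - U2 w|) +
    \sum_(t <- l) `|t.1.1.1| *
      `|mean P (fun w => cos (t.1.1.2 * U1 w + t.1.2 * U2 w + t.2)) -
        expR (- (Q t.1.1.2 t.1.2 / 2)) * cos t.2|.
Proof.
move=> bh V0 e0; have [ch _] := bh.
have [M M_gt0 hM] := bmfun_bound (bmfun_continuous bh).
have [t1 t10 Lt1] := tight L (divr_gt0 e0 (mulr_gt0 (ltr0n R 8) M_gt0) : 0 < e / (8 * M)).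
(* Since tau >= t2 >= 1, tau^2 >= 64 M V / e, so the second-moment part of the tail contributes at
   most e/8; [t1] limits the tail of [L] to e/4. *)
pose t2 := 1 + 64 * M * V / e.
have t2_ge1 : 1 <= t2 by rewrite lerDl divr_ge0 ?mulr_ge0 ?(ltW e0) ?(ltW M_gt0).
pose tau := Num.max t1 t2.
have tau0 : 0 < tau by rewrite lt_max t10.
have tau_t2 : t2 <= tau by rewrite le_max lexx orbT.
have [p [l pl] sub] := trig_substitute ch hM tau0 (divr_gt0 e0 (ltr0n R 8) : 0 < e / 8).
pose C1 := \sum_(t <- l) `|t.1.1.1| * (`|t.1.1.2| + `|t.1.2|).
have C10 : 0 <= C1 by apply: sumr_ge0 => t _; rewrite mulr_ge0// addr_ge0.
pose C2 := 2 * M * (2 / tau).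
have C20 : 0 <= C2 by rewrite !mulr_ge0 ?invr_ge0 ?(ltW tau0) ?(ltW M_gt0).
exists (C1 + C2); first exact: addr_ge0.
exists l => d T P Z1 Z2 U1 U2 bZ1 bZ2 bU1 bU2 UV.
have mZ : measurable_fun setT (fun w => (Z1 w, Z2 w)).
  by apply: measurable_fun_pair; [case: bZ1|case: bZ2].
have bD : bmfun (fun w => `|Z1 w - U1 w| + `|Z2 w - U2 w|).
  by apply: bmfunD; apply: bmfun_norm; exact: bmfunB.
have bU : bmfun (fun w => U1 w ^+ 2 + U2 w ^+ 2) by apply: bmfunD; exact: bmfunX.
set D := mean P (fun w => `|Z1 w - U1 w| + `|Z2 w - U2 w|).
have outZ : mean P (outside tau \o (fun w => (Z1 w, Z2 w))) <=
    2 / tau * D + e / (16 * M).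
  apply: (@le_trans _ _ (mean P (fun w => 2 / tau * (`|Z1 w - U1 w| + `|Z2 w - U2 w|) +
      4 / tau ^+ 2 * (U1 w ^+ 2 + U2 w ^+ 2)))).
    apply: le_mean; first exact: bmfun_outside.
      by apply: bmfunD; exact: bmfunZ.
    by move=> w; exact: outside_le.
  rewrite meanD; [|exact: bmfunZ..].
  rewrite !meanZ// lerD2l.
  apply: (@le_trans _ _ (4 / tau ^+ 2 * V)).
    by rewrite ler_wpM2l// divr_ge0// exprn_ge0// ltW.
  rewrite mulrAC ler_pdivrMr ?exprn_gt0// mulrAC ler_pdivlMr ?mulr_gt0//.
  have : 64 * M * V <= e * tau.
    have : 64 * M * V <= e * t2.
      have : e * (64 * M * V / e) = 64 * M * V by field; rewrite gt_eqF.
      rewrite /t2 mulrDr mulr1 => ->.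
      by move: e0; lra.
    by move=> /le_trans; apply; rewrite ler_pM2l.
  have : e * tau <= e * tau ^+ 2.
    by rewrite ler_pM2l// expr2 ler_peMl ?(ltW tau0)// (le_trans t2_ge1).
  by lra.
have outL : mean L (outside tau \o id) <= e / (8 * M).
  apply: le_trans Lt1; apply: le_mean.
  - exact: (bmfun_outside tau (Z := id)).
  - exact: (bmfun_outside t1 (Z := id)).
  - move=> z /=; rewrite /outside ler_nat.
    have [/andP[z1 z2]|_] := boolP ((`|z.1| <= t1) && (`|z.2| <= t1)).
      by rewrite (le_trans z1) ?(le_trans z2) ?le_max ?lexx.
    by case: (_ && _).
have s1 := sub _ _ P _ mZ.
have s2 := sub _ _ L _ (@measurable_id _ _ setT).
have bcos (f g : T -> R) t : bmfun f -> bmfun g ->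
    bmfun (fun w => cos (t.1.1.2 * f w + t.1.2 * g w + t.2) : R).
  move=> [mf _] [mg _]; apply: bmfun_cos; apply: measurable_funD => //.
  by apply: measurable_funD; exact: measurable_funM.
have pE (f g : T -> R) : bmfun f -> bmfun g -> mean P (fun w => p (f w, g w)) =
    \sum_(t <- l) t.1.1.1 * mean P (fun w => cos (t.1.1.2 * f w + t.1.2 * g w + t.2)).
  move=> bf bg; under eq_mean do rewrite pl.
  rewrite mean_sum; last by move=> t _; apply: bmfunZ; exact: bcos.
  by apply: eq_bigr => t _; rewrite meanZ//; exact: bcos.
have pL : mean L p = \sum_(t <- l) t.1.1.1 * (expR (- (Q t.1.1.2 t.1.2 / 2)) * cos t.2).
  have bL t : bmfun (fun z : R * R => cos (t.1.1.2 * z.1 + t.1.2 * z.2 + t.2) : R).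
    apply: bmfun_cos; apply: measurable_funD => //.
    by apply: measurable_funD; exact: measurable_funM.
  under eq_mean do rewrite pl.
  rewrite mean_sum; last by move=> t _; apply: bmfunZ; exact: bL.
  by apply: eq_bigr => t _; rewrite meanZ ?charL//; exact: bL.
have s3 : `|mean P (fun w => p (Z1 w, Z2 w)) - mean P (fun w => p (U1 w, U2 w))| <= C1 * D.
  rewrite !pE// -sumrB (le_trans (ler_norm_sum _ _ _))// /C1 mulr_suml.
  apply: ler_sum => t _; rewrite -mulrBr normrM -mulrA ler_wpM2l//.
  rewrite -meanB; [|exact: bcos..].
  rewrite (le_trans (norm_mean _ _))//; first by apply: bmfunB; exact: bcos.
  rewrite -meanZ//; apply: le_mean.
  - by apply: bmfun_norm; apply: bmfunB; exact: bcos.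
  - exact: bmfunZ.
  move=> w; rewrite (le_trans (cos_lipschitz _ _))//.
  rewrite (_ : _ - _ = t.1.1.2 * (Z1 w - U1 w) + t.1.2 * (Z2 w - U2 w)); last by ring.
  rewrite (le_trans (ler_normD _ _))// !normrM mulrDl !mulrDr.
  have h1 : 0 <= `|t.1.1.2| * `|Z2 w - U2 w| by exact: mulr_ge0.
  have h2 : 0 <= `|t.1.2| * `|Z1 w - U1 w| by exact: mulr_ge0.
  by lra.
set S := \sum_(t <- l) _.
have s4 : `|mean P (fun w => p (U1 w, U2 w)) - mean L p| <= S.
  rewrite pE// pL -sumrB (le_trans (ler_norm_sum _ _ _))//.
  by apply: ler_sum => t _; rewrite -mulrBr normrM.
have Mout : 2 * M * mean P (outside tau \o (fun w => (Z1 w, Z2 w))) <= C2 * D + e / 8.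
  apply: (le_trans (ler_wpM2l _ outZ)); first by rewrite mulr_ge0// ltW.
  rewrite /C2 le_eqVlt; apply/orP; left; apply/eqP; field.
  by rewrite gt_eqF// gt_eqF.
have MoutL : 2 * M * mean L (outside tau \o id) <= e / 4.
  apply: (le_trans (ler_wpM2l _ outL)); first by rewrite mulr_ge0// ltW.
  rewrite le_eqVlt; apply/orP; left; apply/eqP; field.
  by rewrite gt_eqF.
move: s1 s2 s3 s4; rewrite /comp/=.
set A1 := mean P (fun w => h _); set A2 := mean P (fun w => p (Z1 w, _)).
set A3 := mean P (fun w => p (U1 w, _)); set B1 := mean L _; set B2 := mean L _.
move=> s1 s2 s3 s4.
have -> : A1 - B1 = (A1 - A2) + (A2 - A3) + (A3 - B2) - (B1 - B2) by ring.
rewrite (le_trans (ler_normB _ _))// (le_trans (lerD (ler_normD _ _) (lexx _)))//.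
rewrite (le_trans (lerD (lerD (ler_normD _ _) (lexx _)) (lexx _)))//.
rewrite /comp/= in Mout MoutL; lra.
Qed.

End levy.

(** * Remainder terms *)

Section ustat_moment.
Context {R : realType} {d : measure_display} {T : measurableType d} {n m : nat}.
Variables (P : probability T R) (Z : 'I_n + 'I_m -> T -> R) (mu rho : probability R R).
Hypothesis indepZ : indep_law P Z (fun i => if i is inl _ then mu else rho).
Hypotheses (n0 : (0 < n)%N) (m0 : (0 < m)%N).
Variables (k : R * R -> R) (B : R).
Hypotheses (bk : bmfun k) (kB : forall z, `|k z| <= B).

(** The remainder and the two projections, with (a + b + c)^2 <= 3 (a^2 + b^2 + c^2): the sum is 48
    B^2/m + 12 B^2 (1 + n/m), and m >= 1. It provides the second moment that [levy_bound] asks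
    for. *)
Lemma mean_sqr_ustat :
  mean P (fun w => (Num.sqrt n%:R * (ustat Z inl inr k w - theta mu rho k)) ^+ 2) <=
  12 * B ^+ 2 * (5 + n%:R / m%:R).
Proof.
have [mZ _] := indepZ.
have nn : 0 < n%:R :> R by rewrite ltr0n.
have mm : 0 < m%:R :> R by rewrite ltr0n.
have inl_inj : injective (@inl 'I_n 'I_m) by move=> ? ? [].
have inr_inj : injective (@inr 'I_n 'I_m) by move=> ? ? [].
have deg := mean_sqr_degenerate indepZ n0 m0 inl_inj inr_inj
  (fun _ _ => isT) (fun=> erefl) (fun=> erefl) bk kB.
have b1 := bmfun_proj1 mu rho bk; have b2 := bmfun_proj2 mu rho bk.
have lx := mean_sqr_lln indepZ n0 inl_inj (fun=> erefl) b1 (proj1_le rho bk kB).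
have ly := mean_sqr_lln indepZ m0 inr_inj (fun=> erefl) b2 (proj2_le mu bk kB).
rewrite -/(theta mu rho k) in lx; rewrite -theta_proj2// in ly.
set D := (fun w => _) in deg; set X := (fun w => _) in lx; set Y := (fun w => _) in ly.
have bU : bmfun (ustat Z inl inr k) := bmfun_ustat indepZ inl inr bk.
have bsx i : bmfun (fun w => proj1 rho k (Z (inl i) w)) by exact: bmfun_compr b1.
have bsy j : bmfun (fun w => proj2 mu k (Z (inr j) w)) by exact: bmfun_compr b2.
have bX0 : bmfun (fun w => n%:R^-1 * \sum_i proj1 rho k (Z (inl i) w) - theta mu rho k).
  by apply: bmfunB (bmfun_cst _); apply: bmfunZ; apply: bmfun_sum.
have bY0 : bmfun (fun w => m%:R^-1 * \sum_i proj2 mu k (Z (inr i) w) - theta mu rho k).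
  by apply: bmfunB (bmfun_cst _); apply: bmfunZ; apply: bmfun_sum.
have bX : bmfun X by exact: bmfunX.
have bY : bmfun Y by exact: bmfunX.
have bD : bmfun D.
  apply: bmfunX; apply: bmfunB; first by apply: bmfunB (bmfun_cst _).
  by apply: bmfunD; apply: bmfunZ; apply: bmfun_sum => i _; apply: bmfunB (bmfun_cst _).
have bV : bmfun (fun w => 3 * n%:R * (D w + X w + Y w)).
  by apply: bmfunZ; apply: bmfunD => //; exact: bmfunD.
apply: (@le_trans _ _ (mean P (fun w => 3 * n%:R * (D w + X w + Y w)))).
  apply: le_mean => //; first by apply: bmfunX; apply: bmfunZ; apply: bmfunB (bmfun_cst _).
  move=> w; rewrite exprMn sqr_sqrtr// [3 * _]mulrC -mulrA ler_pM2l//.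
  rewrite /D /X /Y.
  set u := ustat Z inl inr k w - _.
  have -> : n%:R^-1 * \sum_i (proj1 rho k (Z (inl i) w) - theta mu rho k) =
      n%:R^-1 * \sum_i proj1 rho k (Z (inl i) w) - theta mu rho k.
    rewrite sumrB sumr_const card_ord -[theta mu rho k *+ n]mulr_natl.
    by field; rewrite gt_eqF.
  have -> : m%:R^-1 * \sum_i (proj2 mu k (Z (inr i) w) - theta mu rho k) =
      m%:R^-1 * \sum_i proj2 mu k (Z (inr i) w) - theta mu rho k.
    rewrite sumrB sumr_const card_ord -[theta mu rho k *+ m]mulr_natl.
    by field; rewrite gt_eqF.
  set a := n%:R^-1 * _ - _; set b := m%:R^-1 * _ - _.
  have := sqr_ge0 (u - (a + b) - a); have := sqr_ge0 (u - (a + b) - b).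
  by have := sqr_ge0 (a - b); lra.
rewrite meanZ; last by apply: bmfunD => //; exact: bmfunD.
rewrite meanD//; last exact: bmfunD.
rewrite (meanD P bD bX).
apply: (@le_trans _ _ (3 * n%:R * ((4 * B) ^+ 2 / (n%:R * m%:R) + (2 * B) ^+ 2 / n%:R +
    (2 * B) ^+ 2 / m%:R))).
  by rewrite ler_pM2l ?mulr_gt0// !lerD.
rewrite (_ : 3 * _ * _ = 48 * B ^+ 2 / m%:R + 12 * B ^+ 2 * (1 + n%:R / m%:R)); last first.
  by field; rewrite !gt_eqF.
have : 48 * B ^+ 2 / m%:R <= 48 * B ^+ 2.
  apply: ler_piMr; first by rewrite mulr_ge0 ?sqr_ge0.
  by rewrite invf_le1// ler1n.
have : 0 <= 12 * B ^+ 2 by rewrite mulr_ge0 ?sqr_ge0.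
lra.
Qed.

End ustat_moment.

Section gap.
Context {R : realType} {d : measure_display} {T : measurableType d}.
Variables (P : probability T R) (n m : nat) (x y : nat -> T -> R).
Hypotheses (mx : forall i, (i < n)%N -> measurable_fun setT (x i)).
Hypotheses (my : forall j, (j < m)%N -> measurable_fun setT (y j)).
Hypotheses (n0 : (0 < n)%N) (m0 : (0 < m)%N).
Variable x0 : R.
Local Notation Fh w := (ecdf n (x^~ w)).
Local Notation Gh w := (ecdf m (y^~ w)).

(** The excess of the U-statistic with the overlap kernel over the plug-in I_2; its sign comes from
    the minimum property of I_2. *)
Definition ecdf_gap (x' y' : nat -> R) : R :=
  2 * (n%:R^-1 * \sum_(i < n) `|ecdf m y' (x' i) - ecdf m y' x0|) -
  overlap_index (ecdf n x') (ecdf m y').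

Lemma ecdf_gapE x' y' : ecdf_gap x' y' =
  (n%:R * m%:R)^-1 * \sum_(i < n) \sum_(j < m) overlap_kernel x0 (x' i, y' j) -
  overlap_index (ecdf n x') (ecdf m y').
Proof.
have FE z := empirical_ray x' z n0; have GE z := empirical_ray y' z m0.
rewrite -theta_empirical//; last exact: bmfun_overlap_kernel.
rewrite (theta_overlap_kernel _ GE) mean_empirical//.
apply: bmfun_norm; apply: bmfunB (bmfun_cst _).
by apply: bmfun_nondecreasing => [a b|a]; [exact: (cdf_mono GE)|exact: (cdf_bounds GE)].
Qed.

(** [kappa] in [overlap_gap_le] is the oscillation of the second empirical distribution function
    over the window around [x0], plus 1 on the bad event that the sample median falls outside the
    window. *)
Lemma ecdf_gap_bounds (eta : R) x' y' : 0 <= eta -> 0 <= ecdf_gap x' y' <=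
  2 * (ecdf m y' (x0 + eta) - ecdf m y' (x0 - eta) +
    (~~ (ecdf n x' (x0 - eta) < 1 / 2 <= ecdf n x' (x0 + eta)))%:R) *
  `|2 * ecdf n x' x0 - 1|.
Proof.
move=> eta0.
have FE z := empirical_ray x' z n0; have GE z := empirical_ray y' z m0.
have Gm : {homo ecdf m y' : a b / a <= b} by exact: (cdf_mono GE).
have G01 := cdf_bounds GE.
have bGc : bmfun (fun a => `|ecdf m y' a - ecdf m y' x0|).
  by apply: bmfun_norm; apply: bmfunB (bmfun_cst _); exact: bmfun_nondecreasing.
rewrite /ecdf_gap -(mean_empirical x' n0 bGc); apply/andP; split.
  by rewrite subr_ge0; exact: (overlap_le FE Gm G01).
apply: (overlap_gap_le FE Gm G01 eta0) => [good|bad].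
  by rewrite good/= addr0.
by rewrite bad lerDr subr_ge0 Gm//; lra.
Qed.

Lemma bmfun_ecdf_gap : bmfun (fun w => ecdf_gap (x^~ w) (y^~ w)).
Proof.
apply: bmfunB; last exact: bmfun_overlap_ecdf.
apply: bmfunZ; apply: bmfunZ; apply: bmfun_sum => i _; apply: bmfun_norm.
apply: bmfunB; first by apply: bmfun_ecdf => //; exact: mx.
by apply: bmfun_ecdf => //; exact: measurable_cst.
Qed.

Variables (F G : R -> R) (K : R).
Hypothesis Fx0 : F x0 = 1 / 2.
Hypothesis FK : forall z, mean P (fun w => (Fh w z - F z) ^+ 2) <= K / n%:R.
Hypothesis GK : forall z, mean P (fun w => Gh w z) = G z.

(** The gap is at most a deviation of order n^(-1/2) times an oscillation. The weight [s] separates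
    the two factors, so that second moments of [Fh] and first moments of [Gh] suffice. The bad event
    costs a Chebyshev bound with margin [dl]. *)
Lemma mean_ecdf_gap (eta dl s : R) : 0 <= eta -> 0 < dl -> 0 < s ->
  F (x0 - eta) <= 1 / 2 - dl -> 1 / 2 + dl <= F (x0 + eta) ->
  mean P (fun w => Num.sqrt n%:R * ecdf_gap (x^~ w) (y^~ w)) <=
  4 * K * s + 2 / s * (G (x0 + eta) - G (x0 - eta) + 2 * K / (dl ^+ 2 * n%:R)).
Proof.
move=> eta0 dl0 s0 Flo Fhi.
have nn : 0 < n%:R :> R by rewrite ltr0n.
have bF z : bmfun (fun w => Fh w z).
  apply: bmfunZ; apply: bmfun_sum => i _.
  by apply: (bmfun_rel_kernel (measurable_cst z) (mx (ltn_ord i))).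
have bG z : bmfun (fun w => Gh w z) by apply: bmfun_ecdf => //; exact: measurable_cst.
have bF2 z : bmfun (fun w => (Fh w z - F z) ^+ 2).
  by apply: bmfunX; apply: bmfunB (bmfun_cst _).
pose a := x0 - eta; pose b := x0 + eta.
rewrite -/a in Flo; rewrite -/b in Fhi.
pose E w := 4 * s * n%:R * (Fh w x0 - F x0) ^+ 2 + 2 / s * ((Gh w b - Gh w a) +
   dl ^- 2 * ((Fh w a - F a) ^+ 2 + (Fh w b - F b) ^+ 2)).
have b2 : bmfun (fun w => dl ^- 2 * ((Fh w a - F a) ^+ 2 + (Fh w b - F b) ^+ 2)).
  by apply: bmfunZ; exact: bmfunD.
have b1 : bmfun (fun w => Gh w b - Gh w a) by exact: bmfunB.
have b3 : bmfun (fun w => (Gh w b - Gh w a) + dl ^- 2 * ((Fh w a - F a) ^+ 2 +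
   (Fh w b - F b) ^+ 2)) by exact: bmfunD.
have bE : bmfun E by apply: bmfunD; exact: bmfunZ.
apply: (@le_trans _ _ (mean P E)).
  apply: le_mean => //; first by apply: bmfunZ; exact: bmfun_ecdf_gap.
  move=> w; have /andP[_ gap] := ecdf_gap_bounds (x^~ w) (y^~ w) eta0.
  apply: le_trans (ler_wpM2l (sqrtr_ge0 _) gap) _.
  set bad := (~~ _)%:R.
  have badle : bad <= dl ^- 2 * ((Fh w a - F a) ^+ 2 + (Fh w b - F b) ^+ 2).
    have pos (c e : R) : 0 <= c ^+ 2 + e ^+ 2 by rewrite addr_ge0 ?sqr_ge0.
    have key (c e : R) : dl <= `|c| \/ dl <= `|e| -> 1 <= dl ^- 2 * (c ^+ 2 + e ^+ 2).
      move=> cd; rewrite mulrC ler_pdivlMr ?exprn_gt0// mul1r.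
      rewrite -[c ^+ 2]real_normK ?num_real// -[e ^+ 2]real_normK ?num_real//.
      case: cd => h.
        by rewrite ler_wpDr ?sqr_ge0// lerXn2r ?nnegrE ?(ltW dl0).
      by rewrite ler_wpDl ?sqr_ge0// lerXn2r ?nnegrE ?(ltW dl0).
    rewrite /bad; have [_|] := boolP (_ && _).
      by rewrite mulr_ge0 ?pos// invr_ge0 exprn_ge0// ltW.
    rewrite negb_and -leNgt -ltNge -/a -/b => /orP[h|h]; apply: key; [left|right].
      by rewrite (le_trans _ (ler_norm _))//; lra.
    by rewrite -normrN (le_trans _ (ler_norm _))//; lra.
  have FE z := empirical_ray (x^~ w) z n0; have GE z := empirical_ray (y^~ w) z m0.
  have G0 : 0 <= Gh w b - Gh w a.
    by rewrite subr_ge0; apply: (cdf_mono GE); rewrite /a /b; lra.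
  have G1 : Gh w b - Gh w a <= 1.
    by have := cdf_bounds GE a; have := cdf_bounds GE b; lra.
  have bad01 : 0 <= bad <= 1.
    rewrite /bad; case: (~~ _) => /=; rewrite ?lexx ?ler01 //.
  have bad2 : bad ^+ 2 = bad by rewrite /bad; case: (~~ _) => /=; rewrite ?expr1n ?expr0n.
  rewrite -/a -/b.
  set ka := Gh w b - Gh w a + bad.
  (* The oscillation is at most 1 and [bad] is 0 or 1; this makes the bound linear in quantities
     whose means are known. *)
  have ka2 : ka ^+ 2 <= 2 * (Gh w b - Gh w a + bad).
    rewrite /ka; nra.
  rewrite (_ : 2 * Fh w x0 - 1 = 2 * (Fh w x0 - F x0)); last by rewrite Fx0; field.
  rewrite normrM ger0_norm//; set u := `|_|.
  have u2 : (Fh w x0 - F x0) ^+ 2 = u ^+ 2 by rewrite real_normK ?num_real.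
  rewrite /E u2.
  (* AM-GM: 4 r ka u <= 4 s r^2 u^2 + ka^2 / s *)
  have amgm : Num.sqrt n%:R * (2 * ka * (2 * u)) <= 4 * s * n%:R * u ^+ 2 + s^-1 * ka ^+ 2.
    have r2 := sqr_sqrtr (ler0n R n); move: r2; set r := Num.sqrt _ => r2; rewrite -r2.
    have : 0 <= s^-1 * (2 * s * r * u - ka) ^+ 2 by rewrite mulr_ge0 ?sqr_ge0// invr_ge0 ltW.
    clearbody r ka u; move=> h; rewrite -subr_ge0 (le_trans h)// le_eqVlt.
    by apply/orP; left; apply/eqP; field; rewrite gt_eqF.
  apply: (le_trans amgm); rewrite lerD2l.
  rewrite [2 / s]mulrC -mulrA ler_pM2l ?invr_gt0//.
  rewrite (le_trans ka2)// ler_pM2l// lerD2l//.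
rewrite /E meanD; [|exact: bmfunZ..].
rewrite (meanZ P _ (bF2 x0)) (meanZ P _ b3).
rewrite (meanD P b1 b2) (meanB P (bG b) (bG a)) !GK.
rewrite meanZ; last exact: bmfunD.
rewrite (meanD P (bF2 a) (bF2 b)).
apply: lerD.
  rewrite (_ : 4 * K * s = 4 * s * n%:R * (K / n%:R)); last by field; rewrite gt_eqF.
  by rewrite ler_pM2l ?mulr_gt0.
rewrite ler_pM2l ?divr_gt0// lerD2l.
rewrite (_ : 2 * K / _ = dl ^- 2 * (K / n%:R + K / n%:R)); last first.
  by field; rewrite !gt_eqF.
by rewrite ler_pM2l ?invr_gt0 ?exprn_gt0// lerD.
Qed.

End gap.

(** * Distribution functions with a continuous density *)

Section density.
Context {R : realType}.
Variables (F f : R -> R).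
Hypothesis Ff : continuous_density F f.

Lemma density_increment (a b : R) : a <= b ->
  (F b - F a)%:E = (\int[lebesgue_measure]_(t in `]a, b]) (f t)%:E)%E.
Proof.
move=> ab; have [cf f0 FE] := Ff.
have mf : measurable_fun setT (EFin \o f).
  by apply/measurable_EFinP; apply: continuous_measurable_fun.
have U : (`]-oo, b]%classic : set R) = `]-oo, a]%classic `|` `]a, b]%classic.
  apply/seteqP; split => x /=; rewrite !in_itv/=.
    by move=> xb; case: (leP x a) => xa; [left|right].
  by case=> [xa|/andP[_ ->]//]; exact: le_trans ab.
have : (F b)%:E = ((F a)%:E + \int[lebesgue_measure]_(t in `]a, b]) (f t)%:E)%E.
  rewrite !FE U ge0_integral_setU//=; try exact: measurable_itv.
  - by apply: measurable_funTS.
  - by move=> x _; rewrite lee_fin.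
  - apply/disj_setPRL => x /=; rewrite !in_itv/= => /andP[xa _] /=.
    by rewrite leNgt xa.
by rewrite EFinB => ->; rewrite addeAC subee// add0e.
Qed.

Let mfab a b : measurable_fun (`]a, b]%classic : set R) (EFin \o f).
Proof.
have [cf _ _] := Ff.
by apply: measurable_funTS; apply/measurable_EFinP; apply: continuous_measurable_fun.
Qed.

Let integral_cst_ab (a b c : R) : a <= b ->
  (\int[lebesgue_measure]_(t in `]a, b]) c%:E = (c * (b - a))%:E)%E.
Proof.
move=> ab; rewrite integral_cst/=; last exact: measurable_itv.
rewrite lebesgue_measure_itv/= lte_fin.
have [h|h] := boolP (a < b); first by rewrite -EFinB -EFinM.
have -> : b = a by apply/le_anti; rewrite ab leNgt h.
by rewrite subrr mulr0 mule0.
Qed.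

Lemma density_lower (x l : R) : 0 <= l -> l < f x ->
  exists2 eta : R, 0 < eta & forall a b, x - eta < a -> a <= b -> b < x + eta ->
    l * (b - a) <= F b - F a.
Proof.
move=> l0 lf; have [cf f0 _] := Ff.
have near_x : \forall y \near x, l < f y by exact: (cvgr_gt (f x) (cf x)).
have [/= e e0 He] := near_x; exists e => // a b xa ab bx.
rewrite -lee_fin (density_increment ab) -integral_cst_ab//.
apply: ge0_le_integral => //=; first exact: mfab.
by move=> y; rewrite lee_fin in_itv/= => /andP[ay yb]; apply/ltW/He; rewrite /ball/= ltr_norml; lra.
Qed.

Lemma density_upper (x u : R) : f x < u ->
  exists2 eta : R, 0 < eta & forall a b, x - eta < a -> a <= b -> b < x + eta ->
    F b - F a <= u * (b - a).
Proof.
move=> fu; have [cf f0 _] := Ff.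
have near_x : \forall y \near x, f y < u by exact: (cvgr_lt (f x) (cf x)).
have [/= e e0 He] := near_x; exists e => // a b xa ab bx.
rewrite -lee_fin (density_increment ab) -integral_cst_ab//.
apply: ge0_le_integral => //=.
- by move=> y _; rewrite lee_fin.
- exact: mfab.
by move=> y; rewrite lee_fin in_itv/= => /andP[ay yb]; apply/ltW/He; rewrite /ball/= ltr_norml; lra.
Qed.

(** Near [x] the density stays below [f x + 1], which makes [F] Lipschitz there. *)
Lemma density_modulus (x e : R) : 0 < e ->
  exists2 eta0 : R, 0 < eta0 &
    forall eta, 0 <= eta -> eta <= eta0 -> F (x + eta) - F (x - eta) <= e.
Proof.
move=> e0; have [_ f0 _] := Ff.
have fx0 := f0 x; have u0 : 0 < f x + 1 by lra.
have [|eta1 eta10 H] := @density_upper x (f x + 1); first by lra.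
have q0 : 0 < e / (f x + 1) by rewrite divr_gt0.
exists (Num.min (eta1 / 2) (e / (f x + 1) / 2)).
  by rewrite lt_min !divr_gt0.
move=> eta eta0; rewrite le_min => /andP[h1 h2].
apply: le_trans (H (x - eta) (x + eta) _ _ _) _; [lra..|].
rewrite mulrC -ler_pdivlMr//; lra.
Qed.

Section median.
Variable mu : probability R R.
Hypothesis FE : forall x, fine (mu `]-oo, x]%classic) = F x.
Hypothesis f0 : f (quantile F (1 / 2)) != 0.
Local Notation x0 := (quantile F (1 / 2)).

(** F x0 >= 1/2 because the infimum is attained. A strict inequality would be a jump, since F < 1/2
    to the left of [x0], and a density excludes jumps. *)
Lemma cdf_median : F x0 = 1 / 2.
Proof.
have h12 : 0 < (1 / 2 : R) < 1 by lra.
apply/eqP; rewrite eq_le -(quantile_le FE) // lexx andbT leNgt; apply/negP => h.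
have [|eta0 eta00 H] := @density_modulus x0 (F x0 - 1 / 2); first by lra.
have := H eta0 (ltW eta00) (lexx _).
have := cdf_mono FE (_ : x0 <= x0 + eta0); rewrite lerDl => /(_ (ltW eta00)).
have : F (x0 - eta0) < 1 / 2.
  rewrite ltNge -(quantile_le FE)// -ltNge; lra.
lra.
Qed.

(** The density is positive at [x0], hence at least [f x0 / 2] nearby, so [F] crosses the level 1/2
    with at least this speed; monotonicity carries the margin from [r] to [eta]. *)
Lemma cdf_median_gap (eta : R) : 0 < eta -> exists2 dl : R, 0 < dl &
  F (x0 - eta) <= 1 / 2 - dl /\ 1 / 2 + dl <= F (x0 + eta).
Proof.
move=> eta0; have [_ fge _] := Ff.
have fx0 : 0 < f x0 by rewrite lt_neqAle eq_sym f0 fge.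
have [||e e0 H] := @density_lower x0 (f x0 / 2); [lra|lra|].
pose r := Num.min (e / 2) eta.
have r0 : 0 < r by rewrite lt_min eta0 divr_gt0.
have [re reta] : r <= e / 2 /\ r <= eta by split; rewrite /r ge_min lexx ?orbT.
exists (f x0 / 2 * r); first by rewrite mulr_gt0// divr_gt0.
have m1 := cdf_mono FE (_ : x0 - eta <= x0 - r).
have m2 := cdf_mono FE (_ : x0 + r <= x0 + eta).
have := H (x0 - r) x0; have := H x0 (x0 + r); rewrite cdf_median.
rewrite (_ : x0 + r - x0 = r); last by ring.
rewrite (_ : x0 - (x0 - r) = r); last by ring.
move=> /(_ _ _ _) h1 /(_ _ _ _) h2.
have {}h1 : f x0 / 2 * r <= F (x0 + r) - 1 / 2 by apply: h1; lra.
have {}h2 : f x0 / 2 * r <= 1 / 2 - F (x0 - r) by apply: h2; lra.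
have {}m1 : F (x0 - eta) <= F (x0 - r) by apply: m1; lra.
have {}m2 : F (x0 + r) <= F (x0 + eta) by apply: m2; lra.
lra.
Qed.

End median.

End density.

(** * Sample errors and their limits *)

Section finite_subfamily.
Context {R : realType} {d : measure_display} {T : measurableType d}.
Context {I : finType} {J : eqType}.
Variables (P : probability T R) (Z : J -> T -> R) (e : I -> J).
Variable mu : I -> probability R R.

Lemma indep_law_subfamily : mutually_independent P Z -> injective e ->
  (forall i, measurable_fun setT (Z (e i))) ->
  (forall i A, measurable A -> P (Z (e i) @^-1` A) = mu i A) ->
  indep_law P (fun i => Z (e i)) mu.
Proof.
move=> indepZ e_inj mZ law; split=> // A mA.
pose A' j := if [pick i | e i == j] is Some i then A i else setT.
have A'e i : A' (e i) = A i.
  by rewrite /A'; case: pickP => [i' /eqP/e_inj->//|/(_ i)]; rewrite eqxx.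
have := indepZ (map e (enum I)) A'; rewrite map_inj_uniq// enum_uniq.
move=> /(_ isT (fun j => _)) H.
rewrite (_ : \bigcap_(i in _) _ = \bigcap_(j in [set` map e (enum I)]) Z j @^-1` A' j).
  rewrite H => [|j]; last by rewrite /A'; case: pickP.
  rewrite big_map big_enum/=; congr EFin; apply: eq_bigr => i _.
  by rewrite A'e law.
apply/seteqP; split => w Hw.
  by move=> _ /= /mapP[i _ ->]; rewrite A'e; exact: Hw.
move=> i _; have := Hw (e i); rewrite /= A'e; apply.
by apply/mapP; exists i => //; rewrite mem_enum.
Qed.

End finite_subfamily.

Section two_samples_law.
Context {R : realType} {d : measure_display} {Omega : measurableType d}.
Variables (P : probability Omega R) (X Y : nat -> {RV P >-> R}) (F G : R -> R).
Hypotheses (cdfX : forall i x, cdf (X i) x = (F x)%:E).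
Hypotheses (cdfY : forall j x, cdf (Y j) x = (G x)%:E).
Hypothesis indepXY : mutually_independent P (two_samples X Y).

Lemma indep_data n m : indep_law P (@data R d Omega n m X Y)
  (fun i => if i is inl _ then distribution P (X 0%N) else distribution P (Y 0%N)).
Proof.
pose e (i : 'I_n + 'I_m) : nat + nat :=
  match i with inl a => inl (val a) | inr b => inr (val b) end.
have -> : @data R d Omega n m X Y = fun i => two_samples X Y (e i).
  by apply/funext => -[].
apply: indep_law_subfamily => //.
- by move=> [a|b] [a'|b'] //= [/val_inj->].
- by case=> [a|b] /=.
- case=> [a|b] A mA /=.
    apply: (@eq_measure_ray _ (distribution P (X a))) => // x.
    by rewrite -[LHS]/(cdf (X a) x) -[RHS]/(cdf (X 0%N) x) !cdfX.
  apply: (@eq_measure_ray _ (distribution P (Y b))) => // x.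
  by rewrite -[LHS]/(cdf (Y b) x) -[RHS]/(cdf (Y 0%N) x) !cdfY.
Qed.

End two_samples_law.

(** * Linear combinations of the two kernels and the limiting variance *)

Section comb_kernel.
Context {R : realType}.
Variables (x0 a b : R).
Local Notation ok := (overlap_kernel x0).

(** Cramer-Wold device: a linear combination of the two U-statistics is the U-statistic of one
    bounded kernel, so a one-dimensional cosine bound controls the joint law. *)
Definition comb_kernel (z : R * R) : R := a * rel_kernel z + b * ok z.

Lemma comb_kernel_le z : `|comb_kernel z| <= `|a| + 2 * `|b|.
Proof.
rewrite (le_trans (ler_normD _ _))// (normrM a) (normrM b) (mulrC 2 `|b|).
apply: lerD; first by rewrite ler_piMr// rel_kernel_le.
by rewrite ler_wpM2l// overlap_kernel_le.
Qed.

Lemma bmfun_rel_kernel_id : bmfun (@rel_kernel R).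
Proof.
apply: (eq_bmfun (g := fun z : R * R => rel_kernel (z.1, z.2))); first by case.
by apply: bmfun_rel_kernel.
Qed.

Lemma bmfun_overlap_kernel_id : bmfun ok.
Proof.
apply: (eq_bmfun (g := fun z : R * R => ok (z.1, z.2))); first by case.
by apply: bmfun_overlap_kernel.
Qed.

Lemma bmfun_comb_kernel : bmfun comb_kernel.
Proof.
apply: bmfunD; apply: bmfunZ; [exact: bmfun_rel_kernel_id|exact: bmfun_overlap_kernel_id].
Qed.

Variables mu rho : probability R R.

Lemma proj1_comb x :
  proj1 rho comb_kernel x = a * proj1 rho rel_kernel x + b * proj1 rho ok x.
Proof.
have b1 := bmfun_kx bmfun_rel_kernel_id x; have b2 := bmfun_kx bmfun_overlap_kernel_id x.
by rewrite /proj1 (meanD rho (bmfunZ a b1) (bmfunZ b b2)) (meanZ rho a b1) (meanZ rho b b2).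
Qed.

Lemma proj2_comb y :
  proj2 mu comb_kernel y = a * proj2 mu rel_kernel y + b * proj2 mu ok y.
Proof.
have b1 := bmfun_ky bmfun_rel_kernel_id y; have b2 := bmfun_ky bmfun_overlap_kernel_id y.
by rewrite /proj2 (meanD mu (bmfunZ a b1) (bmfunZ b b2)) (meanZ mu a b1) (meanZ mu b b2).
Qed.

Lemma theta_comb :
  theta mu rho comb_kernel = a * theta mu rho rel_kernel + b * theta mu rho ok.
Proof.
have b1 := bmfun_proj1 mu rho bmfun_rel_kernel_id.
have b2 := bmfun_proj1 mu rho bmfun_overlap_kernel_id.
rewrite /theta; under eq_mean do rewrite proj1_comb.
by rewrite (meanD mu (bmfunZ a b1) (bmfunZ b b2)) (meanZ mu a b1) (meanZ mu b b2).
Qed.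

Lemma ustat_comb (I : finType) d (T : measurableType d) (Z : I -> T -> R) n m
    (p : 'I_n -> I) (q : 'I_m -> I) w :
  ustat Z p q comb_kernel w = a * ustat Z p q rel_kernel w + b * ustat Z p q ok w.
Proof.
rewrite /ustat; set c := (_ * _)^-1.
transitivity (c * (a * (\sum_i \sum_j rel_kernel (Z (p i) w, Z (q j) w)) +
    b * (\sum_i \sum_j ok (Z (p i) w, Z (q j) w)))); last by ring.
congr (_ * _); rewrite !mulr_sumr -big_split/=; apply: eq_bigr => i _.
by rewrite !mulr_sumr -big_split.
Qed.

Lemma mean_sqr_comb (f1 f2 : R -> R) : bmfun f1 -> bmfun f2 ->
  mean mu (fun x => (a * f1 x + b * f2 x) ^+ 2) =
  a ^+ 2 * mean mu (fun x => f1 x ^+ 2) + 2 * a * b * mean mu (fun x => f1 x * f2 x) +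
  b ^+ 2 * mean mu (fun x => f2 x ^+ 2).
Proof.
move=> b1 b2; have c1 := bmfunX 2 b1; have c2 := bmfunX 2 b2; have c12 := bmfunM b1 b2.
rewrite (@eq_mean _ _ _ mu _ (fun x => (a ^+ 2 * f1 x ^+ 2 + 2 * a * b * (f1 x * f2 x)) +
   b ^+ 2 * f2 x ^+ 2)); last by move=> x; ring.
rewrite (meanD mu (bmfunD (bmfunZ _ c1) (bmfunZ _ c12)) (bmfunZ _ c2)).
by rewrite (meanD mu (bmfunZ _ c1) (bmfunZ _ c12)) (meanZ mu _ c1) (meanZ mu _ c12) (meanZ mu _ c2).
Qed.

End comb_kernel.

Section limit_variance.
Context {R : realType}.
Implicit Types (mu rho : probability R R) (k : R * R -> R).

Definition var1 mu rho k := mean mu (fun x => (proj1 rho k x - theta mu rho k) ^+ 2).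
Definition var2 mu rho k := mean rho (fun y => (proj2 mu k y - theta mu rho k) ^+ 2).
Definition limit_var mu rho (nu : R) k := var1 mu rho k + nu * var2 mu rho k.

Lemma limit_var_ge0 mu rho nu k : 0 <= nu -> 0 <= limit_var mu rho nu k.
Proof. by move=> nu0; rewrite addr_ge0 ?mulr_ge0 ?mean_ge0// => x; exact: sqr_ge0. Qed.

Lemma var2_le mu rho k (B : R) : bmfun k -> (forall z, `|k z| <= B) ->
  var2 mu rho k <= (2 * B) ^+ 2.
Proof.
move=> bk kB; apply: le_mean_cst.
  by apply: bmfunX; apply: bmfunB (bmfun_cst _); exact: bmfun_proj2.
move=> y; rewrite -[leLHS]real_normK ?num_real//.
have B0 : 0 <= B := le_trans (normr_ge0 _) (kB 0).
rewrite lerXn2r ?nnegrE ?mulr_ge0// (le_trans (ler_normB _ _))//.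
have := proj2_le mu bk kB y; have := theta_le mu rho bk kB; lra.
Qed.

Let subr_comb (a b u v u' v' : R) : a * u + b * v - (a * u' + b * v') = a * (u - u') + b * (v - v').
Proof. by ring. Qed.

Let quad_comb (a b nu u1 u2 u3 v1 v2 v3 : R) :
  a ^+ 2 * u1 + 2 * a * b * u2 + b ^+ 2 * u3 +
  nu * (a ^+ 2 * v1 + 2 * a * b * v2 + b ^+ 2 * v3) =
  a ^+ 2 * (u1 + nu * v1) + 2 * a * b * (u2 + nu * v2) + b ^+ 2 * (u3 + nu * v3).
Proof. by ring. Qed.

(** Projections and [theta] are linear in the kernel, so the variance is a quadratic form in (a, b);
    its coefficients are the covariances handed to [gaussian_law_exists]. *)
Lemma limit_var_comb mu rho nu x0 : exists s : R * R * R, forall a b,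
  limit_var mu rho nu (comb_kernel x0 a b) =
  a ^+ 2 * s.1.1 + 2 * a * b * s.1.2 + b ^+ 2 * s.2.
Proof.
pose p1 k x := proj1 rho k x - theta mu rho k.
pose p2 k y := proj2 mu k y - theta mu rho k.
pose ok := overlap_kernel x0; pose rk := @rel_kernel R.
have bk1 := @bmfun_rel_kernel_id R; have bk2 := bmfun_overlap_kernel_id x0.
have b1 k : bmfun k -> bmfun (p1 k).
  by move=> bk; apply: bmfunB (bmfun_cst _); exact: (bmfun_proj1 mu rho bk).
have b2 k : bmfun k -> bmfun (p2 k).
  by move=> bk; apply: bmfunB (bmfun_cst _); exact: bmfun_proj2.
exists (mean mu (fun x => p1 rk x ^+ 2) + nu * mean rho (fun y => p2 rk y ^+ 2),
  mean mu (fun x => p1 rk x * p1 ok x) + nu * mean rho (fun y => p2 rk y * p2 ok y),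
  mean mu (fun x => p1 ok x ^+ 2) + nu * mean rho (fun y => p2 ok y ^+ 2)) => a b /=.
rewrite /limit_var.
have -> : var1 mu rho (comb_kernel x0 a b) = mean mu (fun x => (a * p1 rk x + b * p1 ok x) ^+ 2).
  apply: eq_mean => x; rewrite proj1_comb theta_comb; congr (_ ^+ 2).
  by rewrite /p1; exact: subr_comb.
have -> : var2 mu rho (comb_kernel x0 a b) = mean rho (fun x => (a * p2 rk x + b * p2 ok x) ^+ 2).
  apply: eq_mean => x; rewrite proj2_comb theta_comb; congr (_ ^+ 2).
  by rewrite /p2; exact: subr_comb.
rewrite (mean_sqr_comb a b mu (b1 _ bk1) (b1 _ bk2)).
rewrite (mean_sqr_comb a b rho (b2 _ bk1) (b2 _ bk2)).
exact: quad_comb.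
Qed.

End limit_variance.

Section two_sample_levy.
Context {R : realType}.

(** One of the two extra terms exceeds 2 as soon as a condition of [ustat_clt] fails, and 2 bounds
    the error trivially; the estimate then holds for all positive sample sizes. *)
Definition cos_error (n m : nat) (B : R) : R := @clt_error R n m B +
  4 * B * Num.sqrt n%:R / n%:R + 4 * B * Num.sqrt n%:R / m%:R.

Lemma expRN_lipschitz (a b : R) : 0 <= a -> 0 <= b -> `|expR (- a) - expR (- b)| <= `|a - b|.
Proof.
wlog ab : a b / a <= b.
  move=> H a0 b0; case: (leP a b) => h; first exact: H.
  by rewrite distrC [leRHS]distrC; apply: H => //; exact: ltW.
move=> a0 b0; rewrite ger0_norm; last by rewrite subr_ge0 ler_expR lerN2.
rewrite distrC ger0_norm ?subr_ge0//.
have := expR_ge1Dx (a - b); have := expR_gt0 (- a) => p q.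
have : expR (- b) = expR (- a) * expR (a - b) by rewrite -expRD; congr expR; ring.
have : expR (- a) <= 1 by rewrite -expR0 ler_expR; lra.
move=> s ->; rewrite -{1}[expR (- a)]mulr1 -mulrBr.
have [h|h] := leP (1 - expR (a - b)) 0; last by nra.
rewrite (@le_trans _ _ 0)//; last by lra.
by rewrite mulr_ge0_le0// ltW.
Qed.

Section fixed.
Context {d : measure_display} {T : measurableType d} {n m : nat}.
Variables (P : probability T R) (Z : 'I_n + 'I_m -> T -> R) (mu rho : probability R R).
Hypothesis indepZ : indep_law P Z (fun i => if i is inl _ then mu else rho).
Hypotheses (n0 : (0 < n)%N) (m0 : (0 < m)%N).

Definition ustat_error k w : R := Num.sqrt n%:R * (ustat Z inl inr k w - theta mu rho k).

Lemma bmfun_ustat_error k : bmfun k -> bmfun (ustat_error k).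
Proof. by move=> bk; apply: bmfunZ; apply: bmfunB (bmfun_cst _); exact: (bmfun_ustat indepZ). Qed.

(** The target variance [s] is free, because given the data the actual variance is random; the
    exponential is Lipschitz in it. *)
Lemma cos_error_le k (B s c : R) : bmfun k -> (forall z, `|k z| <= B) -> 0 <= s ->
  `|mean P (fun w => cos (ustat_error k w + c)) - expR (- (s / 2)) * cos c| <=
  cos_error n m B + `|limit_var mu rho (n%:R / m%:R) k - s| / 2.
Proof.
move=> bk kB s0; have B0 : 0 <= B := le_trans (normr_ge0 _) (kB 0).
have nn : 0 < n%:R :> R by rewrite ltr0n.
have mm : 0 < m%:R :> R by rewrite ltr0n.
have r0 : 0 <= Num.sqrt n%:R :> R by exact: sqrtr_ge0.
set lv := limit_var _ _ _ _.
have lv0 : 0 <= lv by apply: limit_var_ge0; rewrite divr_ge0.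
have clt0 : 0 <= @clt_error R n m B.
  by rewrite !addr_ge0 ?mulr_ge0 ?exprn_ge0 ?divr_ge0 ?mulr_ge0 ?invr_ge0 ?sqrtr_ge0.
have e1 : 0 <= 4 * B * Num.sqrt n%:R / n%:R by rewrite divr_ge0 ?mulr_ge0.
have e2 : 0 <= 4 * B * Num.sqrt n%:R / m%:R by rewrite divr_ge0 ?mulr_ge0.
have bc : bmfun (fun w => cos (ustat_error k w + c)).
  by apply/bmfun_cos/bmfun_meas/bmfunD; [exact: bmfun_ustat_error|exact: bmfun_cst].
have crude : `|mean P (fun w => cos (ustat_error k w + c)) - expR (- (lv / 2)) * cos c| <= 2.
  rewrite (le_trans (ler_normB _ _))// (_ : 2 = 1 + 1 :> R); last by ring.
  rewrite lerD//; first by apply: norm_mean_le => // w; exact: cos_max.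
  rewrite normrM (ger0_norm (expR_ge0 _)) mulr_ile1 ?expR_ge0 ?cos_max//.
  by rewrite -expR0 ler_expR oppr_le0 divr_ge0.
have main : `|mean P (fun w => cos (ustat_error k w + c)) - expR (- (lv / 2)) * cos c| <=
    cos_error n m B.
  rewrite /cos_error -/lv.
  have [h1|h1] := leP (2 * B * Num.sqrt n%:R / n%:R) 1; last first.
    by rewrite (le_trans crude)//; lra.
  have [h2|h2] := leP (2 * B * Num.sqrt n%:R / m%:R) 1; last first.
    by rewrite (le_trans crude)//; lra.
  have := ustat_clt indepZ n0 m0 bk kB c h1 h2.
  rewrite -[asym_var _ _ _]/lv -[X in mean P X]/(fun w => cos (ustat_error k w + c)).
  lra.
rewrite (_ : _ - _ = (mean P (fun w => cos (ustat_error k w + c)) - expR (- (lv / 2)) * cos c)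
  + (expR (- (lv / 2)) - expR (- (s / 2))) * cos c); last by ring.
rewrite (le_trans (ler_normD _ _))// lerD// normrM.
apply: (@le_trans _ _ `|expR (- (lv / 2)) - expR (- (s / 2))|).
  by rewrite ler_piMr// cos_max.
rewrite (le_trans (expRN_lipschitz _ _)) ?divr_ge0//.
by rewrite -mulrBl normrM [`|2^-1|]ger0_norm.
Qed.

End fixed.

Variables (L : probability (R * R)%type R) (Q : R -> R -> R).
Hypothesis charL : forall a b c,
  mean L (fun z => cos (a * z.1 + b * z.2 + c)) = expR (- (Q a b / 2)) * cos c.
Hypothesis Q0 : forall a b, 0 <= Q a b.

Lemma two_sample_levy (h : R * R -> R) (nu e : R) : bounded_continuous h -> 0 <= nu -> 0 < e ->
  exists2 C, 0 <= C & exists l : seq (R * R * R * R),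
  forall n m d (T : measurableType d) (P : probability T R) (Z : 'I_n + 'I_m -> T -> R)
    (mu rho : probability R R) x0 (Z1 Z2 : T -> R),
    indep_law P Z (fun i => if i is inl _ then mu else rho) ->
    (0 < n)%N -> (0 < m)%N -> n%:R / m%:R <= nu -> bmfun Z1 -> bmfun Z2 ->
  `|mean P (fun w => h (Z1 w, Z2 w)) - mean L h| <=
    e + C * mean P (fun w => `|Z1 w - ustat_error Z mu rho rel_kernel w| +
                            `|Z2 w - ustat_error Z mu rho (overlap_kernel x0) w|) +
    \sum_(t <- l) `|t.1.1.1| * (cos_error n m (`|t.1.1.2| + 2 * `|t.1.2|) +
      `|limit_var mu rho (n%:R / m%:R) (comb_kernel x0 t.1.1.2 t.1.2) - Q t.1.1.2 t.1.2| / 2).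
Proof.
move=> bh nu0 e0.
(* [mean_sqr_ustat] with B = 1 for the first kernel and B = 2 for the second: 12 + 48 = 60. *)
have V0 : 0 <= 60 * (5 + nu) by rewrite mulr_ge0// addr_ge0.
have [C C0 [l Hl]] := levy_bound charL bh V0 e0; exists C => //; exists l.
move=> n m d T P Z mu rho x0 Z1 Z2 indepZ n0 m0 nmnu b1 b2.
have bk1 := @bmfun_rel_kernel_id R; have bk2 := bmfun_overlap_kernel_id x0.
have bU1 := bmfun_ustat_error indepZ bk1; have bU2 := bmfun_ustat_error indepZ bk2.
apply: le_trans (Hl _ _ P Z1 Z2 _ _ b1 b2 bU1 bU2 _) _.
  rewrite meanD; [|exact: bmfunX..].
  apply: le_trans (lerD (mean_sqr_ustat indepZ n0 m0 bk1 (@rel_kernel_le R))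
    (mean_sqr_ustat indepZ n0 m0 bk2 (overlap_kernel_le x0))) _.
  by move: (n%:R / m%:R) nmnu => v vnu; lra.
rewrite lerD2l; apply: ler_sum => t _; apply: ler_wpM2l => //.
set a := t.1.1.2; set b := t.1.2.
have := cos_error_le indepZ n0 m0 t.2 (bmfun_comb_kernel x0 a b)
  (comb_kernel_le x0 a b) (Q0 a b).
apply: le_trans; rewrite le_eqVlt; apply/orP; left; apply/eqP.
congr (`|_ - _|); apply: eq_mean => w; congr (cos (_ + _)).
rewrite /ustat_error ustat_comb theta_comb; ring.
Qed.

End two_sample_levy.

(** * Limits along the sequences of sample sizes *)

Section along.
Context {R : realType}.
Variables (n m : nat -> nat) (nu : R).
Hypotheses (n_oo : n @ \oo --> \oo) (m_oo : m @ \oo --> \oo).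
Hypothesis nm_nu : (n k)%:R / (m k)%:R @[k --> \oo] --> nu.

Lemma near_ge_size (p : nat -> nat) (r : R) : p @ \oo --> \oo -> \forall k \near \oo, r <= (p k)%:R.
Proof. by move=> p_oo; exact: (p_oo _ (nbhs_infty_ger r)). Qed.

Lemma near_size_gt0 (p : nat -> nat) : p @ \oo --> \oo -> \forall k \near \oo, (0 < p k)%N.
Proof. by move=> p_oo; exact: (p_oo _ (nbhs_infty_gt 0)). Qed.

Lemma cvg_inv_sqrt (p : nat -> nat) : p @ \oo --> \oo ->
  (Num.sqrt (p k)%:R)^-1 @[k --> \oo] --> (0 : R).
Proof.
move=> p_oo; apply/cvgrPdist_le => /= e e0; near=> k.
rewrite sub0r normrN ger0_norm ?invr_ge0 ?sqrtr_ge0//.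
have h : e ^- 2 <= (p k)%:R by near: k; exact: near_ge_size.
have e20 : 0 < e ^- 2 by rewrite invr_gt0 exprn_gt0.
rewrite -[e]invrK lef_pV2 ?posrE ?invr_gt0 ?sqrtr_gt0 ?(lt_le_trans e20 h)//.
rewrite -(@ger0_norm _ e^-1) ?invr_ge0 ?(ltW e0)// -sqrtr_sqr.
by rewrite ler_sqrt ?exprVn// (le_trans _ h)// ltW.
Unshelve. all: by end_near.
Qed.

Lemma cvg_cos_error (B : R) : (@cos_error R (n k) (m k) B) @[k --> \oo] --> (0 : R).
Proof.
pose u k : R := (Num.sqrt (n k)%:R)^-1; pose v k : R := (Num.sqrt (m k)%:R)^-1.
pose w k : R := (n k)%:R / (m k)%:R.
have u0 : u k @[k --> \oo] --> (0 : R) by exact: cvg_inv_sqrt.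
have v0 : v k @[k --> \oo] --> (0 : R) by exact: cvg_inv_sqrt.
(* [cos_error] rewritten with u = n^(-1/2), v = m^(-1/2) and w = n/m; the second cube becomes 8 B^3
   w^2 u. *)
have lim : (8 * B ^+ 3 * u k + 8 * B ^+ 3 * w k * w k * u k + 4 * B * v k +
  4 * B * u k + 4 * B * w k * u k) @[k --> \oo] --> (0 : R).
  have -> : (0 : R) = 8 * B ^+ 3 * 0 + 8 * B ^+ 3 * nu * nu * 0 + 4 * B * 0 + 4 * B * 0 +
    4 * B * nu * 0 by ring.
  have lc (c l : R) (f : nat -> R) : f k @[k --> \oo] --> l -> c * f k @[k --> \oo] --> c * l.
    exact: (cvgM (cvg_cst c)).
  have h1 := lc (8 * B ^+ 3) _ _ u0.
  have h2 := cvgM (cvgM (lc (8 * B ^+ 3) _ _ nm_nu) nm_nu) u0.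
  have h3 := lc (4 * B) _ _ v0; have h4 := lc (4 * B) _ _ u0.
  have h5 := cvgM (lc (4 * B) _ _ nm_nu) u0.
  apply: cvgD; last exact: h5.
  apply: cvgD; last exact: h4.
  apply: cvgD; last exact: h3.
  by apply: cvgD; [exact: h1|exact: h2].
apply: cvg_trans lim; apply: near_eq_cvg; near=> k.
have nk : (0 < n k)%N by near: k; exact: near_size_gt0.
have mk : (0 < m k)%N by near: k; exact: near_size_gt0.
rewrite /cos_error /clt_error /u /v /w.
have rn : 0 < Num.sqrt (n k)%:R :> R by rewrite sqrtr_gt0 ltr0n.
have rm : 0 < Num.sqrt (m k)%:R :> R by rewrite sqrtr_gt0 ltr0n.
have nE := sqr_sqrtr (ler0n R (n k)); have mE := sqr_sqrtr (ler0n R (m k)).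
move: rn rm nE mE; set rn := Num.sqrt _; set rm := Num.sqrt _ => rn0 rm0 <- <-.
clearbody rn rm; field; rewrite !gt_eqF//.
Unshelve. all: by end_near.
Qed.

Section gap_limit.
Context {d : measure_display} {T : measurableType d} (P : probability T R).
Variables (F G f g : R -> R) (mu : probability R R).
Hypothesis FE : forall x, fine (mu `]-oo, x]%classic) = F x.
Hypotheses (densF : continuous_density F f) (densG : continuous_density G g).
Hypothesis f0 : f (quantile F (1 / 2)) != 0.
Local Notation x0 := (quantile F (1 / 2)).
Variables (x y : nat -> nat -> T -> R) (K : R).
Hypotheses (mx : forall k i, measurable_fun setT (x k i)).
Hypotheses (my : forall k j, measurable_fun setT (y k j)).
Hypotheses (FK : forall k z, (0 < n k)%N -> (0 < m k)%N ->
  mean P (fun w => (ecdf (n k) ((x k)^~ w) z - F z) ^+ 2) <= K / (n k)%:R).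
Hypotheses (GK : forall k z, (0 < n k)%N -> (0 < m k)%N ->
  mean P (fun w => ecdf (m k) ((y k)^~ w) z) = G z).

(** The order of choices matters: [s] makes 4 K s <= e/2 whatever n is, then [eta] makes the
    oscillation of [G] at most [q], with 2/s times q + q equal to e/2; this fixes the margin [dl],
    and n is taken large last. *)
Lemma near_mean_ecdf_gap (e : R) : 0 < e -> \forall k \near \oo,
  mean P (fun w => Num.sqrt (n k)%:R * ecdf_gap (n k) (m k) x0 ((x k)^~ w) ((y k)^~ w)) <= e.
Proof.
move=> e0.
have K1 : 0 < `|K| + 1 by rewrite ltr_wpDl.
pose s := e / (8 * (`|K| + 1)).
have s0 : 0 < s by rewrite divr_gt0 ?mulr_gt0.
pose q := e * s / 8.
have q0 : 0 < q by rewrite divr_gt0 ?mulr_gt0.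
have [eta eta0 Hq] := density_modulus densG x0 q0.
have [dl dl0 [Flo Fhi]] := cdf_median_gap densF FE f0 eta0.
have dn0 : 0 < dl ^+ 2 * q by rewrite mulr_gt0 ?exprn_gt0.
near=> k.
have nk : (0 < n k)%N by near: k; exact: near_size_gt0.
have mk : (0 < m k)%N by near: k; exact: near_size_gt0.
have nb : 2 * `|K| / (dl ^+ 2 * q) <= (n k)%:R by near: k; exact: near_ge_size.
have nn : 0 < (n k)%:R :> R by rewrite ltr0n.
have := @mean_ecdf_gap R d T P (n k) (m k) (x k) (y k) (fun i _ => mx k i) (fun j _ => my k j)
  nk mk x0 F G K (cdf_median densF FE) (fun z => FK z nk mk) (fun z => GK z nk mk)
  eta dl s (ltW eta0) dl0 s0 Flo Fhi.
move=> /le_trans; apply.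
have h1 : 4 * K * s <= e / 2.
  apply: (@le_trans _ _ (4 * (`|K| + 1) * s)).
    by rewrite ler_pM2r// ler_pM2l//; have := ler_norm K; lra.
  by rewrite /s le_eqVlt; apply/orP; left; apply/eqP; field; rewrite gt_eqF.
have h2 : 2 * K / (dl ^+ 2 * (n k)%:R) <= q.
  rewrite ler_pdivrMr ?mulr_gt0 ?exprn_gt0//.
  move: nb; rewrite ler_pdivrMr// => nb.
  by have := ler_norm K; lra.
have h3 := Hq eta (ltW eta0) (lexx _).
apply: (@le_trans _ _ (e / 2 + 2 / s * (q + q))).
  by rewrite lerD// ler_pM2l ?divr_gt0// lerD.
by rewrite /q le_eqVlt; apply/orP; left; apply/eqP; field; rewrite gt_eqF.
Unshelve. all: by end_near.
Qed.

End gap_limit.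

End along.

Section finite_samples.
Context {R : realType} {n m : nat}.
Local Notation I := ('I_n + 'I_m)%type.

(** [ecdf n] expects a sequence; the filling value 0 beyond the sample size is never read. *)
Definition ext1 (z : I -> R) (k : nat) : R := if insub k is Some a then z (inl a) else 0.
Definition ext2 (z : I -> R) (k : nat) : R := if insub k is Some b then z (inr b) else 0.

Lemma ext1E z (a : 'I_n) : ext1 z a = z (inl a). Proof. by rewrite /ext1 valK. Qed.
Lemma ext2E z (b : 'I_m) : ext2 z b = z (inr b). Proof. by rewrite /ext2 valK. Qed.

Lemma eq_ecdf p (x x' : nat -> R) : (forall i : 'I_p, x i = x' i) -> ecdf p x = ecdf p x'.
Proof.
move=> xx'; apply/funext => c; congr (_ * _); apply: eq_bigr => i _.
by rewrite xx'.
Qed.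

Lemma ecdf_ext1 x y : ecdf n (ext1 (sample x y)) = ecdf n x.
Proof. by apply: eq_ecdf => i; rewrite ext1E. Qed.

Lemma ecdf_ext2 x y : ecdf m (ext2 (sample x y)) = ecdf m y.
Proof. by apply: eq_ecdf => i; rewrite ext2E. Qed.

Definition sample_gap (x0 : R) (z : I -> R) : R := ecdf_gap n m x0 (ext1 z) (ext2 z).

Lemma sample_gapE x0 x y : sample_gap x0 (sample x y) = ecdf_gap n m x0 x y.
Proof.
rewrite /sample_gap /ecdf_gap ecdf_ext1 ecdf_ext2; congr (2 * (_ * _) - _).
by apply: eq_bigr => i _; rewrite ext1E.
Qed.

Definition sample_error (F G : R -> R) (z : I -> R) : R * R :=
  rescaled_error n (ecdf n (ext1 z)) (ecdf m (ext2 z)) F G.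

Section measurability.
Context {d : measure_display} {T : measurableType d} (Z : I -> T -> R).
Hypothesis mZ : forall i, measurable_fun setT (Z i).

Lemma measurable_ext1 k : measurable_fun setT (fun w => ext1 (Z^~ w) k).
Proof. by rewrite /ext1; case: insub => [a|]; [exact: mZ|exact: measurable_cst]. Qed.

Lemma measurable_ext2 k : measurable_fun setT (fun w => ext2 (Z^~ w) k).
Proof. by rewrite /ext2; case: insub => [a|]; [exact: mZ|exact: measurable_cst]. Qed.

Hypotheses (n0 : (0 < n)%N) (m0 : (0 < m)%N).

Lemma bmfun_sample_gap x0 : bmfun (fun w => sample_gap x0 (Z^~ w)).
Proof.
apply: (bmfun_ecdf_gap (x := fun k w => ext1 (Z^~ w) k) (y := fun k w => ext2 (Z^~ w) k)) => //.
  by move=> i _; exact: measurable_ext1.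
by move=> i _; exact: measurable_ext2.
Qed.

Lemma bmfun_sample_rel_effect :
  bmfun (fun w => rel_effect (ecdf n (ext1 (Z^~ w))) (ecdf m (ext2 (Z^~ w)))).
Proof.
apply: (bmfun_rel_effect_ecdf (x := fun k w => ext1 (Z^~ w) k) (y := fun k w => ext2 (Z^~ w) k)) => //.
  by move=> i _; exact: measurable_ext1.
by move=> i _; exact: measurable_ext2.
Qed.

Lemma bmfun_sample_overlap :
  bmfun (fun w => overlap_index (ecdf n (ext1 (Z^~ w))) (ecdf m (ext2 (Z^~ w)))).
Proof.
apply: (bmfun_overlap_ecdf (x := fun k w => ext1 (Z^~ w) k) (y := fun k w => ext2 (Z^~ w) k)) => //.
  by move=> i _; exact: measurable_ext1.
by move=> i _; exact: measurable_ext2.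
Qed.

End measurability.

Hypotheses (n0 : (0 < n)%N) (m0 : (0 < m)%N).
Context {d : measure_display} {T : measurableType d}.
Variables (P : probability T R) (Z : I -> T -> R) (mu rho : probability R R) (F G : R -> R).
Hypothesis indepZ : indep_law P Z (fun i => if i is inl _ then mu else rho).
Hypothesis FE : forall x, fine (mu `]-oo, x]%classic) = F x.
Hypothesis GE : forall x, fine (rho `]-oo, x]%classic) = G x.
Variable x0 : R.

(** Zero when [x0] is a median of [F]. The bootstrap takes the empirical laws as its population, and
    there it is the [ecdf_gap] of the data. *)
Definition population_gap : R := theta mu rho (overlap_kernel x0) - overlap_index F G.

Lemma population_gap_ge0 : 0 <= population_gap.
Proof.
rewrite subr_ge0 (theta_overlap_kernel mu GE).
by apply: (overlap_le FE) => [a b|]; [exact: (cdf_mono GE)|exact: (cdf_bounds GE)].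
Qed.

Lemma population_gap_median : F x0 = 1 / 2 -> population_gap = 0.
Proof.
move=> Fx0; apply/eqP; rewrite eq_le population_gap_ge0 andbT.
rewrite /population_gap (theta_overlap_kernel mu GE).
have Gm : {homo G : a b / a <= b} by exact: (cdf_mono GE).
have G01 := cdf_bounds GE.
apply: le_trans (overlap_gap_le (kappa := 1) (x0 := x0) FE Gm G01 (lexx 0) _ _) _ => //.
  by move=> _; rewrite addr0 subr0 subrr.
by rewrite Fx0 (_ : 2 * (1 / 2) - 1 = 0 :> R) ?normr0 ?mulr0//; field.
Qed.

Lemma sample_gap_ge0 z : 0 <= sample_gap x0 z.
Proof. by have /andP[] := ecdf_gap_bounds n0 m0 x0 (ext1 z) (ext2 z) (lexx 0). Qed.

Lemma sample_rel_error w : (sample_error F G (Z^~ w)).1 = ustat_error Z mu rho rel_kernel w.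
Proof.
rewrite /= /ustat_error rel_effect_ecdf// (theta_rel_kernel GE FE).
congr (_ * (_ * _ - _)); apply: eq_bigr => i _; apply: eq_bigr => j _.
by rewrite ext1E ext2E.
Qed.

Lemma sample_overlap_error w :
  (sample_error F G (Z^~ w)).2 - ustat_error Z mu rho (overlap_kernel x0) w =
  Num.sqrt n%:R * (population_gap - sample_gap x0 (Z^~ w)).
Proof.
rewrite /= /ustat_error /population_gap /sample_gap ecdf_gapE//.
have -> : ustat Z inl inr (overlap_kernel x0) w = (n%:R * m%:R)^-1 *
    \sum_(i < n) \sum_(j < m) overlap_kernel x0 (ext1 (Z^~ w) i, ext2 (Z^~ w) j).
  congr (_ * _); apply: eq_bigr => i _; apply: eq_bigr => j _.
  by rewrite ext1E ext2E.
rewrite -mulrBr; congr (_ * _).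
set a := overlap_index _ _; set b := overlap_index _ _; set c := theta _ _ _.
by move: a b c (_ * _) => a b c u; ring.
Qed.

Lemma bmfun_sample_error1 : bmfun (fun w => (sample_error F G (Z^~ w)).1).
Proof.
have [mZ _] := indepZ; apply: bmfunZ; apply: bmfunB (bmfun_cst _).
exact: bmfun_sample_rel_effect.
Qed.

Lemma bmfun_sample_error2 : bmfun (fun w => (sample_error F G (Z^~ w)).2).
Proof.
have [mZ _] := indepZ; apply: bmfunZ; apply: bmfunB (bmfun_cst _).
exact: bmfun_sample_overlap.
Qed.

(** The first coordinate is exactly a U-statistic error; the second differs from one by the sample
    and population gaps, both nonnegative. *)
Lemma mean_sample_error_diff :
  mean P (fun w => `|(sample_error F G (Z^~ w)).1 - ustat_error Z mu rho rel_kernel w| +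
    `|(sample_error F G (Z^~ w)).2 - ustat_error Z mu rho (overlap_kernel x0) w|) <=
  mean P (fun w => Num.sqrt n%:R * sample_gap x0 (Z^~ w)) + Num.sqrt n%:R * population_gap.
Proof.
have [mZ _] := indepZ.
have bg : bmfun (fun w => Num.sqrt n%:R * sample_gap x0 (Z^~ w)).
  by apply: bmfunZ; exact: bmfun_sample_gap.
rewrite -[X in _ + X](mean_cst P) -(meanD P bg (bmfun_cst _)); apply: le_mean.
- apply: bmfunD; apply: bmfun_norm; apply: bmfunB.
  + exact: bmfun_sample_error1.
  + by apply: (bmfun_ustat_error indepZ); exact: bmfun_rel_kernel_id.
  + exact: bmfun_sample_error2.
  + by apply: (bmfun_ustat_error indepZ); exact: bmfun_overlap_kernel_id.
- exact: (bmfunD bg (bmfun_cst _)).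
move=> w; rewrite sample_rel_error subrr normr0 add0r sample_overlap_error.
rewrite normrM (ger0_norm (sqrtr_ge0 _)) -mulrDr ler_wpM2l ?sqrtr_ge0//.
rewrite (le_trans (ler_normB _ _))// addrC.
by rewrite (ger0_norm (sample_gap_ge0 _)) (ger0_norm population_gap_ge0).
Qed.

End finite_samples.

Section sample_levy.
Context {R : realType}.
Variables (L : probability (R * R)%type R) (Q : R -> R -> R).
Hypothesis charL : forall a b c,
  mean L (fun z => cos (a * z.1 + b * z.2 + c)) = expR (- (Q a b / 2)) * cos c.
Hypothesis Q0 : forall a b, 0 <= Q a b.

Definition trig_weight (t : R * R * R * R) : R := `|t.1.1.2| + 2 * `|t.1.2|.

(** [C] and [l] precede the sizes, the laws and the probability space, so the bound can be applied
    to every realisation of the data with the same constants. *)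
Lemma sample_levy (h : R * R -> R) (nu e : R) : bounded_continuous h -> 0 <= nu -> 0 < e ->
  exists2 C, 0 <= C & exists l : seq (R * R * R * R),
  forall n m d (T : measurableType d) (P : probability T R) (Z : 'I_n + 'I_m -> T -> R)
    (mu rho : probability R R) F G x0,
    indep_law P Z (fun i => if i is inl _ then mu else rho) ->
    (forall x, fine (mu `]-oo, x]%classic) = F x) ->
    (forall x, fine (rho `]-oo, x]%classic) = G x) ->
    (0 < n)%N -> (0 < m)%N -> n%:R / m%:R <= nu ->
  `|mean P (fun w => h (sample_error F G (Z^~ w))) - mean L h| <=
    e + C * (mean P (fun w => Num.sqrt n%:R * sample_gap x0 (Z^~ w)) +
             Num.sqrt n%:R * population_gap mu rho F G x0) +
    \sum_(t <- l) `|t.1.1.1| * (cos_error n m (trig_weight t) +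
      `|limit_var mu rho (n%:R / m%:R) (comb_kernel x0 t.1.1.2 t.1.2) - Q t.1.1.2 t.1.2| / 2).
Proof.
move=> bh nu0 e0; have [C C0 [l Hl]] := two_sample_levy charL Q0 bh nu0 e0.
exists C => //; exists l => n m d T P Z mu rho F G x0 indepZ FE GE n0 m0 nmnu.
have b1 := bmfun_sample_error1 n0 m0 F G indepZ.
have b2 := bmfun_sample_error2 n0 m0 F G indepZ.
apply: le_trans (Hl _ _ _ _ P Z mu rho x0 _ _ indepZ n0 m0 nmnu b1 b2) _.
rewrite lerD2r lerD2l; apply: ler_wpM2l => //.
exact: mean_sample_error_diff.
Qed.

End sample_levy.

Section empirical_variance.
Context {R : realType} {d : measure_display} {Omega : measurableType d}.
Variables (P : probability Omega R) (n m : nat) (X Y : nat -> Omega -> R).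
Variables (mu rho : probability R R).
Local Notation I := ('I_n + 'I_m)%type.
Local Notation Z := (@data R d Omega n m X Y).
Hypothesis indepZ : indep_law P Z (fun i : I => if i is inl _ then mu else rho).
Hypotheses (n0 : (0 < n)%N) (m0 : (0 < m)%N).
Variables (k : R * R -> R) (B : R).
Hypotheses (bk : bmfun k) (kB : forall z, `|k z| <= B).
Local Notation emp1 w := (empirical n (X^~ w)).
Local Notation emp2 w := (empirical m (Y^~ w)).
Let k' (z : R * R) := k (z.2, z.1).

Lemma bmfun_swap : bmfun k'.
Proof.
apply: (@bmfun_compr _ _ _ _ _ (fun z : R * R => (z.2, z.1)) k) => //.
by apply: measurable_fun_pair; [exact: measurable_snd|exact: measurable_fst].
Qed.

Lemma var1_empirical w : var1 (emp1 w) (emp2 w) k = var1_hat Z inl inr k w.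
Proof.
rewrite /var1 mean_empirical//; last first.
  by apply: bmfunX; apply: bmfunB (bmfun_cst _); exact: (bmfun_proj1 (emp1 w)).
rewrite theta_empirical//; congr (_ * _); apply: eq_bigr => i _; congr ((_ - _) ^+ 2).
by rewrite /proj1 mean_empirical//; exact: (bmfun_kx bk).
Qed.

(** Exchanging the samples and transposing the kernel turns the second variance component into the
    first, so one estimate of [var1_hat] serves both. *)
Lemma var2_empirical w : var2 (emp1 w) (emp2 w) k = var1_hat Z inr inl k' w.
Proof.
rewrite /var2 mean_empirical//; last first.
  by apply: bmfunX; apply: bmfunB (bmfun_cst _); exact: bmfun_proj2.
rewrite theta_empirical//; congr (_ * _); apply: eq_bigr => i _; congr ((_ - _) ^+ 2).
  by rewrite /proj2 mean_empirical//; exact: (bmfun_ky bk).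
by rewrite /ustat exchange_big/= [n%:R * _]mulrC.
Qed.

Lemma var2_swap : mean rho (fun y => (proj1 mu k' y - theta rho mu k') ^+ 2) = var2 mu rho k.
Proof.
have -> : theta rho mu k' = theta mu rho k by rewrite (@theta_proj2 R mu rho k bk).
by [].
Qed.

Lemma bmfun_limit_var_empirical :
  bmfun (fun w => limit_var (emp1 w) (emp2 w) (n%:R / m%:R) k).
Proof.
apply: bmfunD; last apply: bmfunZ.
  by apply: eq_bmfun => [w|]; [exact: var1_empirical|exact: (bmfun_var1_hat indepZ)].
apply: eq_bmfun => [w|]; first exact: var2_empirical.
by apply: (bmfun_var1_hat indepZ); exact: bmfun_swap.
Qed.

(** L1 control of the conditional variance; replacing n/m by [nu] costs their distance times the
    bound (2 B)^2 of [var2]. *)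
Lemma mean_limit_var_empirical (nu : R) :
  mean P (fun w => `|limit_var (emp1 w) (emp2 w) (n%:R / m%:R) k - limit_var mu rho nu k|) <=
  16 * B ^+ 2 * ((Num.sqrt n%:R)^-1 + (Num.sqrt m%:R)^-1) * (1 + n%:R / m%:R) +
  `|n%:R / m%:R - nu| * (2 * B) ^+ 2.
Proof.
set r := n%:R / m%:R.
have r0 : 0 <= r by rewrite divr_ge0.
have inl_inj : injective (@inl 'I_n 'I_m) by move=> ? ? [].
have inr_inj : injective (@inr 'I_n 'I_m) by move=> ? ? [].
have H1 := mean_norm_var1_hat indepZ n0 m0 inl_inj inr_inj
  (fun _ _ => isT) (fun=> erefl) (fun=> erefl) bk kB.
have H2 := mean_norm_var1_hat indepZ m0 n0 inr_inj inl_inj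
  (fun _ _ => isT) (fun=> erefl) (fun=> erefl) bmfun_swap (fun z => kB (z.2, z.1)).
rewrite var2_swap in H2; rewrite -/(var1 mu rho k) in H1.
set D1 := (fun w => _) in H1; set D2 := (fun w => _) in H2.
have bD1 : bmfun D1.
  by apply: bmfun_norm; apply: bmfunB (bmfun_cst _); exact: (bmfun_var1_hat indepZ).
have bD2 : bmfun D2.
  apply: bmfun_norm; apply: bmfunB (bmfun_cst _); apply: (bmfun_var1_hat indepZ).
  exact: bmfun_swap.
have bE := bmfunD (bmfunD bD1 (bmfunZ r bD2)) (bmfun_cst (`|r - nu| * (2 * B) ^+ 2)).
apply: (@le_trans _ _ (mean P (fun w => (D1 w + r * D2 w) + `|r - nu| * (2 * B) ^+ 2))).
  apply: le_mean => //.
    by apply: bmfun_norm; apply: bmfunB (bmfun_cst _); exact: bmfun_limit_var_empirical.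
  move=> w; rewrite /limit_var var1_empirical var2_empirical /D1 /D2.
  have V2 := var2_le mu rho bk kB; have V20 : 0 <= var2 mu rho k.
    by apply: mean_ge0 => x; exact: sqr_ge0.
  move: V2 V20; move: (var1_hat _ _ _ _ _) (var1_hat _ _ _ _ _) => b a.
  move: (var1 _ _ _) (var2 _ _ _) => a' b' V2 V20.
  rewrite (_ : _ - _ = (a - a') + r * (b - b') + (r - nu) * b'); last by ring.
  rewrite (le_trans (ler_normD _ _))// lerD//.
    by rewrite (le_trans (ler_normD _ _))// lerD// normrM ger0_norm.
  by rewrite normrM (ger0_norm V20) ler_wpM2l.
rewrite (meanD P (bmfunD bD1 (bmfunZ r bD2)) (bmfun_cst _)) (meanD P bD1 (bmfunZ r bD2)).
rewrite (meanZ P r bD2) mean_cst lerD2r.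
apply: le_trans (lerD H1 (ler_wpM2l r0 H2)) _.
rewrite le_eqVlt; apply/orP; left; apply/eqP.
by move: (Num.sqrt n%:R)^-1 (Num.sqrt m%:R)^-1 => u v; ring.
Qed.

End empirical_variance.

(** * Conditional laws of the bootstrap errors *)

Section ecdf_moments.
Context {R : realType} {n m : nat}.
Local Notation I := ('I_n + 'I_m)%type.
Context {d : measure_display} {T : measurableType d}.
Variables (P : probability T R) (Z : I -> T -> R) (mu rho : probability R R) (F G : R -> R).
Hypothesis indepZ : indep_law P Z (fun i => if i is inl _ then mu else rho).
Hypothesis FE : forall x, fine (mu `]-oo, x]%classic) = F x.
Hypothesis GE : forall x, fine (rho `]-oo, x]%classic) = G x.
Hypotheses (n0 : (0 < n)%N) (m0 : (0 < m)%N).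

Let bray (c : R) : bmfun (fun x : R => (x <= c)%R%:R : R).
Proof. exact: (bmfun_rel_kernel (measurable_cst c) (@measurable_id _ R setT)). Qed.

Lemma mean_sqr_ecdf c : mean P (fun w => (ecdf n (ext1 (Z^~ w)) c - F c) ^+ 2) <= 4 / n%:R.
Proof.
have inl_inj : injective (@inl 'I_n 'I_m) by move=> ? ? [].
have le1 x : `|(x <= c)%R%:R : R| <= 1 by rewrite ger0_norm// lern1; case: (x <= c).
have := mean_sqr_lln indepZ n0 inl_inj (fun=> erefl) (bray c) le1.
rewrite (mean_rel_kernel FE) (_ : (2 * 1) ^+ 2 = 4); last by ring.
apply: le_trans; rewrite le_eqVlt; apply/orP; left; apply/eqP.
apply: eq_mean => w; congr ((_ * _ - _) ^+ 2); apply: eq_bigr => i _.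
by rewrite ext1E.
Qed.

Lemma mean_ecdf c : mean P (fun w => ecdf m (ext2 (Z^~ w)) c) = G c.
Proof.
have [mZ _] := indepZ.
have bj (j : 'I_m) : bmfun (fun w => (ext2 (Z^~ w) j <= c)%R%:R : R).
  exact: (bmfun_compr (measurable_ext2 mZ j) (bray c)).
rewrite /ecdf meanZ; last by apply: bmfun_sum => j _; exact: bj.
rewrite mean_sum; last by move=> j _; exact: bj.
rewrite (eq_bigr (fun=> G c)) => [|j _].
  rewrite sumr_const card_ord -[G c *+ m]mulr_natl mulrA mulVf ?mul1r//.
  by rewrite pnatr_eq0 -lt0n.
transitivity (mean rho (fun x : R => (x <= c)%R%:R : R)); last exact: (mean_rel_kernel GE).
rewrite -(mean_coord indepZ (inr j) (bray c)).
by apply: eq_mean => w; rewrite ext2E.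
Qed.

End ecdf_moments.

Section bootstrap.
Context {R : realType} {d : measure_display} {Omega : measurableType d}.
Variables (P : probability Omega R) (n m : nat).
Variables (X Y Xs Ys : nat -> Omega -> R).
Hypotheses (mX : forall i, measurable_fun setT (X i)).
Hypotheses (mY : forall i, measurable_fun setT (Y i)).
Hypotheses (mXs : forall i, measurable_fun setT (Xs i)).
Hypotheses (mYs : forall i, measurable_fun setT (Ys i)).
Hypotheses (n0 : (0 < n)%N) (m0 : (0 < m)%N).
Hypothesis bootP : bootstrap_samples P n m X Y Xs Ys.
Local Notation I := ('I_n + 'I_m)%type.
Local Notation J := ({ffun 'I_n -> 'I_n} * {ffun 'I_m -> 'I_m})%type.
Local Notation Z := (@data R d Omega n m X Y).
Local Notation Zs := (@boot R d Omega n m Xs Ys).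
Local Notation Fh w := (ecdf n (X^~ w)).
Local Notation Gh w := (ecdf m (Y^~ w)).
Local Notation law w := (@boot_law R n m (Z^~ w)).

Let indepB w : indep_law (law w) (fun i t => coords t i)
  (fun i => if i is inl _ then empirical n (X^~ w) else empirical m (Y^~ w)) :=
  indep_boot_law n0 m0 (X^~ w) (Y^~ w).

Let mZ := @measurable_data _ _ _ n m _ _ mX mY.

Let mCoords (z : I -> R) k : measurable_fun setT (fun t => join2 z (@coords R I t) k).
Proof. by case: k => i; [exact: measurable_cst|exact: measurable_coords]. Qed.

Let bmjoint_join2 (H : (I + I -> R) -> R) (z : I -> R) :
  bmjoint H -> bmjoint (fun z' => H (join2 z z')).
Proof. by move=> bH; exact: (bmjoint_comp (mCoords z) bH). Qed.

(** Freezing the data, averaging under [boot_law] and then averaging over the data recovers the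
    unconditional mean. *)
Lemma mean_boot (H : (I + I -> R) -> R) : bmjoint H ->
  bmfun (fun w => mean (law w) (fun t => H (join2 (Z^~ w) (coords t)))) /\
  mean P (fun w => H (join2 (Z^~ w) (Zs^~ w))) =
  mean P (fun w => mean (law w) (fun t => H (join2 (Z^~ w) (coords t)))).
Proof.
move=> bH.
have E w : mean (law w) (fun t => H (join2 (Z^~ w) (coords t))) =
    boot_mean (fun z => H (join2 (Z^~ w) z)) (Z^~ w).
  by rewrite (mean_boot_law _ (bmjoint_join2 _ bH)).
split.
  apply: (eq_bmfun E); apply: bmfunZ; apply: bmfun_sum => j _.
  by apply: (bmjoint_comp _ bH); exact: measurable_join2.
rewrite (mean_disintegration mX mY mXs mYs n0 m0 bootP bH).
by apply: eq_mean => w; rewrite E.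
Qed.

Lemma mean_boot_le (H : (I + I -> R) -> R) (c : R) : bmjoint H ->
  (forall w, mean (law w) (fun t => H (join2 (Z^~ w) (coords t))) <= c) ->
  mean P (fun w => H (join2 (Z^~ w) (Zs^~ w))) <= c.
Proof.
by move=> bH Hc; have [b ->] := mean_boot bH; exact: le_mean_cst.
Qed.

Let zl (z : I + I -> R) (i : I) := z (inl i).
Let zr (z : I + I -> R) (i : I) := z (inr i).

Let m1 k : measurable_fun setT (fun t : #|{: I + I}|.-tuple R => ext1 (zl (coords t)) k).
Proof. by apply: (measurable_ext1 (Z := fun i t => coords t (inl i))) => i; exact: measurable_coords. Qed.
Let m2 k : measurable_fun setT (fun t : #|{: I + I}|.-tuple R => ext2 (zl (coords t)) k).
Proof. by apply: (measurable_ext2 (Z := fun i t => coords t (inl i))) => i; exact: measurable_coords. Qed.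
Let m1' k : measurable_fun setT (fun t : #|{: I + I}|.-tuple R => ext1 (zr (coords t)) k).
Proof. by apply: (measurable_ext1 (Z := fun i t => coords t (inr i))) => i; exact: measurable_coords. Qed.
Let m2' k : measurable_fun setT (fun t : #|{: I + I}|.-tuple R => ext2 (zr (coords t)) k).
Proof. by apply: (measurable_ext2 (Z := fun i t => coords t (inr i))) => i; exact: measurable_coords. Qed.

Section moments.
Variables (mu rho : probability R R) (F G : R -> R).
Hypothesis indepZ : indep_law P Z (fun i => if i is inl _ then mu else rho).
Hypothesis FE : forall x, fine (mu `]-oo, x]%classic) = F x.
Hypothesis GE : forall x, fine (rho `]-oo, x]%classic) = G x.

Lemma mean_ecdf_data c : mean P (fun w => Gh w c) = G c.
Proof.
rewrite -(mean_ecdf indepZ GE m0 c); apply: eq_mean => w.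
by rewrite ecdf_ext2.
Qed.

Lemma mean_sqr_ecdf_data c : mean P (fun w => (Fh w c - F c) ^+ 2) <= 4 / n%:R.
Proof.
have := mean_sqr_ecdf indepZ FE n0 c; congr (_ <= _); apply: eq_mean => w.
by rewrite ecdf_ext1.
Qed.

Lemma mean_ecdf_boot c : mean P (fun w => ecdf m (Ys^~ w) c) = G c.
Proof.
pose H (z : I + I -> R) := ecdf m (ext2 (zr z)) c.
have bH : bmjoint H by apply: (bmfun_ecdf (y := fun k t => ext2 (zr (coords t)) k)) => //.
have [_] := mean_boot bH.
rewrite (@eq_mean _ _ _ P _ (fun w => ecdf m (Ys^~ w) c)); last first.
  by move=> w; rewrite /H -(@ecdf_ext2 R n m (Xs^~ w) (Ys^~ w)).
move=> ->; rewrite -mean_ecdf_data; apply: eq_mean => w.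
by apply: (mean_ecdf (indepB w) _ m0) => x; exact: empirical_ray.
Qed.

(** Given the data, the mean square error around their empirical distribution function is at most
    4/n, and that function is itself within 4/n of [F] in mean square; (u + v)^2 <= 2 u^2 + 2 v^2
    gives 16/n. *)
Lemma mean_sqr_ecdf_boot c : mean P (fun w => (ecdf n (Xs^~ w) c - F c) ^+ 2) <= 16 / n%:R.
Proof.
pose H (z : I + I -> R) := (ecdf n (ext1 (zr z)) c - ecdf n (ext1 (zl z)) c) ^+ 2.
have bH : bmjoint H.
  apply: bmfunX; apply: bmfunB.
    by apply: (bmfun_ecdf (y := fun k t => ext1 (zr (coords t)) k)).
  by apply: (bmfun_ecdf (y := fun k t => ext1 (zl (coords t)) k)).
have bs : mean P (fun w => (ecdf n (Xs^~ w) c - Fh w c) ^+ 2) <= 4 / n%:R.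
  rewrite (@eq_mean _ _ _ P _ (fun w => H (join2 (Z^~ w) (Zs^~ w)))); last first.
    move=> w; rewrite /H -(@ecdf_ext1 R n m (Xs^~ w) (Ys^~ w)).
    by rewrite -(@ecdf_ext1 R n m (X^~ w) (Y^~ w)).
  apply: (mean_boot_le bH) => w.
  have := mean_sqr_ecdf (indepB w) (fun x => empirical_ray (X^~ w) x n0) n0 c.
  by rewrite -{1}(@ecdf_ext1 R n m (X^~ w) (Y^~ w)).
have bX (V : nat -> Omega -> R) : (forall i, measurable_fun setT (V i)) ->
    bmfun (fun w => ecdf n (V^~ w) c) by move=> mV; exact: bmfun_ecdf.
have b1 : bmfun (fun w => (ecdf n (Xs^~ w) c - Fh w c) ^+ 2).
  by apply/bmfunX/bmfunB; exact: bX.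
have b2 : bmfun (fun w => (Fh w c - F c) ^+ 2).
  by apply/bmfunX/bmfunB; [exact: bX|exact: bmfun_cst].
apply: (@le_trans _ _ (mean P (fun w => 2 * (ecdf n (Xs^~ w) c - Fh w c) ^+ 2 +
    2 * (Fh w c - F c) ^+ 2))).
  apply: le_mean.
  - by apply/bmfunX/bmfunB; [exact: bX|exact: bmfun_cst].
  - by apply: bmfunD; exact: bmfunZ.
  - move=> w; move: (ecdf n _ c) (Fh w c) => u v.
    by have := sqr_ge0 (u - v - (v - F c)); lra.
rewrite (meanD P (bmfunZ 2 b1) (bmfunZ 2 b2)) (meanZ P 2 b1) (meanZ P 2 b2).
have := mean_sqr_ecdf_data c; move: bs; lra.
Qed.

End moments.

Section conditional_mean.
Variable h : R * R -> R.
Hypothesis bh : bounded_continuous h.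

(** The mean of [h] at the bootstrap error with the data frozen. By [mean_boot_error] it has the
    integrals of the conditional expectation over data events. *)
Definition cond_mean (w : Omega) : R :=
  mean (law w) (fun t => h (sample_error (Fh w) (Gh w) (coords t))).

Let joint_error (z : I + I -> R) : R * R :=
  sample_error (ecdf n (ext1 (zl z))) (ecdf m (ext2 (zl z))) (zr z).

Let joint_error_boot w : h (joint_error (join2 (Z^~ w) (Zs^~ w))) =
  h (rescaled_error n (ecdf n (Xs^~ w)) (ecdf m (Ys^~ w)) (Fh w) (Gh w)).
Proof.
rewrite /joint_error /sample_error -(@ecdf_ext1 R n m (X^~ w) (Y^~ w)) -(@ecdf_ext2 R n m (X^~ w) (Y^~ w)).
by rewrite -(@ecdf_ext1 R n m (Xs^~ w) (Ys^~ w)) -(@ecdf_ext2 R n m (Xs^~ w) (Ys^~ w)).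
Qed.

Let cond_meanE w : mean (law w) (fun t => h (joint_error (join2 (Z^~ w) (coords t)))) =
  cond_mean w.
Proof.
apply: eq_mean => t; rewrite /joint_error -(@ecdf_ext1 R n m (X^~ w) (Y^~ w)).
by rewrite -(@ecdf_ext2 R n m (X^~ w) (Y^~ w)).
Qed.

Let bmjoint_error : bmjoint (fun z => h (joint_error z)).
Proof.
have bhm := bmfun_continuous bh.
apply: (@bmfun_compr _ _ _ _ _ (fun t : #|{: I + I}|.-tuple R => joint_error (coords t)) h) => //.
apply: measurable_fun_pair => /=; apply: bmfun_meas; apply: bmfunZ; apply: bmfunB.
- by apply: (bmfun_rel_effect_ecdf (x := fun k t => ext1 (zr (coords t)) k)
    (y := fun k t => ext2 (zr (coords t)) k)).
- by apply: (bmfun_rel_effect_ecdf (x := fun k t => ext1 (zl (coords t)) k)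
    (y := fun k t => ext2 (zl (coords t)) k)).
- by apply: (bmfun_overlap_ecdf (x := fun k t => ext1 (zr (coords t)) k)
    (y := fun k t => ext2 (zr (coords t)) k)).
- by apply: (bmfun_overlap_ecdf (x := fun k t => ext1 (zl (coords t)) k)
    (y := fun k t => ext2 (zl (coords t)) k)).
Qed.

Lemma bmfun_cond_mean : bmfun cond_mean.
Proof.
have [b _] := mean_boot bmjoint_error; apply: eq_bmfun b => w.
by rewrite cond_meanE.
Qed.

(** The indicator of a data event is a function of the data vector, so it comes out of the average
    with the data frozen. *)
Lemma mean_boot_error (D : set Omega) : data_sigma n m X Y D ->
  mean P (fun w => \1_D w *
    h (rescaled_error n (ecdf n (Xs^~ w)) (ecdf m (Ys^~ w)) (Fh w) (Gh w))) =
  mean P (fun w => \1_D w * cond_mean w).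
Proof.
move=> /data_sigma_preimage[B mB ->].
pose tl (z : I + I -> R) : #|{: I}|.-tuple R := joint_tuple (fun i (_ : unit) => z (inl i)) tt.
have tlE z z' : tl (join2 (fun i => z i) z') = joint_tuple (fun i (_ : unit) => z i) tt by [].
have mtl : measurable_fun setT (fun t : #|{: I + I}|.-tuple R => tl (coords t)).
  by apply: (measurable_joint_tuple (Z := fun i t => coords t (inl i))) => i; exact: measurable_coords.
have bH : bmjoint (fun z => \1_B (tl z) * h (joint_error z)).
  apply: (bmfunM (f := fun t => \1_B (tl (coords t)))) bmjoint_error.
  by apply: (bmfun_compr mtl); exact: bmfun_indic.
have [_] := mean_boot bH.
rewrite (@eq_mean _ _ _ P _ (fun w => \1_(joint_tuple Z @^-1` B) w *
    h (rescaled_error n (ecdf n (Xs^~ w)) (ecdf m (Ys^~ w)) (Fh w) (Gh w)))); last first.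
  by move=> w; rewrite joint_error_boot.
move=> ->; apply: eq_mean => w; rewrite -cond_meanE -meanZ//.
exact: (bmjoint_join2 (Z^~ w) bmjoint_error).
Qed.

End conditional_mean.

End bootstrap.

Section bootstrap_error.
Context {R : realType} {d : measure_display} {Omega : measurableType d}.
Variables (P : probability Omega R) (n m : nat).
Variables (X Y Xs Ys : nat -> Omega -> R).
Hypotheses (mX : forall i, measurable_fun setT (X i)).
Hypotheses (mY : forall i, measurable_fun setT (Y i)).
Hypotheses (mXs : forall i, measurable_fun setT (Xs i)).
Hypotheses (mYs : forall i, measurable_fun setT (Ys i)).
Hypotheses (n0 : (0 < n)%N) (m0 : (0 < m)%N).
Hypothesis bootP : bootstrap_samples P n m X Y Xs Ys.
Local Notation I := ('I_n + 'I_m)%type.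
Local Notation Z := (@data R d Omega n m X Y).
Local Notation Fh w := (ecdf n (X^~ w)).
Local Notation Gh w := (ecdf m (Y^~ w)).
Local Notation emp1 w := (empirical n (X^~ w)).
Local Notation emp2 w := (empirical m (Y^~ w)).
Local Notation law w := (@boot_law R n m (Z^~ w)).
Variable x0 : R.

Lemma mean_boot_gap :
  bmfun (fun w => mean (law w) (fun t => Num.sqrt n%:R * sample_gap x0 (coords t))) /\
  mean P (fun w => mean (law w) (fun t => Num.sqrt n%:R * sample_gap x0 (coords t))) =
  mean P (fun w => Num.sqrt n%:R * ecdf_gap n m x0 (Xs^~ w) (Ys^~ w)).
Proof.
pose H (z : I + I -> R) := Num.sqrt n%:R * sample_gap x0 (fun i => z (inr i)).
have bH : bmjoint H.
  apply: bmfunZ; apply: (bmfun_sample_gap (Z := fun i t => coords t (inr i))) => // i.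
  exact: measurable_coords.
have [b E] := mean_boot mX mY mXs mYs n0 m0 bootP bH.
split; first exact: b.
rewrite -E; apply: eq_mean => w; congr (_ * _).
by rewrite -sample_gapE.
Qed.

Lemma population_gap_empirical w :
  population_gap (emp1 w) (emp2 w) (Fh w) (Gh w) x0 = ecdf_gap n m x0 (X^~ w) (Y^~ w).
Proof.
rewrite /population_gap ecdf_gapE// theta_empirical//.
exact: bmfun_overlap_kernel_id.
Qed.

Variables (mu rho : probability R R) (nu : R).
Hypothesis indepZ : indep_law P Z (fun i => if i is inl _ then mu else rho).
Variables (h : R * R -> R) (e c C : R) (l : seq (R * R * R * R)).
Hypothesis bh : bounded_continuous h.
Hypothesis levy : forall w, `|@cond_mean R d Omega n m X Y h w - c| <=
  e + C * (mean (law w) (fun t => Num.sqrt n%:R * sample_gap x0 (coords t)) +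
           Num.sqrt n%:R * population_gap (emp1 w) (emp2 w) (Fh w) (Gh w) x0) +
  \sum_(t <- l) `|t.1.1.1| * (cos_error n m (trig_weight t) +
    `|limit_var (emp1 w) (emp2 w) (n%:R / m%:R) (comb_kernel x0 t.1.1.2 t.1.2) -
      limit_var mu rho nu (comb_kernel x0 t.1.1.2 t.1.2)| / 2).

Definition var_error (n m : nat) (nu B : R) : R :=
  16 * B ^+ 2 * ((Num.sqrt n%:R)^-1 + (Num.sqrt m%:R)^-1) * (1 + n%:R / m%:R) +
  `|n%:R / m%:R - nu| * (2 * B) ^+ 2.

(** The pointwise bound [levy] integrated over the data: the conditional mean of the resampled gap
    becomes its unconditional mean, and the population gap becomes the gap of the data. *)
Lemma mean_cond_mean_error : mean P (fun w => `|@cond_mean R d Omega n m X Y h w - c|) <=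
  e + C * (mean P (fun w => Num.sqrt n%:R * ecdf_gap n m x0 (Xs^~ w) (Ys^~ w)) +
           mean P (fun w => Num.sqrt n%:R * ecdf_gap n m x0 (X^~ w) (Y^~ w))) +
  \sum_(t <- l) `|t.1.1.1| * (cos_error n m (trig_weight t) +
    var_error n m nu (trig_weight t) / 2).
Proof.
have [bA EA] := mean_boot_gap; rewrite -EA.
set A := (fun w => mean (law w) _) in bA *.
pose B w := Num.sqrt n%:R * ecdf_gap n m x0 (X^~ w) (Y^~ w).
have bB : bmfun B.
  by apply: bmfunZ; exact: bmfun_ecdf_gap.
pose D (t : R * R * R * R) w :=
  `|limit_var (emp1 w) (emp2 w) (n%:R / m%:R) (comb_kernel x0 t.1.1.2 t.1.2) -
      limit_var mu rho nu (comb_kernel x0 t.1.1.2 t.1.2)|.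
have bD t : bmfun (D t).
  apply: bmfun_norm; apply: bmfunB (bmfun_cst _).
  exact: (bmfun_limit_var_empirical indepZ n0 m0 (bmfun_comb_kernel _ _ _)).
have DE t : mean P (D t) <= var_error n m nu (trig_weight t).
  exact: (mean_limit_var_empirical indepZ n0 m0 (bmfun_comb_kernel _ _ _)
    (comb_kernel_le _ _ _)).
pose E t w := `|t.1.1.1| * (cos_error n m (trig_weight t) + 2^-1 * D t w).
have bE t : bmfun (E t).
  by apply: bmfunZ; apply: bmfunD; [exact: bmfun_cst|exact: bmfunZ].
have bAB := bmfunZ C (bmfunD bA bB).
have bS : bmfun (fun w => \sum_(t <- l) E t w) by apply: bmfun_sum => t _; exact: bE.
have beAB := bmfunD (bmfun_cst e) bAB.
apply: (@le_trans _ _ (mean P (fun w => e + C * (A w + B w) + \sum_(t <- l) E t w))).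
  apply: le_mean; [|exact: bmfunD|].
    by apply: bmfun_norm; apply: bmfunB (bmfun_cst _); exact: (bmfun_cond_mean mX mY mXs mYs n0 m0 bootP bh).
  move=> w; apply: (le_trans (levy w)); rewrite population_gap_empirical lerD2l.
  by apply: ler_sum => t _; rewrite /E -/(D t w) [2^-1 * _]mulrC.
rewrite (meanD P beAB bS) (meanD P (bmfun_cst e) bAB) mean_cst (meanZ P C (bmfunD bA bB)).
rewrite (meanD P bA bB) lerD2l mean_sum; last by move=> t _; exact: bE.
apply: ler_sum => t _.
rewrite /E meanZ; last by apply: bmfunD; [exact: bmfun_cst|exact: bmfunZ].
rewrite ler_wpM2l// (meanD P (bmfun_cst _) (bmfunZ 2^-1 (bD t))) mean_cst lerD2l.
by rewrite (meanZ P 2^-1 (bD t)) mulrC ler_pM2r// invr_gt0.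
Qed.

End bootstrap_error.

Section error_limits.
Context {R : realType}.
Variables (n m : nat -> nat) (nu : R).
Hypotheses (n_oo : n @ \oo --> \oo) (m_oo : m @ \oo --> \oo).
Hypothesis nm_nu : (n k)%:R / (m k)%:R @[k --> \oo] --> nu.

Lemma cvg_var_error (B : R) : var_error (n k) (m k) nu B @[k --> \oo] --> (0 : R).
Proof.
have u0 := cvg_inv_sqrt (R := R) n_oo; have v0 := cvg_inv_sqrt (R := R) m_oo.
have w0 : `|(n k)%:R / (m k)%:R - nu| @[k --> \oo] --> (0 : R).
  rewrite -(normr0 R) -(subrr nu); apply: cvg_norm.
  by apply: cvgB nm_nu _; exact: cvg_cst.
have -> : (0 : R) = 16 * B ^+ 2 * (0 + 0) * (1 + nu) + 0 * (2 * B) ^+ 2 by ring.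
apply: cvgD; last by apply: cvgM w0 _; exact: cvg_cst.
apply: cvgM; last by apply: cvgD nm_nu; exact: cvg_cst.
by apply: cvgM; [exact: cvg_cst|exact: cvgD].
Qed.

Lemma cvg_levy_error (l : seq (R * R * R * R)) :
  (\sum_(t <- l) `|t.1.1.1| * (cos_error (n k) (m k) (trig_weight t) +
    var_error (n k) (m k) nu (trig_weight t) / 2)) @[k --> \oo] --> (0 : R).
Proof.
elim: l => [|t l IH].
  by under eq_fun do rewrite big_nil; exact: cvg_cst.
under eq_fun do rewrite big_cons.
have h1 := cvg_cos_error n_oo m_oo nm_nu (trig_weight t).
have h2 : var_error (n k) (m k) nu (trig_weight t) / 2 @[k --> \oo] --> 0 / (2 : R).
  by apply: cvgM; [exact: cvg_var_error|exact: cvg_cst].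
have h3 : `|t.1.1.1| * (cos_error (n k) (m k) (trig_weight t) +
    var_error (n k) (m k) nu (trig_weight t) / 2) @[k --> \oo] --> `|t.1.1.1| * (0 + 0 / (2 : R)).
  by apply: cvgM; [exact: cvg_cst|exact: cvgD].
have := cvgD h3 IH.
by rewrite mul0r !addr0 mulr0; apply.
Qed.

End error_limits.

(** * Arbitrary versions of the conditional expectation *)

Section conditional_expectation.
Context {R : realType} {d : measure_display} {Omega : measurableType d}.
Variables (P : probability Omega R) (S : set (set Omega)) (Z W A : Omega -> R).
Hypothesis condW : cond_expectation P S Z W.
Hypothesis bA : bmfun A.
Hypothesis ZA : forall D, S D -> measurable D /\
  mean P (fun w => \1_D w * Z w) = mean P (fun w => \1_D w * A w).

(** On an event of [S], [W] may be replaced by [A] under the integral. With [s] equal to 1 or -1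
    according to the sign of [W - c], Markov's inequality passes from [A] to [W] without showing
    that they agree almost surely. *)
Lemma cond_expectation_half (s c e : R) (D : set Omega) : `|s| <= 1 -> S D ->
  (forall w, D w -> e <= s * (W w - c)) ->
  e * fine (P D) <= mean P (fun w => `|A w - c|).
Proof.
move=> s1 SD De; have [mD E] := ZA SD; have [iW _ WZ] := condW.
have iWD : P.-integrable D (EFin \o W) by exact: integrableS iW.
have EW : \int[P]_(w in D) W w = mean P (fun w => \1_D w * A w).
  rewrite -E /Rintegral WZ// integral_mkcond /mean /Rintegral; congr fine.
  apply: eq_integral => w _; rewrite patchE indicE; case: ifP => _.
    by rewrite mul1r.
  by rewrite mul0r.
have b1 : bmfun (\1_D : Omega -> R) by exact: bmfun_indic.
have b1A : bmfun (fun w => \1_D w * A w) by exact: bmfunM.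
have lo : (e + s * c) * fine (P D) <= s * mean P (fun w => \1_D w * A w).
  rewrite -EW -RintegralZl// -Rintegral_cst//; apply: le_Rintegral => //.
  - by apply: measurable_bounded_integrable => //;
      [rewrite (le_lt_trans (probability_le1 _ _))// ltry|exact: bounded_cst].
  - exact: (integrableZl _ _ iWD).
  - by move=> w Dw; have := De w Dw; lra.
have bd : bmfun (fun w => `|A w - c|) by apply: bmfun_norm; apply: bmfunB (bmfun_cst _).
have hi : s * mean P (fun w => \1_D w * A w) - s * c * fine (P D) <=
    mean P (fun w => `|A w - c|).
  rewrite -(mean_indic P mD) -(meanZ P _ b1A) -(meanZ P (s * c) b1).
  rewrite -(meanB P (bmfunZ s b1A) (bmfunZ (s * c) b1)).
  apply: le_mean => //; first by apply: bmfunB; exact: bmfunZ.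
  move=> w; rewrite (_ : _ - _ = \1_D w * (s * (A w - c))); last by ring.
  rewrite (le_trans (ler_norm _))// normrM normrM mulrA ler_piMl//.
  rewrite mulr_ile1// indicE; case: (w \in D); rewrite ?normr0 ?normr1//.
by move: lo hi; rewrite mulrDl; lra.
Qed.

Lemma cond_expectation_deviation (c e : R) : 0 < e ->
  (P [set w | (e <= `|W w - c|)%R] <= (2 / e * mean P (fun w => `|A w - c|))%:E)%E.
Proof.
move=> e0; have [_ SW _] := condW.
(* The deviation is split by sign; both halves belong to [S] because [W] is [S]-measurable, and they
   account for the factor 2. *)
pose D1 := W @^-1` [set x | c + e <= x]; pose D2 := W @^-1` [set x | x <= c - e].
have S1 : S D1.
  by apply: SW; rewrite (_ : [set x | _] = `[c + e, +oo[%classic)//;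
    apply/seteqP; split => x /=; rewrite in_itv/= andbT.
have S2 : S D2.
  by apply: SW; rewrite (_ : [set x | _] = `]-oo, c - e]%classic)//;
    apply/seteqP; split => x /=; rewrite in_itv.
have [mD1 _] := ZA S1; have [mD2 _] := ZA S2.
have -> : [set w | (e <= `|W w - c|)%R] = D1 `|` D2.
  apply/seteqP; split => w /=; rewrite ler_normr /D1 /D2/=.
    by move=> /orP[h|h]; [left|right]; lra.
  by case=> h; apply/orP; [left|right]; lra.
have h1 := @cond_expectation_half 1 c e D1 _ S1.
have h2 := @cond_expectation_half (-1) c e D2 _ S2.
apply: (le_trans (measureU2 _ mD1 mD2)).
rewrite -(fineK (fin_num_measure P _ mD1)) -(fineK (fin_num_measure P _ mD2)) -EFinD lee_fin.
rewrite mulrAC ler_pdivlMr// mulrC.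
have {}h1 : e * fine (P D1) <= mean P (fun w => `|A w - c|).
  by apply: h1; rewrite ?normr1// => w; rewrite /D1/=; lra.
have {}h2 : e * fine (P D2) <= mean P (fun w => `|A w - c|).
  by apply: h2; rewrite ?normrN1// => w; rewrite /D2/=; lra.
by rewrite mulrDr; lra.
Qed.

End conditional_expectation.

(** * Convergence of the sample errors, the bootstrap errors and the conditional laws *)

Section bootstrap_consistency.
Context {d : measure_display} {Omega : measurableType d} {R : realType}.
Variables (P : probability Omega R) (F G f g : R -> R) (X Y : nat -> {RV P >-> R}).
Hypotheses (cdfX : forall i x, cdf (X i) x = (F x)%:E).
Hypotheses (cdfY : forall j x, cdf (Y j) x = (G x)%:E).
Hypothesis indepXY : mutually_independent P (two_samples X Y).
Hypotheses (densF : continuous_density F f) (densG : continuous_density G g).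
Hypothesis f0 : f (quantile F (1 / 2)) != 0.
Variables (n m : nat -> nat) (nu : R).
Hypotheses (nu_ge0 : 0 <= nu) (n_oo : n @ \oo --> \oo) (m_oo : m @ \oo --> \oo).
Hypothesis nm_nu : (n k)%:R / (m k)%:R @[k --> \oo] --> nu.
Variables Xs Ys : nat -> nat -> {RV P >-> R}.
Hypothesis bootP : forall k, bootstrap_samples P (n k) (m k) X Y (Xs k) (Ys k).

Local Notation x0 := (quantile F (1 / 2)).
Local Notation mu := (distribution P (X 0)).
Local Notation rho := (distribution P (Y 0)).
Local Notation Z k := (@data R d Omega (n k) (m k) X Y).
Local Notation Fh k w := (ecdf (n k) (fun i => X i w)).
Local Notation Gh k w := (ecdf (m k) (fun j => Y j w)).
Local Notation Fs k w := (ecdf (n k) (fun i => Xs k i w)).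
Local Notation Gs k w := (ecdf (m k) (fun j => Ys k j w)).

Let mX i : measurable_fun setT (X i).
Proof. exact: measurable_funPT. Qed.
Let mY i : measurable_fun setT (Y i).
Proof. exact: measurable_funPT. Qed.
Let mXs k i : measurable_fun setT (Xs k i).
Proof. exact: measurable_funPT. Qed.
Let mYs k i : measurable_fun setT (Ys k i).
Proof. exact: measurable_funPT. Qed.

Let FE x : fine (mu `]-oo, x]%classic) = F x.
Proof. by have := cdfX 0 x; rewrite /cdf => ->. Qed.
Let GE x : fine (rho `]-oo, x]%classic) = G x.
Proof. by have := cdfY 0 x; rewrite /cdf => ->. Qed.

Let indepZ k := indep_data cdfX cdfY indepXY (n k) (m k).

Definition limit_form (a b : R) : R := limit_var mu rho nu (comb_kernel x0 a b).

Variable L : probability (R * R)%type R.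
Hypothesis charL : forall a b c, mean L (fun z => cos (a * z.1 + b * z.2 + c)) =
  expR (- (limit_form a b / 2)) * cos c.

Let limit_form_ge0 a b : 0 <= limit_form a b.
Proof. exact: limit_var_ge0. Qed.

Variable h : R * R -> R.
Hypothesis bh : bounded_continuous h.

Let near_data_gap (e : R) : 0 < e -> \forall k \near \oo,
  mean P (fun w => Num.sqrt (n k)%:R * ecdf_gap (n k) (m k) x0 (X^~ w) (Y^~ w)) <= e.
Proof.
apply: (near_mean_ecdf_gap n_oo m_oo FE densF densG f0 (x := fun=> X) (y := fun=> Y)
  (fun=> mX) (fun=> mY) (K := 4)) => k z nk mk.
  exact: (mean_sqr_ecdf_data nk (indepZ k) FE).
exact: (mean_ecdf_data mk (indepZ k) GE).
Qed.

Let near_boot_gap (e : R) : 0 < e -> \forall k \near \oo,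
  mean P (fun w => Num.sqrt (n k)%:R * ecdf_gap (n k) (m k) x0 ((Xs k)^~ w) ((Ys k)^~ w)) <= e.
Proof.
apply: (near_mean_ecdf_gap n_oo m_oo FE densF densG f0 (x := fun k => Xs k) (y := fun k => Ys k)
  (fun k => mXs k) (fun k => mYs k) (K := 16)) => k z nk mk.
  exact: (mean_sqr_ecdf_boot mX mY (mXs k) (mYs k) nk mk (@bootP k) (indepZ k) FE).
exact: (mean_ecdf_boot mX mY (mXs k) (mYs k) nk mk (@bootP k) (indepZ k) GE).
Qed.

Lemma near_mean_error (e : R) : 0 < e -> \forall k \near \oo,
  `|mean P (fun w => h (rescaled_error (n k) (Fh k w) (Gh k w) F G)) - mean L h| <= e.
Proof.
move=> e0; have nu1 : 0 <= nu + 1 by rewrite addr_ge0.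
have e40 : 0 < e / 4 by rewrite divr_gt0.
have [C C0 [l Hl]] := sample_levy charL limit_form_ge0 bh nu1 e40.
(* The gap is made small relative to [C + 1], because [C] may be 0. *)
have C1 : 0 < C + 1 by rewrite ltr_wpDl.
have eC : 0 < e / 4 / (C + 1) by rewrite divr_gt0.
near=> k.
have nk : (0 < n k)%N by near: k; exact: near_size_gt0.
have mk : (0 < m k)%N by near: k; exact: near_size_gt0.
have nmk : (n k)%:R / (m k)%:R <= nu + 1 by near: k; apply: (cvgr_le nu) => //; rewrite ltrDl.
have lk : \sum_(t <- l) `|t.1.1.1| * (cos_error (n k) (m k) (trig_weight t) +
    var_error (n k) (m k) nu (trig_weight t) / 2) <= e / 4.
  by near: k; apply: (cvgr_le 0) => //; exact: cvg_levy_error.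
have gk : mean P (fun w => Num.sqrt (n k)%:R * ecdf_gap (n k) (m k) x0 (X^~ w) (Y^~ w)) <=
  e / 4 / (C + 1) by near: k; exact: near_data_gap.
have := Hl _ _ _ _ P (Z k) mu rho F G x0 (indepZ k) FE GE nk mk nmk.
rewrite (population_gap_median FE GE (cdf_median densF FE)) mulr0 addr0.
rewrite (@eq_mean _ _ _ P _ (fun w => h (rescaled_error (n k) (Fh k w) (Gh k w) F G))); last first.
  move=> w; rewrite /sample_error.
  by rewrite (@ecdf_ext1 R (n k) (m k) (X^~ w) (Y^~ w)) (@ecdf_ext2 R (n k) (m k) (X^~ w) (Y^~ w)).
rewrite (@eq_mean _ _ _ P (fun w => _ * sample_gap _ _)
   (fun w => Num.sqrt (n k)%:R * ecdf_gap (n k) (m k) x0 (X^~ w) (Y^~ w))); last first.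
  by move=> w; congr (_ * _); exact: sample_gapE.
move=> /le_trans; apply.
have Cg : C * mean P (fun w => Num.sqrt (n k)%:R * ecdf_gap (n k) (m k) x0 (X^~ w) (Y^~ w)) <=
    e / 4.
  apply: (le_trans (ler_wpM2l C0 gk)); rewrite mulrCA ler_piMr ?(ltW e40)//.
  by rewrite ler_pdivrMr// mul1r lerDl.
apply: (@le_trans _ _ (e / 4 + e / 4 + e / 4)); last by lra.
apply: lerD; first by rewrite lerD.
apply: le_trans lk; apply: ler_sum => t _; apply: ler_wpM2l => //.
rewrite lerD2l ler_pM2r ?invr_gt0//.
rewrite /limit_form /limit_var opprD addrACA subrr add0r -mulrBl normrM.
have V0 : 0 <= var2 mu rho (comb_kernel x0 t.1.1.2 t.1.2).
  by apply: mean_ge0 => y; exact: sqr_ge0.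
have := var2_le mu rho (bmfun_comb_kernel x0 t.1.1.2 t.1.2) (comb_kernel_le x0 t.1.1.2 t.1.2).
rewrite (ger0_norm V0) -/(trig_weight t) => V2.
rewrite /var_error (le_trans (ler_wpM2l (normr_ge0 _) V2))// lerDr.
by rewrite !mulr_ge0 ?addr_ge0 ?divr_ge0 ?invr_ge0 ?sqrtr_ge0 ?sqr_ge0.
Unshelve. all: by end_near.
Qed.

Local Notation cm k := (@cond_mean R d Omega (n k) (m k) X Y h).

(** [indep_boot_law] holds for every realisation of the data, so the bound for independent samples
    is available pointwise. Its random terms, two gaps and the variances, are small in mean, which
    is why the conclusion is in L1. *)
Lemma near_mean_cond_mean (e : R) : 0 < e -> \forall k \near \oo,
  mean P (fun w => `|cm k w - mean L h|) <= e.
Proof.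
move=> e0; have e4E : e / 4 + (e / 4 + e / 4) + e / 4 <= e by lra.
have nu1 : 0 <= nu + 1 by rewrite addr_ge0.
have e40 : 0 < e / 4 by rewrite divr_gt0.
have [C C0 [l Hl]] := sample_levy charL limit_form_ge0 bh nu1 e40.
have C1 : 0 < C + 1 by rewrite ltr_wpDl.
have eC : 0 < e / 4 / (C + 1) by rewrite divr_gt0.
apply: filter_app (near_boot_gap eC); near=> k => bk.
have nk : (0 < n k)%N by near: k; exact: near_size_gt0.
have mk : (0 < m k)%N by near: k; exact: near_size_gt0.
have nmk : (n k)%:R / (m k)%:R <= nu + 1 by near: k; apply: (cvgr_le nu) => //; rewrite ltrDl.
have lk : \sum_(t <- l) `|t.1.1.1| * (cos_error (n k) (m k) (trig_weight t) +
    var_error (n k) (m k) nu (trig_weight t) / 2) <= e / 4.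
  by near: k; apply: (cvgr_le 0) => //; exact: cvg_levy_error.
have gk : mean P (fun w => Num.sqrt (n k)%:R * ecdf_gap (n k) (m k) x0 (X^~ w) (Y^~ w)) <=
  e / 4 / (C + 1) by near: k; exact: near_data_gap.
have levy w := Hl (n k) (m k) _ _ (@boot_law R (n k) (m k) ((Z k)^~ w)) (fun i t => coords t i)
  (empirical (n k) (X^~ w)) (empirical (m k) (Y^~ w)) (Fh k w) (Gh k w) x0
  (indep_boot_law nk mk (X^~ w) (Y^~ w))
  (fun x => empirical_ray (X^~ w) x nk) (fun x => empirical_ray (Y^~ w) x mk) nk mk nmk.
have main := @mean_cond_mean_error R d Omega P (n k) (m k) X Y (Xs k) (Ys k) mX mY (mXs k) (mYs k)
  nk mk (@bootP k) x0 mu rho nu (indepZ k) h (e / 4) (mean L h) C l bh levy.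
move: main.
move=> /le_trans; apply.
apply: (le_trans _ e4E).
apply: lerD => //; rewrite lerD2l mulrDr; apply: lerD.
  apply: (le_trans (ler_wpM2l C0 bk)); rewrite mulrCA ler_piMr ?(ltW e40)//.
  by rewrite ler_pdivrMr// mul1r lerDl.
apply: (le_trans (ler_wpM2l C0 gk)); rewrite mulrCA ler_piMr ?(ltW e40)//.
by rewrite ler_pdivrMr// mul1r lerDl.
Unshelve. all: by end_near.
Qed.

(** The unconditional law is covered by [mean_boot_error] with the sure event as data event. *)
Lemma near_mean_boot_error (e : R) : 0 < e -> \forall k \near \oo,
  `|mean P (fun w => h (rescaled_error (n k) (Fs k w) (Gs k w) (Fh k w) (Gh k w))) - mean L h| <= e.
Proof.
move=> e0; near=> k.
have nk : (0 < n k)%N by near: k; exact: near_size_gt0.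
have mk : (0 < m k)%N by near: k; exact: near_size_gt0.
have ST : data_sigma (n k) (m k) X Y setT.
  by rewrite -setC0; apply: sigma_algebraC; exact: sigma_algebra0.
have := mean_boot_error mX mY (mXs k) (mYs k) nk mk (@bootP k) bh ST.
rewrite indicT; under eq_mean do rewrite mul1r.
move=> ->; under eq_mean do rewrite mul1r.
have bc := bmfun_cond_mean mX mY (mXs k) (mYs k) nk mk (@bootP k) bh.
rewrite -(mean_cst P (mean L h)) -(meanB P bc (bmfun_cst _)).
apply: le_trans (norm_mean _ (bmfunB bc (bmfun_cst _))) _.
by near: k; exact: near_mean_cond_mean.
Unshelve. all: by end_near.
Qed.

(** The probability of a deviation of [W k] by [e] is at most 2/e times the L1 distance of [cm k] to
    the limit, by [cond_expectation_deviation]. *)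
Lemma cvg_cond_expectation (W : nat -> Omega -> R) :
  (forall k, cond_expectation P (data_sigma (n k) (m k) X Y)
    (h \o (fun w => rescaled_error (n k) (Fs k w) (Gs k w) (Fh k w) (Gh k w))) (W k)) ->
  cvg_in_probability P W (mean L h).
Proof.
move=> condW e e0.
have M0 : (fun k => (2 / e * mean P (fun w => `|cm k w - mean L h|))%:E) @ \oo --> 0%E.
  apply: cvg_EFin; first by apply: nearW.
  have -> : (0 : R) = 2 / e * 0 by rewrite mulr0.
  apply: cvgM; first exact: cvg_cst.
  apply/cvgrPdist_le => e' e'0; near=> k.
  rewrite sub0r normrN ger0_norm; last by apply: mean_ge0.
  by near: k; exact: near_mean_cond_mean.
apply: (squeeze_cvge _ (cvg_cst 0%E) M0); near=> k.
have nk : (0 < n k)%N by near: k; exact: near_size_gt0.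
have mk : (0 < m k)%N by near: k; exact: near_size_gt0.
rewrite measure_ge0 /=.
apply: (cond_expectation_deviation (condW k)) => //.
  exact: (bmfun_cond_mean mX mY (mXs k) (mYs k) nk mk (@bootP k) bh).
move=> D SD; split; last exact: (mean_boot_error mX mY (mXs k) (mYs k) nk mk (@bootP k) bh SD).
have [B mB ->] := data_sigma_preimage SD.
rewrite -[X in measurable X]setTI; apply: (measurable_joint_tuple _ measurableT mB).
exact: measurable_data.
Unshelve. all: by end_near.
Qed.

End bootstrap_consistency.

Theorem theorem4p1 (d : measure_display) (Omega : measurableType d)
    (R : realType) (P : probability Omega R)
    (F G f g : R -> R)
    (X Y : nat -> {RV P >-> R})
    (cdfX : forall i x, cdf (X i) x = (F x)%:E)
    (cdfY : forall j x, cdf (Y j) x = (G x)%:E)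
    (indepXY : mutually_independent P (two_samples X Y))
    (densF : continuous_density F f) (densG : continuous_density G g)
    (slope_defined : forall t, 0 < t < 1 -> f (quantile F t) != 0)
    (slope_bounded : forall a b, 0 < a -> a < b -> b < 1 ->
       exists M : R, forall t, a < t < b -> `|roc_slope F f g t| <= M)
    (n m : nat -> nat) (nu : R) (nu_gt0 : 0 < nu)
    (n_oo : n @ \oo --> \oo) (m_oo : m @ \oo --> \oo)
    (nm_nu : (n k)%:R / (m k)%:R @[k --> \oo] --> nu)
    (Xs Ys : nat -> nat -> {RV P >-> R})
    (boot : forall k, bootstrap_samples P (n k) (m k) X Y (Xs k) (Ys k)) :
  let Fhat k w := ecdf (n k) (fun i => X i w) in
  let Ghat k w := ecdf (m k) (fun j => Y j w) in
  let Fboot k w := ecdf (n k) (fun i => Xs k i w) in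
  let Gboot k w := ecdf (m k) (fun j => Ys k j w) in
  let err k w := rescaled_error (n k) (Fhat k w) (Ghat k w) F G in
  let err_boot k w :=
    rescaled_error (n k) (Fboot k w) (Gboot k w) (Fhat k w) (Ghat k w) in
  exists L : probability (R * R)%type R,
    [/\ bivariate_normal L,
        cvg_in_distribution P err L,
        cvg_in_distribution P err_boot L &
        cond_cvg_in_distribution P
          (fun k => data_sigma (n k) (m k) X Y) err_boot L].
Proof.
move=> Fhat Ghat Fboot Gboot err err_boot.
(* Level 1/2 is the median, where a nonzero density locates the sample medians near [x0] and so
   controls the overlap remainder. *)
have f0 : f (quantile F (1 / 2)) != 0 by apply: slope_defined; lra.
have nu0 := ltW nu_gt0.
have [s sE] := limit_var_comb (distribution P (X 0%N)) (distribution P (Y 0%N)) nu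
  (quantile F (1 / 2)).
(* The limiting variances form a nonnegative quadratic form, hence come from one Gaussian law, which
   serves as the limit in all three convergences. *)
have [|L [normL charL]] := @gaussian_law_exists R s.1.1 s.1.2 s.2.
  by move=> a b; rewrite -sE; exact: limit_var_ge0.
have charL' a b c : mean L (fun z => cos (a * z.1 + b * z.2 + c)) =
    expR (- (limit_form F X Y nu a b / 2)) * cos c by rewrite charL /limit_form sE.
exists L; split => //.
- move=> h bh; apply/cvgrPdist_le => e e0; near=> k; rewrite distrC; near: k.
  exact: (near_mean_error cdfX cdfY indepXY densF densG f0 nu0 n_oo m_oo nm_nu charL' bh e0).
- move=> h bh; apply/cvgrPdist_le => e e0; near=> k; rewrite distrC; near: k.
  exact: (near_mean_boot_error cdfX cdfY indepXY densF densG f0 nu0 n_oo m_oo nm_nu boot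
    charL' bh e0).
- move=> h bh W condW.
  exact: (cvg_cond_expectation cdfX cdfY indepXY densF densG f0 nu0 n_oo m_oo nm_nu boot
    charL' bh condW).
Unshelve. all: by end_near.
Qed.
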